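(* Let $\mu$ be a symmetric probability measure on $\mathrm{Homeo}^+(\mathbf{R})$ whose support is finite and generates an irreducible group $G$ without discrete orbits. Let $\mathcal{M}$ be the unique minimal nonempty closed $G$-invariant subset of $\mathbf{R}$. Then the nonzero $P$-invariant Radon measure is unique up to a scalar factor (any two nonzero $P$-invariant Radon measures on $\mathbf{R}$ are positive scalar multiples of each other), and any such measure $\nu$ has support equal to $\mathcal{M}$. Moreover, for such $\nu$, for all continuous compactly supported functions $\varphi,\psi:\mathbf{R}\to\mathbf{R}$ with $\varphi\ge 0$ and $\int\varphi\,d\nu>0$, and for every $x\in\mathbf{R}$, almost surely $$\frac{\psi(X_1^x)+\cdots+\psi(X_N^x)}{\varphi(X_1^x)+\cdots+\varphi(X_N^x)}\longrightarrow\frac{\int\psi\,d\nu}{\int\varphi\,d\nu}\qquad\text{as } N\to\infty .$$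
   Context: $\mathrm{Homeo}^+(\mathbf{R})$ is the group of orientation-preserving (increasing) homeomorphisms of the real line. A measure $\mu$ is symmetric if $\mu(g)=\mu(g^{-1})$ for all $g$. A group $G\subset\mathrm{Homeo}^+(\mathbf{R})$ is irreducible if it has no global fixed point in $\mathbf{R}$. A discrete orbit is a $G$-orbit that is a closed discrete subset of $\mathbf{R}$. It is known that a finitely generated irreducible group $G$ without discrete orbits has a unique minimal nonempty closed $G$-invariant set $\mathcal{M}\subset\mathbf{R}$, contained in the closure of every orbit. Let $g_1,g_2,\dots$ be i.i.d. random homeomorphisms with distribution $\mu$, $f_n=g_n\circ\cdots\circ g_1$ and $X_n^x=f_n(x)$. The transition operator is $P\varphi(x)=\sum_g\mu(g)\varphi(g(x))$, and a (positive) Radon measure $\nu$ on $\mathbf{R}$ is $P$-invariant if $\nu=\sum_g\mu(g)\,g_\star\nu$. *)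

(* Defs.v *)
From HB Require Import structures.
From mathcomp Require Import all_boot all_order all_algebra finmap.
From mathcomp Require Import all_classical all_reals all_analysis.

Set Implicit Arguments.
Unset Strict Implicit.
Unset Printing Implicit Defensive.
Import Order.TTheory GRing.Theory Num.Theory.
Import numFieldNormedType.Exports.

Local Open Scope classical_set_scope.
Local Open Scope ring_scope.

(* Homeo^+(R): increasing homeomorphisms of the real line. *)
Record homeo (R : realType) := Homeo {
  homeo_fun :> R -> R ;
  homeo_incr : {homo homeo_fun : x y / x < y} ;
  homeo_cont : continuous homeo_fun ;
  homeo_inv : exists2 h : R -> R, continuous h &
                cancel homeo_fun h /\ cancel h homeo_fun }.

HB.instance Definition _ (R : realType) := gen_eqMixin (homeo R).
HB.instance Definition _ (R : realType) := gen_choiceMixin (homeo R).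

Section homeo_group.
Context {R : realType}.
Implicit Types f g h : homeo R.

Lemma homeoP f g : (forall x, f x = g x) -> f = g.
Proof.
case: f g => [f f1 f2 f3] [g g1 g2 g3] /= /funext fg; subst g.
by congr Homeo; exact: Prop_irrelevance.
Qed.

Definition homeo1 : homeo R.
Proof.
apply: (@Homeo R id) => //; first by move=> x; exact: cvg_id.
by exists id => //; move=> x; exact: cvg_id.
Defined.

Definition homeoM (f g : homeo R) : homeo R.
Proof.
apply: (@Homeo R (f \o g)).
- by move=> x y xy /=; do 2 apply: homeo_incr.
- by move=> x; apply: continuous_comp; exact: homeo_cont.
- have [f' cf' [ff' f'f]] := homeo_inv f; have [g' cg' [gg' g'g]] := homeo_inv g.
  exists (g' \o f'); last by split; apply: can_comp.
  by move=> x; apply: continuous_comp; [exact: cf'|exact: cg'].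
Defined.

Definition homeo_invfun (f : homeo R) : R -> R := s2val (cid2 (homeo_inv f)).

Lemma homeo_invfun_cont f : continuous (homeo_invfun f).
Proof. exact: (s2valP (cid2 (homeo_inv f))). Qed.

Lemma homeoVK f : cancel f (homeo_invfun f).
Proof. by have [] := s2valP' (cid2 (homeo_inv f)). Qed.

Lemma homeoKV f : cancel (homeo_invfun f) f.
Proof. by have [] := s2valP' (cid2 (homeo_inv f)). Qed.

Lemma homeo_invfun_incr f : {homo homeo_invfun f : x y / x < y}.
Proof.
move=> x y xy; rewrite ltNge le_eqVlt; apply/negP => /orP[/eqP e|l].
  by move: xy; rewrite -(homeoKV f x) -(homeoKV f y) e ltxx.
by have := homeo_incr f l; rewrite !homeoKV => /(lt_trans xy); rewrite ltxx.
Qed.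

Definition homeoV (f : homeo R) : homeo R :=
  Homeo (@homeo_invfun_incr f) (@homeo_invfun_cont f)
    (ex_intro2 _ _ (f : R -> R) (@homeo_cont R f)
       (conj (homeoKV f) (homeoVK f))).

Lemma homeoMA : associative homeoM. Proof. by move=> f g h; exact: homeoP. Qed.
Lemma homeo1M : left_id homeo1 homeoM. Proof. by move=> f; exact: homeoP. Qed.
Lemma homeoM1 : right_id homeo1 homeoM. Proof. by move=> f; exact: homeoP. Qed.
Lemma homeoVM : left_inverse homeo1 homeoV homeoM.
Proof. by move=> f; apply: homeoP => x /=; exact: homeoVK. Qed.
Lemma homeoMV : right_inverse homeo1 homeoV homeoM.
Proof. by move=> f; apply: homeoP => x /=; exact: homeoKV. Qed.

End homeo_group.

HB.instance Definition _ (R : realType) := isPointed.Build (homeo R) homeo1.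
HB.instance Definition _ (R : realType) :=
  isGroup.Build (homeo R) homeoMA homeo1M homeoM1 homeoVM homeoMV.

(* The sigma-algebra generated by the evaluations g |-> g x; it is the Borel
   sigma-algebra of the compact-open topology, and singletons are measurable
   (measurable_homeo_set1). *)
Section homeo_measurable.
Context {R : realType}.

Definition homeo_measurable : set (set (homeo R)) :=
  <<s \bigcup_(x in [set: R])
        preimage_set_system setT (fun g : homeo R => g x) measurable >>.

Let homeo_measurable0 : homeo_measurable set0.
Proof. exact: sigma_algebra0. Qed.

Let homeo_measurableC (U : set (homeo R)) :
  homeo_measurable U -> homeo_measurable (~` U).
Proof. exact: sigma_algebraC. Qed.

Let homeo_measurableU (F : (set (homeo R))^nat) :
  (forall i, homeo_measurable (F i)) -> homeo_measurable (\bigcup_i F i).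
Proof. exact: sigma_algebra_bigcup. Qed.

Definition homeo_display : measure_display.
Proof. by constructor. Qed.

HB.instance Definition _ := @isMeasurable.Build homeo_display (homeo R)
  homeo_measurable homeo_measurable0 homeo_measurableC homeo_measurableU.

Lemma measurable_homeo_eval (x : R) (A : set R) : measurable A ->
  measurable [set g : homeo R | A (g x)].
Proof.
by move=> mA; apply: sub_gen_smallest; exists x => //; exists A; rewrite ?setTI.
Qed.

Lemma measurable_homeo_set1 (g : homeo R) : measurable [set g].
Proof.
rewrite (_ : [set g] =
    \bigcap_(q in [set: rat]) [set h : homeo R | [set g (ratr q)] (h (ratr q))]).
  rewrite -[X in measurable X]setCK setC_bigcap; apply: measurableC.
  by apply: bigcupT_measurable_rat => q; apply: measurableC;
    exact: measurable_homeo_eval.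
apply/seteqP; split => [h -> //|h hg]; apply: homeoP => x.
have [//|ne] := pselect (h x = g x); exfalso.
have oD : open [set y : R | h y != g y].
  rewrite (_ : [set _ | _] = (h \- g) @^-1` [set y | y != 0]).
    apply: open_comp; last exact: open_neq.
    by move=> y _; apply: cvgB; exact: homeo_cont.
  by apply/seteqP; split => y /=; rewrite subr_eq0.
have D0 : [set y : R | h y != g y] !=set0 by exists x; apply/eqP.
have [y [/= ny [q _ qy]]] := @dense_rat R _ D0 oD.
by move: ny; rewrite -qy (hg q I) eqxx.
Qed.

End homeo_measurable.

Section measures_on_homeo.
Context {R : realType} (mu : probability (homeo R) R).

(* mu has finite support iff it is carried by finitely many atoms; its support
   is then the set of its atoms. *)
Definition atoms : set (homeo R) := [set g | (0 < mu [set g])%E].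

Definition finitely_supported := finite_set atoms /\ mu atoms = 1%E.

Definition symmetric_measure := forall g : homeo R, mu [set g] = mu [set g^-1%g].

(* nu = \sum_g mu(g) g_* nu *)
Definition P_invariant (nu : {measure set (measurableTypeR R) -> \bar R}) :=
  forall A : set (measurableTypeR R), measurable A ->
    nu A = (\sum_(g \in atoms) mu [set g] *
      pushforward nu (g : measurableTypeR R -> measurableTypeR R) A)%E.

End measures_on_homeo.

Section measures_on_line.
Context {R : realType} (nu : {measure set (measurableTypeR R) -> \bar R}).

(* On R, a Borel measure that is finite on compact sets is regular. *)
Definition radon := forall K : set R, compact K -> (nu K < +oo)%E.

Definition nonzero_measure := nu [set: R] != 0%E.

Definition msupport : set R :=
  [set x | forall U : set R, open U -> U x -> (0 < nu U)%E].

End measures_on_line.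

Definition compactly_supported (R : realType) (f : R -> R) :=
  compact (closure [set x | f x != 0]).

Section group_actions.
Context {R : realType}.
Implicit Types (G A : set (homeo R)) (F M : set R).

Definition is_subgroup G := [/\ G 1%g,
  (forall g h, G g -> G h -> G (g * h)%g) & (forall g, G g -> G g^-1%g)].

Definition generated_group A := smallest is_subgroup A.

Definition irreducible G := ~ exists x : R, forall g, G g -> g x = x.

Definition homeo_orbit G (x : R) : set R := [set g x | g in G].

Definition discrete_orbit G (x : R) :=
  closed (homeo_orbit G x) /\ homeo_orbit G x `<=` isolated (homeo_orbit G x).

Definition closed_invariant G F :=
  [/\ F !=set0, closed F & forall g, G g -> g @` F `<=` F].

Definition minimal_closed_invariant G M :=
  closed_invariant G M /\
  forall F, closed_invariant G F -> F `<=` M -> F = M.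

End group_actions.

Section random_walk.
Context d (Omega : measurableType d) {R : realType} (P : probability Omega R).

Definition mutually_independent (g : nat -> {RV P >-> homeo R}) :=
  forall (I : {fset nat}) (A : nat -> set (homeo R)),
    (forall i, measurable (A i)) ->
    P (\bigcap_(i in [set` I]) (g i @^-1` A i)) =
      (\prod_(i <- I) P (g i @^-1` A i))%E.

Definition iid (mu : probability (homeo R) R)
    (g : nat -> {RV P >-> homeo R}) :=
  mutually_independent g /\
  forall n (A : set (homeo R)), measurable A -> distribution P (g n) A = mu A.

(* f_n = g_n o ... o g_1, where the i.i.d. sequence is indexed from 0: the
   n-th increment g_n of the walk is (g n.-1). *)
Fixpoint walk (g : nat -> {RV P >-> homeo R}) (n : nat) (w : Omega) : homeo R :=
  if n is n'.+1 then (g n' w * walk g n' w)%g else 1%g.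

End random_walk.

(* Main.v *)
Require Import Defs.
From HB Require Import structures.
From mathcomp Require Import all_boot all_order all_algebra finmap.
From mathcomp Require Import all_classical all_reals all_analysis.
From mathcomp Require Import measurable_realfun.
From mathcomp Require Import ring lra.
Set Implicit Arguments.
Unset Strict Implicit.
Unset Printing Implicit Defensive.
Import Order.TTheory GRing.Theory Num.Theory.
Import numFieldNormedType.Exports.
Local Open Scope classical_set_scope.
Local Open Scope ring_scope.

(* Write P for the transition operator.  Duality for symmetric increments shows
   that bounded monotone harmonic functions are constant, hence that the walk is
   recurrent: it visits some fixed interval infinitely often from every point.
   Recurrence and the absence of discrete orbits imply that an invariant Radon
   measure nu charges neither points nor the gaps of an orbit closure.  Its
   distribution function D is therefore continuous, onto and a semiconjugacy to
   a minimal system of homeomorphisms t |-> h_i(t) with sum_i p_i h_i(t) = t +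
   const, i.e. preserving Lebesgue measure on average.  There P does not increase
   Lipschitz constants, so the potentials of a Lipschitz function phi for the walk
   killed at rate e xi are equi-Lipschitz, and as e -> 0 they converge, up to
   constants, to approximate solutions h of the Poisson equation
   h - P h = phi - c xi.  The constant c is the ratio of the integrals of phi and xi
   for every invariant measure, which gives uniqueness; and an exponential
   supermartingale built from h bounds sum (phi - c xi)(X_n) by
   eta * sum xi(X_n) + O(1) almost surely, which gives the ratio limit for phi
   against xi.  Squeezing step functions between Lipschitz functions of D extends
   both conclusions to continuous compactly supported functions. *)

(** * Random walks by symmetric finite systems of homeomorphisms *)

(** Passing to the quotient by D is what makes Lipschitz estimates available. The original maps have
    no modulus of continuity that P controls, whereas on the quotient two walkers driven by the same
    increments keep their mean distance. Killing is proportional to xi, not constant, so that the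
    potentials of phi and of C xi - phi add up exactly to C: they stay bounded as e -> 0, and
    inequalities proved for both become equalities. The price is that killing disturbs the Lipschitz
    estimate. The correction in [pot_lip] pays for it, and it requires xi + P xi to be bounded below
    on the support of xi. The Poisson equation is solved only up to eta * xi, because v_e / e is
    used at a small fixed e. An error proportional to xi is harmless for ratios against xi. The
    constant c is found before any measure enters; a measure is then tested against it. *)

Record symmetric_ifs (R : realType) (I : finType) (p : I -> R)
    (F : I -> R -> R) (s : I -> I) : Prop := SymmetricIFS {
  ifs_gt0 : forall i, 0 < p i ;
  ifs_sum : \sum_i p i = 1 ;
  ifs_incr : forall i, {homo F i : x y / x < y} ;
  ifs_inv : involutive s ;
  ifs_sym : forall i, p (s i) = p i ;
  ifs_K : forall i, cancel (F i) (F (s i)) ;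
  ifs_nofix : forall x, exists i, F i x != x }.

Definition avg (R : realType) (I : finType) (p : I -> R) (F : I -> R -> R)
  (f : R -> R) (x : R) : R := \sum_i p i * f (F i x).

(** The first letter is applied first: words are read in the order of time, and appending a letter
    is one more step of the walk. *)
Definition act (R : realType) (I : finType) (F : I -> R -> R)
  (w : seq I) (x : R) : R := foldl (fun y i => F i y) x w.

Section averaging.
Context {R : realType} {I : finType} (p : I -> R) (F : I -> R -> R) (s : I -> I).
Hypothesis H : symmetric_ifs p F s.
Local Notation A := (avg p F).
Implicit Types (f g h t u : R -> R) (x y z : R) (i : I) (n : nat).

Lemma p_ge0 i : 0 <= p i. Proof. exact: ltW (ifs_gt0 H i). Qed.

Lemma ifs_KV i : cancel (F (s i)) (F i).
Proof. by move=> x; rewrite -{1}(ifs_inv H i) (ifs_K H). Qed.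

Lemma ifs_ltE i x y : (F i x < F i y) = (x < y).
Proof.
apply/idP/idP; last exact: (ifs_incr H).
by move=> /(ifs_incr H (s i)); rewrite !(ifs_K H).
Qed.

Lemma ifs_leE i x y : (F i x <= F i y) = (x <= y).
Proof. by rewrite !leNgt ifs_ltE. Qed.

Lemma ifs_lt_adj i x y : (F i x < y) = (x < F (s i) y).
Proof. by rewrite -{1}(ifs_KV i y) ifs_ltE. Qed.

Lemma ifs_le_adj i x y : (F i x <= y) = (x <= F (s i) y).
Proof. by rewrite -{1}(ifs_KV i y) ifs_leE. Qed.

Lemma sum_sym (f : I -> R) : \sum_i p i * f i = \sum_i p i * f (s i).
Proof.
rewrite (reindex_inj (inv_inj (ifs_inv H))) /=.
by apply: eq_bigr => i _; rewrite (ifs_sym H).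
Qed.

Lemma avg_le f g x : (forall i, f (F i x) <= g (F i x)) -> A f x <= A g x.
Proof.
by move=> fg; apply: ler_sum => i _; rewrite ler_pM2l ?(ifs_gt0 H).
Qed.

Lemma avg_lin (a b : R) f g x :
  A (fun y => a * f y + b * g y) x = a * A f x + b * A g x.
Proof.
rewrite /avg !mulr_sumr -big_split; apply: eq_bigr => i _ /=; ring.
Qed.

Lemma avg_cst (c : R) x : A (fun=> c) x = c.
Proof. by rewrite /avg -mulr_suml (ifs_sum H) mul1r. Qed.

Lemma avgB f g x : A (fun y => f y - g y) x = A f x - A g x.
Proof.
have := avg_lin 1 (-1) f g x; rewrite mul1r mulN1r => <-.
by apply: eq_bigr => i _; rewrite mul1r mulN1r.
Qed.

Lemma avgZ a f x : A (fun y => a * f y) x = a * A f x.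
Proof. by rewrite /avg mulr_sumr; apply: eq_bigr => i _; ring. Qed.

Lemma eq_avg f g x : (forall y, f y = g y) -> A f x = A g x.
Proof. by move=> fg; apply: eq_bigr => i _; rewrite fg. Qed.

(** Equality case of the maximum principle: every [p i] is positive, so one value below [c] would
    pull the mean below [c]. *)
Lemma avg_eq1 f x (c : R) : (forall y, f y <= c) -> c <= A f x ->
  forall i, f (F i x) = c.
Proof.
move=> fc cA i; apply/eqP; rewrite eq_le fc leNgt; apply/negP => fi.
suff : A f x < c by rewrite ltNge cA.
rewrite -(avg_cst c x) /avg (bigD1 i) //= [ltRHS](bigD1 i) //=.
apply: ltr_leD; first by rewrite ltr_pM2l ?(ifs_gt0 H).
by apply: ler_sum => j _; rewrite ler_pM2l ?(ifs_gt0 H).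
Qed.

Lemma avg_term f x i : (forall y, 0 <= f y) -> p i * f (F i x) <= A f x.
Proof.
move=> f0; rewrite /avg (bigD1 i) //= lerDl; apply: sumr_ge0 => j _.
by rewrite mulr_ge0 ?p_ge0.
Qed.

Lemma avg_cvg (T : Type) (G : set_system T) {GF : Filter G} (f : T -> R -> R) h x :
  (forall y, f n y @[n --> G] --> h y) -> A (f n) x @[n --> G] --> A h x.
Proof.
move=> fh; rewrite /avg; apply: (@cvg_big R I +%R 0 xpredT (@add_continuous R^o)) => i _.
apply: cvgM; first exact: cvg_cst.
exact: fh.
Qed.

Lemma iter_avg_le n f g x : (forall y, f y <= g y) ->
  iter n A f x <= iter n A g x.
Proof.
move=> fg; elim: n x => [|n IHn] x /=; first exact: fg.
by apply: avg_le => i; exact: IHn.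
Qed.

Lemma iter_avg_lin n (a b : R) f g x :
  iter n A (fun y => a * f y + b * g y) x = a * iter n A f x + b * iter n A g x.
Proof.
elim: n x => [//|n IHn] x /=; rewrite -avg_lin.
by apply: eq_avg => y; rewrite IHn.
Qed.

Lemma iter_avg_cst n (c : R) x : iter n A (fun=> c) x = c.
Proof.
elim: n x => [//|n IHn] x /=.
by rewrite -[RHS](avg_cst c x); apply: eq_avg.
Qed.

Lemma iter_avgD n f g x :
  iter n A (fun y => f y + g y) x = iter n A f x + iter n A g x.
Proof.
have := iter_avg_lin n 1 1 f g x; rewrite !mul1r => <-.
by congr (iter n A _ x); apply/funext => y; rewrite !mul1r.
Qed.

Lemma iter_avgZ n a f x : iter n A (fun y => a * f y) x = a * iter n A f x.
Proof.
elim: n x => [//|n IHn] x /=.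
by rewrite -avgZ; apply: eq_avg.
Qed.

Lemma iter_avg_harm n f x : (forall y, A f y = f y) -> iter n A f x = f x.
Proof.
move=> fh; elim: n x => [//|n IHn] x /=.
by rewrite -[RHS]fh; apply: eq_avg.
Qed.

Lemma iter_avg_sum n (J : Type) (r : seq J) (f : J -> R -> R) x :
  iter n A (fun y => \sum_(j <- r) f j y) x = \sum_(j <- r) iter n A (f j) x.
Proof.
elim: r => [|j r IHr].
  rewrite big_nil -[RHS](iter_avg_cst n 0 x).
  by congr (iter n A _ x); apply/funext => y; rewrite big_nil.
rewrite big_cons -IHr -iter_avgD.
by congr (iter n A _ x); apply/funext => y; rewrite big_cons.
Qed.

(* Siegmund-type duality: the walk started at x and the walk started at z see
   the relation rho in the same way, because the increments are symmetric. *)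
Lemma iter_avg_dual n (rho : R -> R -> R) :
  (forall i x y, rho (F i x) y = rho x (F (s i) y)) ->
  forall x z, iter n A (rho^~ z) x = iter n A (rho x) z.
Proof.
move=> rhoF; elim: n => [//|n IHn] x z.
rewrite [in RHS]iterSr [LHS]/= /avg.
under eq_bigr do rewrite IHn -iter_avgZ.
rewrite -iter_avg_sum; congr (iter n _ _ z); apply/funext => y.
rewrite [RHS]sum_sym; apply: eq_bigr => i _.
by rewrite rhoF.
Qed.

Lemma act_le w x y : (act F w x <= act F w y) = (x <= y).
Proof. by elim: w x y => [//|i w IHw] x y /=; rewrite IHw ifs_leE. Qed.

Lemma act_cat w w' x : act F (w ++ w') x = act F w' (act F w x).
Proof. by rewrite /act foldl_cat. Qed.

Lemma act_rcons w i x : act F (rcons w i) x = F i (act F w x).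
Proof. by rewrite -cats1 act_cat. Qed.

Lemma act_inv w : exists w', cancel (act F w) (act F w').
Proof.
elim: w => [|i w [w' e]]; first by exists [::].
by exists (rcons w' (s i)) => x; rewrite act_rcons /= e (ifs_K H).
Qed.

Lemma move_right x : exists i, x < F i x.
Proof.
have [i] := ifs_nofix H x; rewrite neq_lt => /orP[|] l; last by exists i.
by exists (s i); rewrite -(ifs_lt_adj i).
Qed.

Lemma move_left x : exists i, F i x < x.
Proof. by have [i] := move_right x; exists (s i); rewrite ifs_lt_adj (ifs_inv H). Qed.

(** A finite supremum of the orbit is impossible: some map moves it strictly to the left, while
    invariance of the orbit under the inverse map makes its image an upper bound again. *)
Lemma orbit_ubound x B : exists w, B < act F w x.
Proof.
apply: contrapT => /forallNP nB.
pose S := [set act F w x | w in setT].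
have S0 : S !=set0 by exists x, [::].
have SB : ubound S B by move=> _ [w _ <-]; rewrite leNgt; apply/negP/nB.
have hS : has_sup S by split => //; exists B.
have up y : S y -> y <= sup S by move=> Sy; apply: sup_upper_bound.
have [i] := move_left (sup S); rewrite ltNge => /negP; apply.
apply: sup_le_ub => // _ [w _ <-].
rewrite -(ifs_KV i (act F w x)) ifs_leE; apply: up.
by exists (rcons w (s i)) => //; rewrite act_rcons.
Qed.

Lemma orbit_lbound x B : exists w, act F w x < B.
Proof.
apply: contrapT => /forallNP nB.
pose S := [set act F w x | w in setT].
have S0 : S !=set0 by exists x, [::].
have hS : has_inf S.
  by split => //; exists B => _ [w _ <-]; rewrite leNgt; apply/negP/nB.
have lo y : S y -> inf S <= y by move=> Sy; apply: ge_inf => //; case: hS.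
have [i] := move_right (inf S); rewrite ltNge => /negP; apply.
apply: lb_le_inf => // _ [w _ <-].
rewrite -(ifs_KV i (act F w x)) ifs_leE; apply: lo.
by exists (rcons w (s i)) => //; rewrite act_rcons.
Qed.

Definition wp (w : seq I) : R := \prod_(i <- w) p i.

Lemma wp_gt0 w : 0 < wp w.
Proof. by apply: prodr_gt0 => i _; exact: (ifs_gt0 H). Qed.

(** Only the trajectory that spells [w] is kept in the expectation. *)
Lemma iter_avg_term w f x : (forall y, 0 <= f y) ->
  wp w * f (act F w x) <= iter (size w) A f x.
Proof.
move=> f0; elim: w x => [|i w IHw] x; first by rewrite /wp big_nil mul1r.
rewrite /wp big_cons -mulrA /=.
apply: (@le_trans _ _ (p i * iter (size w) A f (F i x))).
  by rewrite ler_pM2l ?(ifs_gt0 H)// IHw.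
apply: (avg_term (f := iter (size w) A f)) => y.
by rewrite -(iter_avg_cst (size w) 0 y); apply: iter_avg_le.
Qed.

End averaging.

(* The probability that the walk started at x visits K within n steps. *)
Fixpoint hit (R : realType) (I : finType) (p : I -> R) (F : I -> R -> R)
    (K : pred R) (n : nat) (x : R) : R :=
  if n is n'.+1 then (if K x then 1 else avg p F (hit p F K n') x)
  else (K x)%:R.

Definition hitting (R : realType) (I : finType) (p : I -> R) (F : I -> R -> R)
  (K : pred R) (x : R) : R := sup (range (fun n => hit p F K n x)).

Section monotone_harmonic.
Context {R : realType} {I : finType} (p : I -> R) (F : I -> R -> R) (s : I -> I).
Hypothesis H : symmetric_ifs p F s.
Local Notation A := (avg p F).
Implicit Types (f g h t : R -> R) (x y z : R) (i : I) (n : nat).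

(** h(X_n) is a martingale, so its mean squared increment is the increment of its second moment. *)
Lemma iter_avg_sqB h n x : (forall y, A h y = h y) ->
  iter n A (fun y => (h y - h x) ^+ 2) x = iter n A (fun y => h y ^+ 2) x - h x ^+ 2.
Proof.
move=> hh; have -> : (fun y => (h y - h x) ^+ 2) =
    (fun y => (1 * h y ^+ 2 + (- 2 * h x) * h y) + h x ^+ 2).
  by apply/funext => y; ring.
rewrite iter_avgD iter_avg_lin (iter_avg_cst H) (iter_avg_harm n x hh); ring.
Qed.

(** Duality for the relation < gives P_x(X_n < x) = P_x(X_n > x), so the first is at most 1/2. *)
Lemma half_le_iter_avg n x : 1 / 2 <= iter n A (fun y => (x <= y)%R%:R) x.
Proof.
have e1 : iter n A (fun y => (y < x)%R%:R) x = iter n A (fun y => (x < y)%R%:R) x.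
  by apply: (iter_avg_dual H n (rho := fun a b => (a < b)%R%:R)) => i a b; rewrite (ifs_lt_adj H).
have : iter n A (fun y => (y < x)%R%:R + (x <= y)%R%:R) x = 1.
  rewrite -[RHS](iter_avg_cst H n 1 x); congr (iter n A _ x).
  by apply/funext => y; case: ltP => _; rewrite ?addr0 ?add0r.
rewrite iter_avgD e1.
have : iter n A (fun y => (x < y)%R%:R) x <= iter n A (fun y => (x <= y)%R%:R) x.
  by apply: (iter_avg_le H) => y; rewrite ler_nat; case: (ltP x y) => [/ltW ->|].
lra.
Qed.

(* h(X_n) is an L^2-bounded martingale, so its increments over a fixed number
   of steps tend to 0; but from any point where h is in the middle of its range
   a fixed word pushes h close to its supremum.  So X_n leaves the middle part,
   and duality (half_le_iter_avg) then forces h >= 1/2 everywhere. *)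
Lemma monotone_harmonic_normalized h :
  {homo h : x y / x <= y} -> (forall x, A h x = h x) ->
  (forall x, 0 <= h x) -> (forall x, h x <= 1) ->
  (forall e, 0 < e -> exists x, h x < e) ->
  (forall e, 0 < e -> exists x, 1 - e < h x) -> False.
Proof.
move=> hmon hh h0 h1 hinf hsup.
have hpos x : 0 < h x.
  rewrite lt_neqAle h0 andbT; apply/negP => /eqP hx0.
  have [b hb] := hsup (1 / 2) ltac:(lra).
  have [w bw] := orbit_ubound H x b.
  have := iter_avg_term H w x h0.
  rewrite iter_avg_harm // -hx0 pmulr_rle0 ?(wp_gt0 H) //.
  have := hmon _ _ (ltW bw); lra.
(* Starting where h is small makes the final count fail: P(X_n >= x) would be below h x + e + e = 4
   e < 1/4, against 1/2. *)
have [x hx] := hinf (1 / 8) ltac:(lra).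
pose e : R := h x / 2.
have hx0 := hpos x.
have ex : h x = 2 * e by rewrite /e; lra.
have e0 : 0 < e by rewrite /e; lra.
have [a0 ha0] := hinf e e0.
have [b1 hb1] := hsup (e / 2) ltac:(lra).
have [w bw] := orbit_ubound H a0 b1.
(* From a point with e < h < 1 - e, the word [w] raises h above 1 - e/2, a jump of at least e/2; so
   m steps add at least k to the second moment of h. *)
pose m := size w; pose k : R := wp p w * (e / 2) ^+ 2.
have k0 : 0 < k by rewrite mulr_gt0 ?(wp_gt0 H) // exprn_gt0 //; lra.
pose C y : bool := (e < h y) && (h y < 1 - e).
have kC y : k * (C y)%:R <= iter m A (fun y => h y ^+ 2) y - h y ^+ 2.
  rewrite -iter_avg_sqB //.
  have := iter_avg_term H w (f := fun z => (h z - h y) ^+ 2) y (fun z => sqr_ge0 _).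
  apply: le_trans; rewrite /k -mulrA ler_pM2l ?(wp_gt0 H) //.
  case: (boolP (C y)) => [/andP[ey ye]|_]; last by rewrite mulr0 sqr_ge0.
  rewrite mulr1 lerXn2r ?nnegrE //; [lra| |].
    have : a0 <= y by rewrite leNgt; apply/negP => /ltW /hmon; lra.
    rewrite -(act_le H w) => /(le_trans (ltW bw)) /hmon; lra.
  have : a0 <= y by rewrite leNgt; apply/negP => /ltW /hmon; lra.
  rewrite -(act_le H w) => /(le_trans (ltW bw)) /hmon; lra.
pose a n := iter n A (fun y => h y ^+ 2) x.
have key n : k * iter n A (fun y => (C y)%:R) x <= a (n + m)%N - a n.
  rewrite -iter_avgZ /a iterD.
  have -> : iter n A (iter m A (fun y => h y ^+ 2)) x - iter n A (fun y => h y ^+ 2) x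
     = iter n A (fun z => 1 * iter m A (fun y => h y ^+ 2) z + (-1) * h z ^+ 2) x.
    by rewrite iter_avg_lin; ring.
  by apply: (iter_avg_le H) => y; have := kC y; lra.
have a_le1 n : a n <= 1.
  rewrite -(iter_avg_cst H n 1 x); apply: (iter_avg_le H) => y.
  by rewrite expr_le1.
(* The second moment is bounded by 1, so it cannot grow by k e over every block of m steps. *)
have [n an] : exists n, a (n + m)%N - a n < k * e.
  apply: contrapT => /forallNP an.
  have {}an n : k * e <= a (n + m)%N - a n by rewrite leNgt; apply/negP/an.
  have big j : k * e * j%:R <= a (j * m)%N.
    elim: j => [|j IHj].
      rewrite mulr0 /a -(iter_avg_cst H (0 * m) 0 x); apply: (iter_avg_le H) => y.
      exact: sqr_ge0.
    have := an (j * m)%N; rewrite mulSnr -natr1; lra.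
  have ke0 : 0 < k * e by rewrite mulr_gt0.
  have := big (Num.bound (1 / (k * e))).
  have := archi_boundP (ltW (divr_gt0 ltr01 ke0)).
  rewrite ltr_pdivrMr // mulrC.
  have := a_le1 (Num.bound (1 / (k * e)) * m)%N; lra.
have {an}Cn : iter n A (fun y => (C y)%:R) x < e.
  by rewrite -(ltr_pM2l k0); exact: le_lt_trans (key n) an.
have := half_le_iter_avg n x.
(* To the right of x one has h >= 2 e, so a point there lies in [C] unless h >= 1 - e. *)
have : iter n A (fun y => (x <= y)%R%:R) x <=
    iter n A (fun y => (h y + e) + (C y)%:R) x.
  apply: (iter_avg_le H) => y; case: (leP x y) => /= xy.
    have := hmon _ _ xy; have := h1 y; have := h0 y.
    by rewrite /C; case: (ltP e (h y)); case: (ltP (h y) (1 - e)) => /=; lra.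
  have := h0 y; case: (C y) => /=; lra.
rewrite !iter_avgD (iter_avg_cst H) (iter_avg_harm n x hh).
lra.
Qed.

Lemma monotone_harmonic_cst h B :
  {homo h : x y / x <= y} -> (forall x, A h x = h x) ->
  (forall x, `|h x| <= B) -> forall x y, h x = h y.
Proof.
move=> hmon hh hB.
suff le x y : h y <= h x by move=> x y; apply/eqP; rewrite eq_le !le.
rewrite leNgt; apply/negP => hxy.
have hB' z : - B <= h z <= B by rewrite -ler_norml.
pose S := range h.
have hs : has_sup S.
  by split; [exists (h x), x|exists B => _ [z _ <-]; case/andP: (hB' z)].
have hi : has_inf S.
  by split; [exists (h x), x|exists (- B) => _ [z _ <-]; case/andP: (hB' z)].
pose b := sup S; pose a := inf S.
have hb z : h z <= b by apply: sup_upper_bound => //; exists z.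
have ha z : a <= h z by apply: ge_inf; [case: hi|exists z].
have ab : 0 < b - a by have := hb y; have := ha x; lra.
apply: (@monotone_harmonic_normalized (fun z => (b - a)^-1 * (h z - a))).
- by move=> u v /hmon huv; rewrite ler_pM2l ?invr_gt0 // lerD2r.
- by move=> z; rewrite avgZ avgB (avg_cst H) hh.
- by move=> z; rewrite mulr_ge0 ?invr_ge0 ?subr_ge0 // ltW // -subr_gt0.
- by move=> z; rewrite mulrC ler_pdivrMr // mul1r lerD2r.
- move=> e e0; have [_ [z _ <-] hz] := @inf_adherent _ S (e * (b - a)) (mulr_gt0 e0 ab) hi.
  by exists z; rewrite mulrC ltr_pdivrMr // ltrBlDl.
- move=> e e0; have [_ [z _ <-] hz] := @sup_adherent _ S (e * (b - a)) (mulr_gt0 e0 ab) hs.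
  exists z; rewrite [ltRHS]mulrC ltr_pdivlMr //; move: hz; rewrite -/b; lra.
Qed.

End monotone_harmonic.

(** * Recurrence *)

Section hitting_theory.
Context {R : realType} {I : finType} (p : I -> R) (F : I -> R -> R) (s : I -> I).
Hypothesis H : symmetric_ifs p F s.
Local Notation A := (avg p F).
Implicit Types (K : pred R) (f g h t : R -> R) (x y z : R) (i : I) (n : nat).

Lemma hit_in K n x : K x -> hit p F K n x = 1.
Proof. by case: n => [|n] /= ->. Qed.

Lemma hit_out K n x : ~~ K x -> hit p F K n.+1 x = A (hit p F K n) x.
Proof. by move=> /negPf /= ->. Qed.

Lemma hit_ge0 K n x : 0 <= hit p F K n x.
Proof.
elim: n x => [|n IHn] x /=; first exact: ler0n.
by case: ifP => // _; apply: sumr_ge0 => i _; rewrite mulr_ge0 ?(p_ge0 H).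
Qed.

Lemma hit_le1 K n x : hit p F K n x <= 1.
Proof.
elim: n x => [|n IHn] x /=; first by case: (K x).
by case: ifP => // _; rewrite -(avg_cst H 1 x); apply: (avg_le H).
Qed.

Lemma hit_leS K n x : hit p F K n x <= hit p F K n.+1 x.
Proof.
elim: n x => [|n IHn] x; case: (boolP (K x)) => Kx; rewrite ?(hit_in _ Kx) //.
  by rewrite /= (negPf Kx); apply: sumr_ge0 => i _; rewrite mulr_ge0 ?(p_ge0 H).
by rewrite !(hit_out _ Kx); apply: (avg_le H).
Qed.

Lemma hit_cvg K x : hit p F K n x @[n --> \oo] --> hitting p F K x.
Proof.
apply: nondecreasing_cvgn; last by exists 1 => _ [n _ <-]; exact: hit_le1.
by apply/nondecreasing_seqP => n; exact: hit_leS.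
Qed.

Lemma hit_le_hitting K n x : hit p F K n x <= hitting p F K x.
Proof. by apply: sup_ubound; [exists 1 => _ [k _ <-]; exact: hit_le1|exists n]. Qed.

Lemma hitting_le K x c : (forall n, hit p F K n x <= c) -> hitting p F K x <= c.
Proof. by move=> hc; apply: sup_le_ub; [exists (hit p F K 0 x), 0%N|move=> _ [n _ <-]]. Qed.

Lemma hitting_le1 K x : hitting p F K x <= 1.
Proof. by apply: hitting_le => n; exact: hit_le1. Qed.

Lemma hitting_ge0 K x : 0 <= hitting p F K x.
Proof. exact: le_trans (hit_ge0 K 0 x) (hit_le_hitting _ _ _). Qed.

Lemma hitting_in K x : K x -> hitting p F K x = 1.
Proof.
move=> Kx; apply/eqP; rewrite eq_le hitting_le1 /=.
by rewrite -(hit_in 0 Kx) hit_le_hitting.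
Qed.

Lemma hitting_out K x : ~~ K x -> hitting p F K x = A (hitting p F K) x.
Proof.
move=> Kx; have h1 : A (hit p F K n) x @[n --> \oo] --> A (hitting p F K) x.
  by apply: avg_cvg => y; exact: hit_cvg.
have : hit p F K n.+1 x @[n --> \oo] --> hitting p F K x.
  by rewrite (@cvg_shiftS _ (fun n => hit p F K n x)); exact: hit_cvg.
under eq_fun do rewrite hit_out //.
move=> h2; exact: cvg_unique h2 h1.
Qed.

Lemma avg_hitting_le K x : A (hitting p F K) x <= hitting p F K x.
Proof.
case: (boolP (K x)) => Kx; last by rewrite (hitting_out Kx).
by rewrite (hitting_in Kx) -(avg_cst H 1 x); apply: (avg_le H) => i; exact: hitting_le1.
Qed.

(** The hitting probability is the least nonnegative superharmonic function that is at least 1 on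
    [K]. *)
Lemma superharmonic_ge_hit K t c : (forall x, A t x <= t x) -> (forall x, 0 <= t x) ->
  0 <= c -> (forall x, K x -> c <= t x) -> forall x, c * hitting p F K x <= t x.
Proof.
move=> At t0 c0 tK x.
have hn n y : c * hit p F K n y <= t y.
  elim: n y => [|n IHn] y; case: (boolP (K y)) => Ky; rewrite ?(hit_in _ Ky) ?mulr1 ?tK //.
    by rewrite /= (negPf Ky) mulr0.
  rewrite hit_out // -avgZ; apply: le_trans (At y).
  by apply: (avg_le H).
have : c * hit p F K n x @[n --> \oo] --> c * hitting p F K x.
  by apply: cvgM; [exact: cvg_cst|exact: hit_cvg].
move=> cv; have <- := cvg_lim (@Rhausdorff R) cv.
by apply: limr_le; [apply/cvg_ex; eexists; exact: cv|apply: nearW => n; exact: hn].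
Qed.

(* The probability kappa of entering ]-oo, y] infinitely often does not depend
   on the starting point, and kappa <= kappa * r by the Markov property. *)
Lemma hitting_le_eq1 y x : hitting p F (fun z => z <= y) x = 1.
Proof.
pose K z := z <= y; pose r := hitting p F K.
rewrite -/K -/r.
have hmon n u v : u <= v -> hit p F K n v <= hit p F K n u.
  elim: n u v => [|n IHn] u v uv; have := uv.
    by rewrite /= ler_nat /K; case: (leP v y) => //= vy; rewrite (le_trans uv vy).
  case: (boolP (K u)) => Ku; first by rewrite (hit_in _ Ku) hit_le1.
  have Kv : ~~ K v by move: Ku; rewrite /K -!ltNge => /lt_le_trans; apply.
  rewrite !hit_out // => _; apply: ler_sum => i _.
  by rewrite ler_pM2l ?(ifs_gt0 H) // IHn // (ifs_leE H).
have rmon u v : u <= v -> r v <= r u.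
  move=> uv; apply: hitting_le => n.
  exact: le_trans (hmon n _ _ uv) (hit_le_hitting _ _ _).
(* The probability of a visit to [K] at some time from n on; its decreasing limit is the probability
   of infinitely many visits. *)
pose q n z := iter n A r z.
have qS n z : q n.+1 z <= q n z.
  elim: n z => [|n IHn] z; first exact: avg_hitting_le.
  by rewrite [leLHS]/q [leRHS]/q ![in leLHS]iterS ![in leRHS]iterS; apply: (avg_le H) => i; exact: IHn.
have q0 n z : 0 <= q n z.
  rewrite -(iter_avg_cst H n 0 z); apply: (iter_avg_le H) => v.
  exact: hitting_ge0.
have qr n z : q n z <= r z by elim: n => [//|n]; apply: le_trans (qS n z).
have qmon n u v : u <= v -> q n v <= q n u.
  elim: n u v => [|n IHn] u v uv; first exact: rmon.
  by rewrite /q !iterS; apply: ler_sum => i _; rewrite ler_pM2l ?(ifs_gt0 H) // IHn // (ifs_leE H).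
pose h z := inf (range (q^~ z)).
have qlb z : has_lbound (range (q^~ z)) by exists 0 => _ [n _ <-].
have hcv z : q n z @[n --> \oo] --> h z.
  apply: nonincreasing_cvgn => //.
  by apply/nonincreasing_seqP => n; exact: qS.
have hq n z : h z <= q n z by apply: ge_inf => //; exists n.
have h0 z : 0 <= h z by apply: lb_le_inf; [exists (q 0%N z), 0%N|move=> _ [n _ <-]].
have hh z : A h z = h z.
  have h1 : A (q n) z @[n --> \oo] --> A h z by apply: avg_cvg => v; exact: hcv.
  have h2 : q n.+1 z @[n --> \oo] --> h z.
    by rewrite (@cvg_shiftS _ (fun n => q n z)); exact: hcv.
  exact: cvg_unique h1 h2.
have hdec u v : u <= v -> h v <= h u.
  move=> uv; apply: lb_le_inf; first by exists (q 0%N u), 0%N.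
  by move=> _ [n _ <-]; exact: le_trans (hq n v) (qmon n _ _ uv).
have hr z : h z <= r z := hq 0%N z.
have hcst u v : h u = h v.
  apply: oppr_inj; apply: (@monotone_harmonic_cst _ _ _ _ _ H (fun z => - h z) 1).
  - by move=> a b ab; rewrite lerN2 hdec.
  - by move=> z; rewrite -[in RHS]hh /avg -sumrN; apply: eq_bigr => i _; rewrite mulrN.
  - by move=> z; rewrite normrN ger0_norm //; apply: le_trans (hr z) (hitting_le1 _ _).
pose k := h x.
have hk z : h z = k by exact: hcst.
(* Infinitely many visits follow either a first visit within n steps, after which their probability
   is again k, or a later first visit, of probability r - hit. *)
have kle n z : k <= k * hit p F K n z + (r z - hit p F K n z).
  elim: n z => [|n IHn] z; case: (boolP (K z)) => Kz.
  - by rewrite (hit_in _ Kz) /r hitting_in // mulr1 subrr addr0.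
  - by rewrite /= (negPf Kz) mulr0 subr0 add0r -(hk z).
  - by rewrite (hit_in _ Kz) /r hitting_in // mulr1 subrr addr0.
  - rewrite hit_out // /r (hitting_out Kz) -/r -avgB -avgZ.
    have -> : forall a b, A a z + A b z = A (fun v => a v + b v) z.
      by move=> a b; rewrite /avg -big_split; apply: eq_bigr => i _; rewrite mulrDr.
    by rewrite -{1}(avg_cst H k z); apply: (avg_le H).
have kr : k <= k * r x.
  have cv : k * hit p F K n x + (r x - hit p F K n x) @[n --> \oo] --> k * r x + (r x - r x).
    apply: cvgD; [apply: cvgM; [exact: cvg_cst|exact: hit_cvg]|].
    by apply: cvgB; [exact: cvg_cst|exact: hit_cvg].
  rewrite subrr addr0 in cv.
  have <- := cvg_lim (@Rhausdorff R) cv.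
  by apply: limr_ge; [apply/cvg_ex; eexists; exact: cv|apply: nearW => n; exact: kle].
have r1 : r x <= 1 := hitting_le1 _ _.
have : 0 <= k := h0 x; rewrite le_eqVlt => /orP[/eqP k0|k0]; last first.
  by apply/eqP; rewrite eq_le r1 /= -(ler_pM2l k0) mulr1.
(* If k = 0, then q n y tends to 0; but it is at least P_y(X_n <= y), which duality bounds below by
   1/2. *)
have [n qn] : exists n, q n y < 1 / 2.
  have := hcv y; rewrite hk -k0 => /cvgrPdist_lt /(_ (1 / 2) ltac:(lra)) [n _ /(_ n (leqnn _))] /=.
  by rewrite sub0r normrN ger0_norm // => qn; exists n.
have := half_le_iter_avg H n y.
have le1 : iter n A (fun z => (z <= y)%R%:R) y <= q n y.
  by apply: (iter_avg_le H) => z; exact: (hit_le_hitting K 0).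
have e1 : iter n A (fun z => (z <= y)%R%:R) y = iter n A (fun z => (y <= z)%R%:R) y.
  apply: (iter_avg_dual H n (rho := fun a b => (a <= b)%R%:R)) => i a b.
  by rewrite (ifs_le_adj H).
move: qn; lra.
Qed.

End hitting_theory.

Section recurrence.
Context {R : realType} {I : finType} (p : I -> R) (F : I -> R -> R) (s : I -> I).
Hypothesis H : symmetric_ifs p F s.
Local Notation A := (avg p F).
Implicit Types (K : pred R) (f g h t : R -> R) (x y z : R) (i : I) (n : nat).

(** Conjugation by x |-> -x exchanges the two ends of the line and transfers recurrence from left
    half-lines to right ones. *)
Lemma reflect_ifs : symmetric_ifs p (fun i x => - F i (- x)) s.
Proof.
split; [exact: ifs_gt0 H|exact: ifs_sum H| |exact: ifs_inv H|exact: ifs_sym H| |].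
- by move=> i x y xy; rewrite ltrN2 (ifs_ltE H) ltrN2.
- by move=> i x; rewrite opprK (ifs_K H) opprK.
- move=> x; have [i ix] := ifs_nofix H (- x); exists i.
  by apply: contra ix; rewrite eqr_oppLR.
Qed.

Lemma hit_reflect K n x :
  hit p (fun i x => - F i (- x)) K n x = hit p F (fun z => K (- z)) n (- x).
Proof.
elim: n x => [|n IHn] x /=; rewrite !opprK //; case: ifP => // _.
by apply: eq_bigr => i _; rewrite IHn opprK.
Qed.

Lemma hitting_ge_eq1 y x : hitting p F (fun z => y <= z) x = 1.
Proof.
have := hitting_le_eq1 reflect_ifs (- y) (- x).
have -> : (fun z => y <= z) = (fun z => - z <= - y).
  by apply/funext => z; rewrite lerN2.
move=> <-; congr (sup _); apply/seteqP; split => _ [n _ <-]; exists n => //;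
  by rewrite hit_reflect opprK.
Qed.

(** From x the walk surely enters ]-oo, y], where t is at least t y; hence t y <= t x for all x and
    y. *)
Lemma superharmonic_nonincr_cst t :
  (forall x, A t x <= t x) -> (forall x, 0 <= t x) ->
  {homo t : x y /~ x <= y} -> forall x y, t x = t y.
Proof.
move=> At t0 tmon.
suff le x y : t y <= t x by move=> x y; apply/eqP; rewrite eq_le !le.
rewrite -[t y]mulr1 -(hitting_le_eq1 H y x).
by apply: (superharmonic_ge_hit H) => // z; exact: tmon.
Qed.

Lemma superharmonic_nondecr_cst t :
  (forall x, A t x <= t x) -> (forall x, 0 <= t x) ->
  {homo t : x y / x <= y} -> forall x y, t x = t y.
Proof.
move=> At t0 tmon.
suff le x y : t y <= t x by move=> x y; apply/eqP; rewrite eq_le !le.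
rewrite -[t y]mulr1 -(hitting_ge_eq1 y x).
by apply: (superharmonic_ge_hit H) => // z; exact: tmon.
Qed.

(** B bounds the images of 0 under all maps. A walk that crosses 0 in one step lands between 0 and
    such an image, and half-line recurrence forces a crossing. *)
Lemma hitting_itv_eq1 : exists B : R, forall a b, a <= - B -> B <= b ->
  forall x, hitting p F (fun z => a <= z <= b) x = 1.
Proof.
exists (\sum_i `|F i 0|) => a b aB Bb x.
have Fi i : a <= F i 0 <= b.
  have : `|F i 0| <= \sum_i `|F i 0|.
    by rewrite (bigD1 i) //= lerDl; apply: sumr_ge0.
  by rewrite ler_norml; move: aB Bb; lra.
pose K z := a <= z <= b.
have K0 : K 0.
  have : 0 <= \sum_i `|F i 0| by apply: sumr_ge0.
  by rewrite /K; move: aB Bb; lra.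
apply/eqP; rewrite eq_le (hitting_le1 H) /=.
have := ltP 0 x; case=> x0.
  rewrite -(hitting_le_eq1 H 0 x); apply: hitting_le => n.
  apply: le_trans (hit_le_hitting H _ n x); rewrite -/K.
  elim: n x x0 => [|n IHn] x x0; first by rewrite /= (lt_geF x0).
  case: (boolP (K x)) => Kx; first by rewrite (hit_in _ _ _ Kx) (hit_le1 H).
  rewrite [leLHS](@hit_out R) -?ltNge // (hit_out _ _ _ Kx).
  apply: (avg_le H) => i; case: (ltP 0 (F i x)) => Fx; first exact: IHn.
  rewrite [leRHS](@hit_in R) ?(hit_le1 H) // /K.
  have := Fi i; have : F i 0 < F i x by rewrite (ifs_ltE H).
  by move: K0; rewrite /K; lra.
rewrite -(hitting_ge_eq1 0 x); apply: hitting_le => n.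
apply: le_trans (hit_le_hitting H _ n x); rewrite -/K.
elim: n x x0 => [|n IHn] x x0.
  rewrite /=; case: (leP 0 x) => // x0'; have -> : x = 0 by apply/eqP; rewrite eq_le x0.
  by rewrite K0.
case: (boolP (K x)) => Kx; first by rewrite (hit_in _ _ _ Kx) (hit_le1 H).
have {}x0 : x < 0.
  by rewrite lt_neqAle x0 andbT; apply: contra Kx => /eqP ->.
rewrite [leLHS](@hit_out R) -?ltNge // (hit_out _ _ _ Kx).
apply: (avg_le H) => i; case: (leP (F i x) 0) => Fx; first exact: IHn.
rewrite [leRHS](@hit_in R) ?(hit_le1 H) // /K.
have := Fi i; have : F i x < F i 0 by rewrite (ifs_ltE H).
by move: K0; rewrite /K; lra.
Qed.

(** By induction f is at most |C| times the probability of avoiding [K] for n steps, which tends to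
    0. *)
Lemma max_principle K (f : R -> R) (C : R) :
  (forall x, hitting p F K x = 1) -> (forall x, f x <= C) ->
  (forall x, K x -> f x <= 0) -> (forall x, ~~ K x -> f x <= A f x) ->
  forall x, f x <= 0.
Proof.
move=> K1 fC fK fA x.
have C0 : 0 <= `|C| by [].
have fC' y : f y <= `|C| by apply: le_trans (fC y) (ler_norm C).
have fn n y : f y <= `|C| * (1 - hit p F K n y).
  elim: n y => [|n IHn] y; case: (boolP (K y)) => Ky.
  - by rewrite hit_in // subrr mulr0 fK.
  - by rewrite /= (negPf Ky) subr0 mulr1.
  - by rewrite hit_in // subrr mulr0 fK.
  - rewrite hit_out // -{1}(avg_cst H 1 y) -avgB -avgZ.
    by apply: le_trans (fA y Ky) _; apply: (avg_le H).
have : `|C| * (1 - hit p F K n x) @[n --> \oo] --> `|C| * (1 - hitting p F K x).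
  by apply: cvgM; [exact: cvg_cst|apply: cvgB; [exact: cvg_cst|exact: (hit_cvg H)]].
rewrite K1 subrr mulr0 => cv; have <- := cvg_lim (@Rhausdorff R) cv.
by apply: limr_ge; [apply/cvg_ex; eexists; exact: cv|exact: nearW].
Qed.

Definition killed (q f : R -> R) (x : R) : R := q x * A f x.

(** Each visit to the recurrent set [K] costs a factor 1 - d. The limit w of the survival
    probabilities satisfies w = q P w, and the maximum principle gives sup w <= max(0, 1 - d) sup
    w. *)
Lemma killed_cvg0 K (q : R -> R) (d : R) :
  (forall x, hitting p F K x = 1) -> 0 < d ->
  (forall x, 0 <= q x <= 1) -> (forall x, K x -> q x <= 1 - d) ->
  forall x, iter n (killed q) (fun=> 1) x @[n --> \oo] --> 0.
Proof.
move=> K1 d0 q01 qK.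
pose W n x := iter n (killed q) (fun=> 1) x.
have q0 x : 0 <= q x by case/andP: (q01 x).
have q1 x : q x <= 1 by case/andP: (q01 x).
have W0 n x : 0 <= W n x.
  elim: n x => [|n IHn] x; rewrite /W //= mulr_ge0 //.
  by apply: sumr_ge0 => i _; rewrite mulr_ge0 ?(p_ge0 H) //; exact: IHn.
have WS n x : W n.+1 x <= W n x.
  elim: n x => [|n IHn] x; first by rewrite /W /= /killed (avg_cst H) mulr1.
  by rewrite /W /= ler_wpM2l //; apply: (avg_le H) => i; exact: IHn.
pose w x := inf (range (W^~ x)).
have wlb x : has_lbound (range (W^~ x)) by exists 0 => _ [n _ <-].
have Wcv x : W n x @[n --> \oo] --> w x.
  apply: nonincreasing_cvgn => //.
  by apply/nonincreasing_seqP => n; exact: WS.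
have w0 x : 0 <= w x by apply: lb_le_inf; [exists (W 0%N x), 0%N|move=> _ [n _ <-]].
have w1 x : w x <= 1 by apply: ge_inf => //; exists 0%N.
have wE x : w x = q x * A w x.
  have h1 : q x * A (W n) x @[n --> \oo] --> q x * A w x.
    by apply: cvgM; [exact: cvg_cst|apply: avg_cvg => y; exact: Wcv].
  have h2 : W n.+1 x @[n --> \oo] --> w x.
    by rewrite (@cvg_shiftS _ (fun n => W n x)); exact: Wcv.
  exact: cvg_unique h2 h1.
pose V := sup (range w).
have hV : has_sup (range w) by split; [exists (w 0), 0|exists 1 => _ [x _ <-]].
have wV x : w x <= V by apply: sup_upper_bound => //; exists x.
have V0 : 0 <= V by apply: le_trans (w0 0) (wV 0).
have Aw0 x : 0 <= A w x by apply: sumr_ge0 => i _; rewrite mulr_ge0 ?(p_ge0 H).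
have AwV x : A w x <= V by rewrite -(avg_cst H V x); apply: (avg_le H).
have le x : w x - Order.max 0 (1 - d) * V <= 0.
  apply: (@max_principle K (fun x => w x - Order.max 0 (1 - d) * V) 1) => [//|y|y Ky|y _].
  - rewrite lerBlDr (le_trans (w1 y)) // lerDl mulr_ge0 // le_max lexx //.
  - rewrite subr_le0 wE ler_pM // le_max (qK y Ky) orbT //.
  - rewrite avgB (avg_cst H) lerB // wE -[leRHS]mul1r ler_wpM2r //.
have VV : V <= Order.max 0 (1 - d) * V.
  by apply: sup_le_ub; [exists (w 0), 0|move=> _ [x _ <-]; rewrite -subr_le0].
have V00 : V <= 0.
  rewrite leNgt; apply/negP => Vp; move: VV.
  rewrite -[leLHS]mul1r ler_pM2r // le_max; lra.
move=> x; have -> : 0 = w x; last exact: Wcv.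
by apply/eqP; rewrite eq_le w0 (le_trans (wV x)).
Qed.

(** The Green function of a recurrent set is infinite: after any time j, finitely many further steps
    add half a visit on average. *)
Lemma visits_unbounded K x (M : R) : (forall y, hitting p F K y = 1) ->
  exists N, M <= \sum_(n < N) iter n A (fun y => (K y)%:R) x.
Proof.
move=> K1; pose G N y := \sum_(n < N) iter n A (fun y => (K y)%:R) y.
have it0 n y : 0 <= iter n A (fun y => (K y)%:R) y.
  by rewrite -(iter_avg_cst H n 0 y); apply: (iter_avg_le H).
have hitG n y : hit p F K n y <= G n.+1 y.
  elim: n y => [|n IHn] y; first by rewrite /G big_ord_recl big_ord0 addr0.
  rewrite /G big_ord_recl; case: (boolP (K y)) => Ky.
    by rewrite hit_in //= Ky lerDl; apply: sumr_ge0 => i _; exact: it0 (lift ord0 i) y.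
  rewrite hit_out //= (negPf Ky) add0r.
  have -> : \sum_(i < n.+1) A (iter i A (fun y => (K y)%:R)) y = A (G n.+1) y.
    by have := @iter_avg_sum _ _ _ _ _ H 1; rewrite /= /G => ->.
  exact: (avg_le H).
have block j : exists n, G j x + 1 / 2 <= G (j + n)%N x.
  have cv : iter j A (hit p F K n) x @[n --> \oo] --> iter j A (hitting p F K) x.
    elim: j x => [|j IHj] y; first exact: (hit_cvg H).
    by apply: avg_cvg => z; exact: IHj.
  have := cv; have -> : hitting p F K = fun=> 1 by apply/funext.
  rewrite (iter_avg_cst H) => /cvgrPdist_lt /(_ (1 / 2) ltac:(lra)) [n _ /(_ n (leqnn _))] /= hn.
  exists n.+1; rewrite {2}/G big_split_ord /= lerD2l.
  have -> : \sum_(i < n.+1) iter (j + i) A (fun y => (K y)%:R) x = iter j A (G n.+1) x.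
    by rewrite (iter_avg_sum H); apply: eq_bigr => i _; rewrite iterD.
  have : iter j A (hit p F K n) x <= iter j A (G n.+1) x by apply: (iter_avg_le H).
  by move: hn; rewrite ltr_norml; lra.
have big k : exists N, k%:R / 2 <= G N x.
  elim: k => [|k [N IHk]]; first by exists 0%N; rewrite mul0r /G big_ord0.
  have [n hn] := block N; exists (N + n)%N; move: hn; rewrite -[k.+1]addn1 natrD; lra.
have [N hN] := big (Num.bound (2 * `|M|)); exists N; apply: le_trans hN.
have := archi_boundP (_ : 0 <= 2 * `|M|); rewrite mulr_ge0 // => /(_ isT).
have := ler_norm M; lra.
Qed.

Fixpoint reach n x : seq R :=
  if n is n'.+1 then flatten [seq reach n' (F i x) | i <- enum I] else [:: x].

Lemma iter_avg_le_reach n f g x : {in reach n x, forall y, f y <= g y} ->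
  iter n A f x <= iter n A g x.
Proof.
elim: n x => [|n IHn] x fg /=; first by apply: fg; rewrite inE.
apply: (avg_le H) => i; apply: IHn => y yi; apply: fg => /=.
by apply/flattenP; exists (reach n (F i x)) => //; apply: map_f; rewrite mem_enum.
Qed.

Lemma uniq_representatives (T : eqType) (c : R -> T) (ys : seq R) :
  exists zs, [/\ {subset zs <= ys}, uniq (map c zs) &
    {in ys, forall y, c y \in map c zs}].
Proof.
elim: ys => [|y ys [zs [sub u cz]]]; first by exists [::].
have [cy|cy] := boolP (c y \in map c zs).
  exists zs; split => //; first by move=> z /sub; rewrite inE orbC => ->.
  by move=> z; rewrite inE => /orP[/eqP ->|/cz].
exists (y :: zs); split => /=; rewrite ?cy //.
  by move=> z; rewrite !inE => /orP[->//|/sub ->]; rewrite orbT.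
by move=> z; rewrite !inE => /orP[/eqP ->|/cz ->]; rewrite ?eqxx ?orbT.
Qed.

(* m is a harmonic function on the countable set of classes, on which the walk
   is reversible.  If a class c were transient, its Green function would be
   dominated by a multiple of m, hence summable over the classes meeting K,
   contradicting the recurrence of K.  So c is recurrent, and minimality of
   the hitting probability gives m >= m(c) along the orbit of c. *)
Lemma class_mass_ge (T : eqType) (c : R -> T) (m : R -> R) K (B : R) :
  (forall i x y, c x = c y -> c (F i x) = c (F i y)) ->
  (forall x, A m x = m x) -> (forall x, 0 <= m x) ->
  (forall x y, c x = c y -> m x = m y) ->
  (forall x, hitting p F K x = 1) ->
  (forall ys : seq R, all K ys -> uniq (map c ys) -> \sum_(y <- ys) m y <= B) ->
  forall x w, m x <= m (act F w x).
Proof.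
move=> cF mh m0 mc K1 mB x w.
have := m0 x; rewrite le_eqVlt => /orP[/eqP <- //|mx].
pose J y := c y == c x; pose k := hitting p F J.
have k1 y : k y <= 1 := hitting_le1 H _ _.
have kJ y : J y -> k y = 1 by move=> Jy; exact: (hitting_in H).
have kout y : ~~ J y -> k y = A k y := @hitting_out _ _ _ _ _ H _ _.
have hc n y z : c y = c z -> hit p F J n y = hit p F J n z.
  elim: n y z => [|n IHn] y z yz /=; rewrite /J yz //; case: ifP => // _.
  by apply: eq_bigr => i _; rewrite (IHn _ (F i z)) //; exact: cF.
have kc y z : c y = c z -> k y = k z.
  by move=> yz; rewrite /k /hitting; under eq_fun do rewrite (hc _ _ _ yz).
have Akc y z : c y = c z -> A k y = A k z.
  by move=> yz; apply: eq_bigr => i _; rewrite (kc _ (F i z)) //; exact: cF.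
have mk y : m x * k y <= m y.
  by apply: (superharmonic_ge_hit H) => [z|//||z /eqP /mc ->//]; [rewrite mh|exact: ltW].
pose d := 1 - A k x.
have Ak1 : A k x <= 1 by rewrite -(avg_cst H 1 x); apply: (avg_le H).
have : 0 <= d by rewrite subr_ge0.
(* [d] is the probability of never returning to the class of x. If it is 0, then k is harmonic and
   equals 1 at x, hence along the orbit. *)
rewrite le_eqVlt => /orP[/eqP d0|d0].
  have kh y : k y = A k y.
    case: (boolP (J y)) => [Jy|]; last exact: kout.
    rewrite kJ // (Akc y x); last exact/eqP.
    by apply/eqP; rewrite -subr_eq0 -/d -d0.
  have ko : k (act F w x) = 1.
    have : k x = 1 by rewrite kJ // /J.
    elim: w (x) => [//|i w IHw] y ky; apply: IHw.
    by apply: (avg_eq1 H k1); rewrite -kh ky.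
  by have := mk (act F w x); rewrite ko mulr1.
have kd y : k y - A k y = d * (J y)%:R.
  case: (boolP (J y)) => Jy; last by rewrite (kout _ Jy) mulr0 subrr.
  by rewrite kJ // mulr1 (Akc y x) //; exact/eqP.
(* Transient case: k - P k = d 1_J telescopes over time, so the expected number of visits to the
   class is at most k / d, and k <= m / m x. *)
have green N y : \sum_(n < N) iter n A (fun y => (J y)%:R) y <= (d * m x)^-1 * m y.
  have tele : d * (\sum_(n < N) iter n A (fun y => (J y)%:R) y) = k y - iter N A k y.
    elim: N => [|N IHN]; first by rewrite big_ord0 mulr0 subrr.
    rewrite big_ord_recr mulrDr IHN /= -iter_avgZ.
    have -> : (fun z => d * (J z)%:R) = (fun z => 1 * k z + (-1) * A k z).
      by apply/funext => z; rewrite -kd; ring.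
    have := iterSr N A k; rewrite /= => ->.
    rewrite iter_avg_lin; ring.
  have kN0 : 0 <= iter N A k y.
    rewrite -(iter_avg_cst H N 0 y); apply: (iter_avg_le H) => z.
    exact: (hitting_ge0 H).
  rewrite mulrC ler_pdivlMr ?mulr_gt0 // mulrA mulrC.
  apply: le_trans (mk y); rewrite ler_pM2l //.
  by rewrite mulrC tele; lra.
(* Reversibility: visits from x to the class of z are counted as visits from z to the class of x,
   where the Green bound applies. *)
have dual n y z : iter n A (fun v => (c v == c y)%:R) z = iter n A (fun v => (c v == c z)%:R) y.
  rewrite (iter_avg_dual H n (rho := fun a b => (c a == c b)%:R)).
    by congr (iter n A _ y); apply/funext => v; rewrite eq_sym.
  move=> i a b; congr (nat_of_bool _)%:R; apply/eqP/eqP.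
    by move=> /(cF (s i)); rewrite (ifs_K H).
  by move=> /(cF i); rewrite (ifs_KV H).
have [N] := visits_unbounded x ((d * m x)^-1 * B + 1) K1.
suff : \sum_(n < N) iter n A (fun y => (K y)%:R) x <= (d * m x)^-1 * B by lra.
pose L := [seq y <- flatten [seq reach n x | n <- iota 0 N] | K y].
have [zs [zsub zu zc]] := uniq_representatives c L.
have step n : (n < N)%N -> iter n A (fun y => (K y)%:R) x <=
    \sum_(z <- zs) iter n A (fun v => (c v == c z)%:R) x.
  move=> nN; rewrite -(iter_avg_sum H); apply: iter_avg_le_reach => y yr.
  case: (boolP (K y)) => Ky /=; last by apply: sumr_ge0 => z _; exact: ler0n.
  have : y \in L.
    rewrite mem_filter Ky; apply/flattenP; exists (reach n x) => //.
    by apply: map_f; rewrite mem_iota.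
  move=> /zc /mapP[z zz ->]; rewrite (big_rem z) //= eqxx lerDl.
  by apply: sumr_ge0 => v _; exact: ler0n.
apply: (@le_trans _ _ (\sum_(n < N) \sum_(z <- zs) iter n A (fun v => (J v)%:R) z)).
  apply: ler_sum => n _; apply: le_trans (step n (ltn_ord n)) _.
  by apply: ler_sum => z _; rewrite dual.
rewrite exchange_big /=.
apply: (@le_trans _ _ (\sum_(z <- zs) (d * m x)^-1 * m z)).
  by apply: ler_sum => z _; exact: green.
rewrite -mulr_sumr ler_pM2l ?invr_gt0 ?mulr_gt0 //.
apply: mB => //; apply/allP => z /zsub; by rewrite mem_filter => /andP[].
Qed.

End recurrence.

(** * Limits, Lipschitz functions and test functions *)

Section limits.
Context {R : realType} {T : Type} {G : set_system T} {GF : ProperFilter G}.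
Implicit Types (f : T -> R) (l c : R).

Lemma cvg_le_cst f l c : f t @[t --> G] --> l ->
  (\forall t \near G, f t <= c) -> l <= c.
Proof.
move=> fl fc; have <- := cvg_lim (@Rhausdorff R) fl.
by apply: limr_le => //; apply/cvg_ex; exists l.
Qed.

Lemma cvg_ge_cst f l c : f t @[t --> G] --> l ->
  (\forall t \near G, c <= f t) -> c <= l.
Proof.
move=> fl fc; have <- := cvg_lim (@Rhausdorff R) fl.
by apply: limr_ge => //; apply/cvg_ex; exists l.
Qed.

End limits.

(** Along an ultrafilter, bounded functions converge at all points simultaneously; this replaces a
    diagonal extraction when the killing rate tends to 0. *)
Lemma ultra_fmap (T U : Type) (f : T -> U) (G : set_system T) :
  UltraFilter G -> UltraFilter (f @ G).
Proof.
move=> GU; split; first exact: fmap_proper_filter.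
move=> G' G'P sub; apply/seteqP; split => [B G'B|//].
have [//|GnB] := in_ultra_setVsetC (f @^-1` B) GU.
have : G' (B `&` ~` B) by apply: filterI => //; apply: sub.
by rewrite setICr => /filter_ex[].
Qed.

Definition lip (R : realType) (L : R) (f : R -> R) :=
  forall x y, `|f x - f y| <= L * `|x - y|.

Definition tcont (R : realType) (f : R -> R) :=
  continuous f /\ exists r, forall x, r < `|x| -> f x = 0.

Section lipschitz.
Context {R : realType}.
Implicit Types (f g : R -> R) (L x y : R).

Lemma lip_continuous L f : lip L f -> continuous f.
Proof.
move=> fL x; apply/cvgrPdist_le => e e0.
have L0 : 0 < `|L| + 1 by rewrite ltr_wpDl.
near=> y; apply: le_trans (fL x y) _.
apply: (@le_trans _ _ ((`|L| + 1) * `|x - y|)).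
  by rewrite ler_wpM2r // (le_trans (ler_norm L)) // lerDl.
rewrite mulrC -ler_pdivlMr //; near: y.
by apply: cvgr_dist_le => //; rewrite divr_gt0.
Unshelve. all: by end_near. Qed.

(** Ascoli's argument for an arbitrary filter: a common Lipschitz constant makes pointwise
    convergence uniform on segments. *)
Lemma lip_cvg_unif (T : Type) (G : set_system T) {GF : Filter G}
    (f : T -> R -> R) g L (a b e : R) :
  (\forall t \near G, lip L (f t)) -> lip L g ->
  (forall x, f t x @[t --> G] --> g x) -> 0 < e ->
  \forall t \near G, forall x, a <= x <= b -> `|f t x - g x| <= e.
Proof.
move=> fL gL fg e0.
have cK : compact `[a, b] by exact: segment_compact.
suff : \forall t \near G, `[a, b] `<=` (fun x => `|f t x - g x| <= e).
  by apply: filterS => t ht x xab; apply: ht; rewrite /= in_itv.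
move/compact_near_coveringP : cK; apply => // x _.
have L0 : 0 < `|L| + 1 by rewrite ltr_wpDl.
have e3 : 0 < e / 3 by rewrite divr_gt0.
have h1 : \forall x' \near x, (`|L| + 1) * `|x - x'| <= e / 3.
  near=> x'; rewrite mulrC -ler_pdivlMr //; near: x'.
  by apply: cvgr_dist_le => //; rewrite divr_gt0.
have h2 : \forall t \near G, `|g x - f t x| <= e / 3.
  by have /cvgrPdist_le := fg x; apply.
near=> x' t => /=.
have ftL : lip L (f t) by near: t; exact: fL.
have fx := ftL x' x.
have gx := gL x x'.
have k1 : (`|L| + 1) * `|x - x'| <= e / 3 by near: x'; exact: h1.
have k2 : `|g x - f t x| <= e / 3 by near: t; exact: h2.
have k3 : L * `|x - x'| <= (`|L| + 1) * `|x - x'|.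
  by rewrite ler_wpM2r // (le_trans (ler_norm L)) // lerDl.
move: fx gx k2; rewrite (distrC x' x) !ler_norml; move: k1 k3; lra.
Unshelve. all: by end_near. Qed.

End lipschitz.

(** * Systems preserving Lebesgue measure on average *)

Section lebesgue_invariant.
Context {R : realType} {I : finType} (p : I -> R) (F : I -> R -> R) (s : I -> I).
Hypothesis H : symmetric_ifs p F s.
Hypothesis HL : forall x y, \sum_i p i * (F i y - F i x) = y - x.
Local Notation A := (avg p F).
Implicit Types (K : pred R) (f g h : R -> R) (x y z : R) (i : I) (n : nat).

(** All maps are increasing, so the differences F i y - F i x share the sign of y - x and [HL]
    applies to their absolute values. *)
Lemma sum_dist x y : \sum_i p i * `|F i x - F i y| = `|x - y|.
Proof.
wlog xy : x y / x <= y.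
  case: (leP x y) => [xy|/ltW xy] h; first exact: h.
  by rewrite distrC -(h y x xy); apply: eq_bigr => i _; rewrite distrC.
rewrite distrC ger0_norm ?subr_ge0 // -HL; apply: eq_bigr => i _.
by rewrite distrC ger0_norm // subr_ge0 (ifs_leE H).
Qed.

Lemma dist_le i x y : p i * `|F i x - F i y| <= `|x - y|.
Proof.
rewrite -[leRHS]sum_dist (bigD1 i) //= lerDl; apply: sumr_ge0 => j _.
by rewrite mulr_ge0 ?(p_ge0 H).
Qed.

Lemma dist_ge i x y : p i * `|x - y| <= `|F i x - F i y|.
Proof. by have := dist_le (s i) (F i x) (F i y); rewrite (ifs_sym H) !(ifs_K H). Qed.

Lemma ifs_continuous i : continuous (F i).
Proof.
apply: (@lip_continuous _ (p i)^-1) => x y.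
by rewrite mulrC ler_pdivlMr ?(ifs_gt0 H) // mulrC dist_le.
Qed.

Lemma lip_avg L f : lip L f -> lip L (A f).
Proof.
move=> fL x y; rewrite -[in leRHS]sum_dist mulr_sumr /avg -sumrB.
apply: le_trans (ler_norm_sum _ _ _) _; apply: ler_sum => i _.
rewrite -mulrBr normrM (ger0_norm (p_ge0 H i)) mulrCA.
by rewrite ler_pM2l ?(ifs_gt0 H).
Qed.

Lemma avg_continuous f : continuous f -> continuous (A f).
Proof.
move=> fc x; rewrite /continuous_at /avg.
apply: (@cvg_big R I +%R 0 xpredT (@add_continuous R^o)) => i _.
apply: cvgM; first exact: cvg_cst.
by apply: continuous_comp; [exact: ifs_continuous|exact: fc].
Qed.

Lemma tcont_avg f : tcont f -> tcont (A f).
Proof.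
move=> [fc [r fr]]; split; first exact: avg_continuous.
pose r' := \sum_i (`|F i r| + `|F i (- r)|).
have r'i i : `|F i r| <= r' /\ `|F i (- r)| <= r'.
  have : `|F i r| + `|F i (- r)| <= r'.
    by rewrite /r' (bigD1 i) //= lerDl; apply: sumr_ge0 => j _; rewrite addr_ge0.
  have := normr_ge0 (F i r); have := normr_ge0 (F i (- r)); split; lra.
exists r' => x r'x; rewrite /avg big1 // => i _; rewrite fr ?mulr0 //.
have [] := r'i (s i); rewrite !ler_norml => r1 r2.
move: r'x; rewrite !ltr_normr => /orP[] x1.
  by rewrite -(ifs_KV H i r) (ifs_ltE H); apply/orP; left; lra.
apply/orP; right; rewrite ltrNr -(ifs_KV H i (- r)) (ifs_ltE H); lra.
Qed.

Lemma tcontM f g : continuous f -> tcont g -> tcont (fun x => f x * g x).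
Proof.
move=> fc [gc [r gr]]; split; last by exists r => x /gr ->; rewrite mulr0.
by move=> x; apply: cvgM; [exact: fc|exact: gc].
Qed.

Lemma tcontD f g : tcont f -> tcont g -> tcont (fun x => f x + g x).
Proof.
move=> [fc [r fr]] [gc [r' gr]]; split; first by move=> x; apply: cvgD; [exact: fc|exact: gc].
exists (Order.max r r') => x; rewrite gt_max => /andP[rx r'x].
by rewrite fr // gr // addr0.
Qed.

Hypothesis minimal : forall x a b, a < b -> exists w, a < act F w x < b.

(** The maximum over a recurrent segment is global by the maximum principle; the equality case
    propagates it along the orbit of the maximiser, which is dense. *)
Lemma lip_harmonic_cst L C f : lip L f -> (forall x, `|f x| <= C) ->
  (forall x, A f x = f x) -> forall x y, f x = f y.
Proof.
move=> fL fC fh.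
have [B hB] := hitting_itv_eq1 H.
have K1 := hB (- B - `|B|) (B + `|B|).
have B0 : `|B| >= 0 by [].
have Ble : - B - `|B| <= B + `|B|.
  by have := ler_norm (- B); rewrite normrN; lra.
have {}K1 := K1 ltac:(lra) ltac:(lra).
have [c cK cmax] : exists2 c, c \in `[- B - `|B|, B + `|B|] &
    forall t, t \in `[- B - `|B|, B + `|B|] -> f t <= f c.
  by apply: EVT_max => //; apply: continuous_subspaceT; exact: lip_continuous fL.
have fle x : f x <= f c.
  rewrite -subr_le0; apply: (@max_principle _ _ _ _ _ H _ (fun x => f x - f c) (C - f c) K1).
  - by move=> y; rewrite lerB // (le_trans (ler_norm _)).
  - by move=> y yK; rewrite subr_le0; apply: cmax; rewrite in_itv.
  - by move=> y _; rewrite avgB (avg_cst H) fh.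
have orb w y : f y = f c -> f (act F w y) = f c.
  elim: w y => [//|i w IHw] y ky; apply: IHw.
  by apply: (avg_eq1 H fle); rewrite fh ky.
suff fc x : f x = f c by move=> x y; rewrite !fc.
apply/eqP; rewrite -subr_eq0 -normr_le0; apply/ler_addgt0Pl => e e0; rewrite addr0.
have L0 : 0 < `|L| + 1 by rewrite ltr_wpDl.
have d0 : 0 < e / (`|L| + 1) by rewrite divr_gt0.
have [w wx] : exists w, x - e / (`|L| + 1) < act F w c < x + e / (`|L| + 1).
  by apply: minimal; lra.
rewrite -(orb w c erefl); apply: le_trans (fL _ _) _.
apply: (@le_trans _ _ ((`|L| + 1) * `|x - act F w c|)).
  by rewrite ler_wpM2r // (le_trans (ler_norm L)) // lerDl.
rewrite mulrC -ler_pdivlMr // ler_norml; lra.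
Qed.

End lebesgue_invariant.

(** * The Poisson equation *)

(** Functionals rather than measures, so that f |-> int (f o D) d nu can be used without
    constructing the image of nu under D. *)
Record invariant_functional (R : realType) (I : finType) (p : I -> R)
    (F : I -> R -> R) (Lam : (R -> R) -> R) : Prop := InvariantFunctional {
  funD : forall f g, tcont f -> tcont g -> Lam (fun x => f x + g x) = Lam f + Lam g ;
  funZ : forall a f, tcont f -> Lam (fun x => a * f x) = a * Lam f ;
  fun_le : forall f g, tcont f -> tcont g -> (forall x, f x <= g x) -> Lam f <= Lam g ;
  fun_avg : forall f, tcont f -> Lam (avg p F f) = Lam f }.

Section killed_potential.
Context {R : realType} {I : finType} (p : I -> R) (F : I -> R -> R) (s : I -> I).
Hypothesis H : symmetric_ifs p F s.
Hypothesis HL : forall x y, \sum_i p i * (F i y - F i x) = y - x.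
Hypothesis minimal : forall x a b, a < b -> exists w, a < act F w x < b.
Variables (xi : R -> R) (L a b c2 d : R) (K : pred R).
Hypothesis xi_lip : lip L xi.
Hypothesis xi01 : forall x, 0 <= xi x <= 1.
Hypothesis xi_out : forall x, ~~ (a <= x <= b) -> xi x = 0.
Hypothesis c2_gt0 : 0 < c2.
Hypothesis xi_avg : forall x, a <= x <= b -> c2 <= xi x + avg p F xi x.
Hypothesis d_gt0 : 0 < d.
Hypothesis K1 : forall x, hitting p F K x = 1.
Hypothesis xiK : forall x, K x -> d <= xi x.
Local Notation A := (avg p F).
Implicit Types (phi f g h : R -> R) (e x y z : R) (i : I) (n N : nat).

Let xi0 x : 0 <= xi x. Proof. by case/andP: (xi01 x). Qed.
Let xi1 x : xi x <= 1. Proof. by case/andP: (xi01 x). Qed.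

(* e * E (sum_(k < N) phi(X_k)) for the walk killed with probability e * xi(X_j)
   at each step. *)
Definition pot e phi N : R -> R :=
  iter N (fun v x => e * phi x + (1 - e * xi x) * A v x) (fun=> 0).

Lemma potS e phi N x :
  pot e phi N.+1 x = e * phi x + (1 - e * xi x) * A (pot e phi N) x.
Proof. by []. Qed.

Lemma xi_tcont : tcont xi.
Proof.
split; first exact: lip_continuous xi_lip.
exists (`|a| + `|b|) => x xab; apply: xi_out; apply/negP => /andP[ax xb].
move: xab; rewrite ltNge => /negP; apply; rewrite ler_norml.
have := ler_norm (- a); have := ler_norm b; rewrite normrN.
have := normr_ge0 a; have := normr_ge0 b; lra.
Qed.

Section fixed_rate.
Variables (phi : R -> R) (C Lphi e : R).
Hypothesis phi_lip : lip Lphi phi.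
Hypothesis phi_xi : forall x, 0 <= phi x <= C * xi x.
Hypothesis e_in : 0 < e <= 1 / 2.

Let e0 : 0 < e. Proof. by case/andP: e_in. Qed.
Let q0 x : 0 <= 1 - e * xi x.
Proof.
have : e * xi x <= e * 1 by rewrite ler_pM2l // xi1.
by move: e_in; lra.
Qed.
(** If xi vanished everywhere, [xiK] would make [K] empty, against its recurrence. *)
Let C0 : 0 <= C.
Proof.
suff [x xx] : exists x, 0 < xi x.
  by rewrite -(pmulr_lge0 _ xx); case/andP: (phi_xi x); apply: le_trans.
apply: contrapT => /forallNP n.
have xi00 x : xi x = 0 by apply/eqP; rewrite eq_le xi0 andbT leNgt; apply/negP/n.
have nK x : K x = false by apply/negP => /xiK; rewrite xi00 leNgt d_gt0.
have := K1 0; rewrite /hitting.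
have -> : range (fun n => hit p F K n 0) = [set 0].
  apply/seteqP; split => [_ [n' _ <-]|_ ->]; last by exists 0%N => //=; rewrite nK.
  by elim: n' {-1}(0) => [|n' IHn] y /=; rewrite nK // /avg big1 // => i _; rewrite IHn mulr0.
by rewrite sup1 => /esym/eqP; rewrite oner_eq0.
Qed.

Lemma pot_ge0 N x : 0 <= pot e phi N x.
Proof.
elim: N x => [|N IHN] x //=; rewrite addr_ge0 ?mulr_ge0 ?(ltW e0) //.
  by case/andP: (phi_xi x).
by apply: sumr_ge0 => i _; rewrite mulr_ge0 ?(p_ge0 H) //; exact: IHN.
Qed.

Lemma pot_le N x : pot e phi N x <= C.
Proof.
elim: N x => [|N IHN] x //=.
have h1 : A (pot e phi N) x <= C by rewrite -(avg_cst H C x); apply: (avg_le H).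
have /andP[_ h2] := phi_xi x.
have := ler_wpM2l (q0 x) h1; have := ler_wpM2l (ltW e0) h2.
rewrite -/(pot e phi N); lra.
Qed.

Lemma pot_leS N x : pot e phi N x <= pot e phi N.+1 x.
Proof.
elim: N x => [|N IHN] x; first exact: pot_ge0.
by rewrite [leLHS]potS [leRHS]potS lerD2l ler_wpM2l //; apply: (avg_le H).
Qed.

Definition potoo x : R := sup (range (fun N => pot e phi N x)).

Lemma pot_cvg x : pot e phi N x @[N --> \oo] --> potoo x.
Proof.
apply: nondecreasing_cvgn; last by exists C => _ [n _ <-]; exact: pot_le.
by apply/nondecreasing_seqP => n; exact: pot_leS.
Qed.

Lemma potoo_ge0 x : 0 <= potoo x.
Proof. by apply: cvg_ge_cst (@pot_cvg x) _; apply: nearW => N; exact: pot_ge0. Qed.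

Lemma potoo_le x : potoo x <= C.
Proof. by apply: cvg_le_cst (@pot_cvg x) _; apply: nearW => N; exact: pot_le. Qed.

Lemma potooE x : potoo x = e * phi x + (1 - e * xi x) * A potoo x.
Proof.
have h1 : pot e phi N.+1 x @[N --> \oo] --> e * phi x + (1 - e * xi x) * A potoo x.
  apply: cvgD; first exact: cvg_cst.
  by apply: cvgM; [exact: cvg_cst|apply: avg_cvg => y; exact: pot_cvg].
have h2 : pot e phi N.+1 x @[N --> \oo] --> potoo x.
  by rewrite (@cvg_shiftS _ (fun n => pot e phi n x)); exact: pot_cvg.
exact: cvg_unique h2 h1.
Qed.

(* |x - y| (Ac - e B (xi x + xi y)) is a supersolution of the equation solved by
   the increments of the potential: P preserves |x - y|, killing gains
   e Ac xi, and xi + P xi is bounded below on the support of xi. *)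
Lemma pot_lip (pm B C' Ac : R) :
  0 < pm -> (forall i, pm <= p i) -> Lphi + C * L <= C' -> 0 <= C' ->
  B = 2 * C' / (pm * c2) -> Ac = 2 * B + C' / c2 ->
  forall N x y, `|pot e phi N x - pot e phi N y| <=
    `|x - y| * (Ac - e * B * (xi x + xi y)).
Proof.
move=> pm0 pmp C'L C'0 BE AcE.
have B0 : 0 <= B by rewrite BE divr_ge0 ?mulr_ge0 // ltW // mulr_gt0.
have Ac0 : 0 <= C' / c2 by rewrite divr_ge0 // ltW.
elim=> [|N IHN] x y.
  rewrite subrr normr0 mulr_ge0 // subr_ge0 AcE.
  have : e * B * (xi x + xi y) <= 1 * B * (1 + 1).
    apply: ler_pM; rewrite ?mulr_ge0 ?addr_ge0 ?(ltW e0) //.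
      by rewrite ler_wpM2r //; move: e_in; lra.
    by rewrite lerD.
  lra.
wlog yx : x y / xi y <= xi x.
  move=> h; case: (leP (xi y) (xi x)) => [|/ltW] yx; first exact: h.
  by rewrite distrC (distrC x) (addrC (xi x)); apply: h.
set v := pot e phi N; set D := `|x - y|.
have D0 : 0 <= D by exact: normr_ge0.
have vC z : `|A v z| <= C.
  rewrite ger0_norm; last by apply: sumr_ge0 => i _; rewrite mulr_ge0 ?(p_ge0 H) ?pot_ge0.
  by rewrite -(avg_cst H C z); apply: (avg_le H) => i; exact: pot_le.
have dA : `|A v x - A v y| <= D * (Ac - e * B * pm * A xi x).
  apply: (@le_trans _ _ (\sum_i (p i * `|F i x - F i y| * Ac -
      p i * (D * (e * B * pm) * xi (F i x))))).
    rewrite /avg -sumrB; apply: le_trans (ler_norm_sum _ _ _) _.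
    apply: ler_sum => i _; rewrite -mulrBr normrM (ger0_norm (p_ge0 H i)).
    rewrite -mulrA -mulrBr ler_pM2l ?(ifs_gt0 H) //.
    apply: le_trans (IHN _ _) _; rewrite mulrBr lerB //.
    have dg : D * pm <= `|F i x - F i y|.
      apply: le_trans (dist_ge H HL i x y); rewrite mulrC ler_wpM2r //.
    have -> : D * (e * B * pm) * xi (F i x) = (D * pm) * (e * B * xi (F i x)) by ring.
    apply: ler_pM; rewrite ?mulr_ge0 ?(ltW e0) ?(ltW pm0) //.
    by rewrite ler_wpM2l ?mulr_ge0 ?(ltW e0) // lerDl.
  rewrite sumrB -mulr_suml (sum_dist H HL).
  have -> : \sum_i p i * (D * (e * B * pm) * xi (F i x)) = D * (e * B * pm) * A xi x.
    by rewrite -avgZ.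
  rewrite -/D; lra.
have step : `|pot e phi N.+1 x - pot e phi N.+1 y| <=
    e * `|phi x - phi y| + (1 - e * xi x) * `|A v x - A v y| + e * `|xi x - xi y| * C.
  have -> : pot e phi N.+1 x - pot e phi N.+1 y = e * (phi x - phi y) +
     (1 - e * xi x) * (A v x - A v y) + (- (e * (xi x - xi y)) * A v y).
    by rewrite /pot /= -/(pot e phi N) -/v; ring.
  apply: le_trans (ler_normD _ _) _; apply: lerD.
    apply: le_trans (ler_normD _ _) _.
    by rewrite !normrM (gtr0_norm e0) (ger0_norm (q0 x)).
  by rewrite normrM normrN normrM (gtr0_norm e0) ler_wpM2l ?mulr_ge0 ?(ltW e0).
apply: le_trans step _.
have Axi0 : 0 <= A xi x by apply: sumr_ge0 => i _; rewrite mulr_ge0 ?(p_ge0 H).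
have := ler_wpM2l (q0 x) dA.
case: (boolP (a <= x <= b)) => xab; last first.
  have xi_x := xi_out xab.
  have xi_y : xi y = 0 by apply/eqP; rewrite eq_le xi0 andbT -xi_x.
  have phi0 z : xi z = 0 -> phi z = 0.
    by move=> z0; apply/eqP; rewrite eq_le; have := phi_xi z; rewrite z0 mulr0 andbC.
  rewrite !phi0 // xi_x xi_y !subrr normr0 !(mulr0, mul0r, addr0, add0r, subr0, mul1r).
  move=> /le_trans; apply; rewrite ler_wpM2l // gerBl.
  by rewrite !mulr_ge0 ?(ltW e0) ?(ltW pm0).
have hx := xi_avg xab.
have p1 : e * `|phi x - phi y| <= e * (Lphi * D) by rewrite ler_pM2l.
have p2 : e * `|xi x - xi y| * C <= e * (L * D) * C.
  by rewrite ler_wpM2r // ler_pM2l.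
have p3 : e * D * (Lphi + C * L) <= e * D * C' by rewrite ler_wpM2l ?mulr_ge0 ?(ltW e0).
have half : 1 / 2 <= 1 - e * xi x.
  have : e * xi x <= e * 1 by rewrite ler_pM2l // xi1.
  by move: e_in; lra.
have p4 : 1 / 2 * (e * B * pm * A xi x) <= (1 - e * xi x) * (e * B * pm * A xi x).
  by rewrite ler_wpM2r // !mulr_ge0 ?(ltW e0) ?(ltW pm0).
have key : C' + 2 * B * xi x <= Ac * xi x + B * pm / 2 * A xi x.
  have -> : B * pm / 2 = C' / c2.
    rewrite BE; field; rewrite !gt_eqF //.
  have : C' / c2 * c2 <= C' / c2 * (xi x + A xi x) by rewrite ler_wpM2l.
  rewrite divfK ?gt_eqF // AcE; lra.
have keyD : D * e * (C' + 2 * B * xi x) <= D * e * (Ac * xi x + B * pm / 2 * A xi x).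
  by rewrite ler_wpM2l ?mulr_ge0 ?(ltW e0).
have p5 : D * (e * B) * (xi x + xi y) <= D * (e * B) * (xi x + xi x).
  by rewrite ler_wpM2l ?mulr_ge0 ?(ltW e0) // lerD2l.
have p4D := ler_wpM2l D0 p4.
lra.
Qed.

End fixed_rate.

Lemma p_min : exists2 pm : R, 0 < pm & forall i, pm <= p i.
Proof.
exists (\big[Order.min/1]_i p i).
  by apply: lt_bigmin => // i _; exact: ifs_gt0 H i.
by move=> i; exact: bigmin_le.
Qed.

Section limits_of_potentials.
Variables (phi : R -> R) (C Lphi : R).
Hypothesis phi_lip : lip Lphi phi.
Hypothesis phi_xi : forall x, 0 <= phi x <= C * xi x.

Lemma pot_equi_lip : exists Ac, forall e, 0 < e <= 1 / 2 ->
  (forall N, lip Ac (pot e phi N)) /\ lip Ac (potoo phi e).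
Proof.
have [pm pm0 pmp] := p_min.
pose C' := `|Lphi + C * L|; pose B := 2 * C' / (pm * c2).
exists (2 * B + C' / c2) => e he.
have B0 : 0 <= B by apply: divr_ge0; [rewrite /C' mulr_ge0|exact: ltW (mulr_gt0 pm0 c2_gt0)].
have e0 : 0 < e by case/andP: he.
have lipN N : lip (2 * B + C' / c2) (pot e phi N).
  move=> x y.
  have := pot_lip phi_lip phi_xi he pm0 pmp (ler_norm _) (normr_ge0 _) erefl erefl N x y.
  move=> /le_trans; apply; rewrite mulrC ler_wpM2r // gerBl.
  by apply: mulr_ge0; [apply: mulr_ge0 => //; exact: ltW|exact: addr_ge0].
split=> // x y.
have : `|pot e phi N x - pot e phi N y| @[N --> \oo] --> `|potoo phi e x - potoo phi e y|.
  by apply: cvg_norm; apply: cvgB; exact: pot_cvg phi_xi he _.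
by move=> cv; apply: cvg_le_cst cv _; apply: nearW => N; exact: lipN.
Qed.

Let phi' x := C * xi x - phi x.

Lemma compl_bounds x : 0 <= phi' x <= C * xi x.
Proof. by rewrite /phi'; have := phi_xi x; lra. Qed.

Lemma compl_lip : lip (`|C| * L + Lphi) phi'.
Proof.
move=> x y; rewrite /phi'.
have -> : C * xi x - phi x - (C * xi y - phi y) = C * (xi x - xi y) - (phi x - phi y) by ring.
apply: le_trans (ler_normB _ _) _; rewrite mulrDl lerD //.
by rewrite normrM -mulrA ler_wpM2l.
Qed.

(** phi + phi' = C xi and e xi is the killing probability, so the sum is C times the probability of
    having been killed within N steps. *)
Lemma pot_compl e N x : pot e phi N x + pot e phi' N x =
  C * (1 - iter N (killed p F (fun y => 1 - e * xi y)) (fun=> 1) x).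
Proof.
elim: N x => [|N IHN] x; first by rewrite /= addr0 subrr mulr0.
rewrite !potS iterS /killed -/(killed _ _ _).
have : A (pot e phi N) x + A (pot e phi' N) x =
    C * (1 - A (iter N (killed p F (fun y => 1 - e * xi y)) (fun=> 1)) x).
  set g := iter N _ _.
  have -> : 1 - A g x = A (fun y => 1 - g y) x by rewrite avgB (avg_cst H).
  rewrite -avgZ /avg -big_split; apply: eq_bigr => i _ /=.
  by rewrite -mulrDr IHN.
rewrite /phi'; set a1 := A _ x; set a2 := A _ x; set a3 := A _ x => h.
have -> : a2 = C * (1 - a3) - a1 by rewrite -h; ring.
ring.
Qed.

Lemma potoo_compl e : 0 < e <= 1 / 2 -> forall x, potoo phi e x + potoo phi' e x = C.
Proof.
move=> he x; have e0 : 0 < e by case/andP: he.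
have h1 : pot e phi N x + pot e phi' N x @[N --> \oo] --> potoo phi e x + potoo phi' e x.
  by apply: cvgD; [exact: pot_cvg phi_xi he _|exact: pot_cvg compl_bounds he _].
have h2 : pot e phi N x + pot e phi' N x @[N --> \oo] --> C * (1 - 0).
  under eq_fun do rewrite pot_compl.
  apply: cvgM; [exact: cvg_cst|apply: cvgB; first exact: cvg_cst].
  apply: (@killed_cvg0 _ _ _ _ _ H K _ (e * d)) => //; first by rewrite mulr_gt0.
    move=> y; have : e * xi y <= e * 1 by rewrite ler_pM2l.
    by have : 0 <= e * xi y by [rewrite mulr_ge0 // ltW]; move: he; lra.
  by move=> y Ky; rewrite lerB // ler_pM2l // xiK.
by rewrite subr0 mulr1 in h2; exact: cvg_unique h1 h2.
Qed.

Lemma phi_tcont : tcont phi.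
Proof.
split; first exact: lip_continuous phi_lip.
have [_ [r xr]] := xi_tcont; exists r => x /xr xi_x.
by apply/eqP; rewrite eq_le; have := phi_xi x; rewrite xi_x mulr0 andbC.
Qed.

Lemma pot_tcont e N : tcont (pot e phi N).
Proof.
elim: N => [|N IHN]; first by split; [exact: cst_continuous|exists 0].
have -> : pot e phi N.+1 = fun x => e * phi x + (1 - e * xi x) * A (pot e phi N) x by [].
apply: tcontD; first by apply: tcontM phi_tcont; exact: cst_continuous.
apply: tcontM; last exact: tcont_avg H HL _ IHN.
move=> x; apply: cvgB; first exact: cvg_cst.
by apply: cvgM; [exact: cvg_cst|case: xi_tcont => + _; apply].
Qed.

Lemma avg_xi_tcont f : continuous f -> tcont (fun x => A f x * xi x).
Proof. by move=> fc; apply: tcontM xi_tcont; exact: avg_continuous H HL _ fc. Qed.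

(** [Lam] is applied to the recursion at finite N, where all functions have compact support: the
    potentials increase with N, and invariance cancels [Lam] of the potential itself. The limit in N
    is taken only in the product with xi. *)
Lemma fun_potoo_le e Lam : 0 < e <= 1 / 2 -> invariant_functional p F Lam ->
  Lam (fun x => A (potoo phi e) x * xi x) <= Lam phi.
Proof.
move=> he hLam; have e0 : 0 < e by case/andP: he.
have [Ac hAc] := pot_equi_lip; have {hAc} [lipN lipoo] := hAc e he.
have contN N : continuous (pot e phi N) := lip_continuous (lipN N).
have stepN N : Lam (fun x => A (pot e phi N) x * xi x) <= Lam phi.
  have tN := pot_tcont e N.
  have tx := avg_xi_tcont (contN N).
  have tA := tcont_avg H HL tN.
  have : Lam (pot e phi N) <= Lam (pot e phi N.+1).
    by apply: (fun_le hLam) => //; [exact: pot_tcont|move=> x; exact: pot_leS phi_xi he _ _].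
  have -> : pot e phi N.+1 = fun x => (e * phi x + A (pot e phi N) x) +
      (- e) * (A (pot e phi N) x * xi x).
    by apply/funext => x; rewrite potS; ring.
  have te : tcont (fun x => e * phi x) by apply: tcontM phi_tcont; exact: cst_continuous.
  have tex : tcont (fun x => (- e) * (A (pot e phi N) x * xi x)).
    by apply: tcontM tx; exact: cst_continuous.
  rewrite (funD hLam) //; last exact: tcontD.
  rewrite (funD hLam) // !(funZ hLam) //; last exact: phi_tcont.
  rewrite (fun_avg hLam) // mulNr => h.
  by rewrite -(ler_pM2l e0); lra.
have toox : tcont (fun x => A (potoo phi e) x * xi x).
  by apply: avg_xi_tcont; exact: lip_continuous lipoo.
have Lxi0 : 0 <= Lam xi.
  have -> : 0 = Lam (fun x => 0 * xi x) by rewrite (funZ hLam) ?mul0r //; exact: xi_tcont.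
  apply: (fun_le hLam); [by apply: tcontM xi_tcont; exact: cst_continuous|exact: xi_tcont|].
  by move=> x; rewrite mul0r.
apply/ler_addgt0Pl => eta eta0.
have eta' : 0 < eta / (Lam xi + 1) by rewrite divr_gt0 // ltr_wpDl.
have [N _ /(_ N (leqnn N)) hN] : \forall N \near \oo, forall x, a <= x <= b ->
    `|A (pot e phi N) x - A (potoo phi e) x| <= eta / (Lam xi + 1).
  apply: (lip_cvg_unif (L := Ac)) => //.
  - by apply: nearW => N; exact: lip_avg H HL _ _ (lipN N).
  - exact: lip_avg H HL _ _ lipoo.
  - by move=> x; apply: avg_cvg => y; exact: pot_cvg phi_xi he _.
have tx := avg_xi_tcont (contN N).
have texi : tcont (fun x => (eta / (Lam xi + 1)) * xi x).
  by apply: tcontM xi_tcont; exact: cst_continuous.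
have : Lam (fun x => A (potoo phi e) x * xi x) <=
    Lam (fun x => A (pot e phi N) x * xi x + (eta / (Lam xi + 1)) * xi x).
  apply: (fun_le hLam) => //; first exact: tcontD.
  move=> x; case: (boolP (a <= x <= b)) => xab; last by rewrite xi_out // !mulr0 addr0.
  rewrite -mulrDl ler_wpM2r //; have := hN x xab; rewrite ler_norml; lra.
rewrite (funD hLam) // (funZ hLam); last exact: xi_tcont.
have : eta / (Lam xi + 1) * Lam xi <= eta.
  by rewrite mulrAC ler_pdivrMr ?ltr_wpDl // ler_pM2l // lerDl.
by have := stepN N; lra.
Qed.

End limits_of_potentials.

(** The inequalities for phi and for C xi - phi have equal sums of left and of right sides, because
    the two potentials add up to C; so both are equalities. *)
Lemma fun_potoo phi C Lphi e Lam : lip Lphi phi ->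
  (forall x, 0 <= phi x <= C * xi x) -> 0 < e <= 1 / 2 ->
  invariant_functional p F Lam ->
  Lam (fun x => A (potoo phi e) x * xi x) = Lam phi.
Proof.
move=> phi_lip phi_xi he hLam; apply/eqP; rewrite eq_le.
rewrite (fun_potoo_le phi_lip phi_xi he hLam) /=.
have := fun_potoo_le (compl_lip C phi_lip) (compl_bounds phi_xi) he hLam.
set phi' := fun x => C * xi x - phi x.
have tp := phi_tcont phi_lip phi_xi.
have tx := xi_tcont.
have tA : tcont (fun x => A (potoo phi e) x * xi x).
  apply: avg_xi_tcont; have [Ac hAc] := pot_equi_lip phi_lip phi_xi.
  by have [_ /lip_continuous] := hAc e he.
have tC : tcont (fun x => C * xi x) by apply: tcontM tx; exact: cst_continuous.
have tN f : tcont f -> tcont (fun x => -1 * f x) by apply: tcontM; exact: cst_continuous.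
have -> : (fun x => A (potoo phi' e) x * xi x) =
    (fun x => C * xi x + -1 * (A (potoo phi e) x * xi x)).
  apply/funext => x; have -> : A (potoo phi' e) x = C - A (potoo phi e) x; last by ring.
  rewrite -{1}(avg_cst H C x) -avgB; apply: eq_avg => y.
  by rewrite -(potoo_compl phi_xi he y) addrC addKr.
have -> : phi' = (fun x => C * xi x + -1 * phi x) by apply/funext => x; rewrite mulN1r.
do 2 (rewrite (funD hLam) //; last exact: tN).
rewrite !(funZ hLam) //; lra.
Qed.

(* A limit point of the potentials as the killing rate tends to 0 is a bounded
   Lipschitz harmonic function, hence a constant c. *)
Lemma poisson_equation phi C Lphi : lip Lphi phi ->
  (forall x, 0 <= phi x <= C * xi x) ->
  exists c, (forall Lam, invariant_functional p F Lam -> Lam phi = c * Lam xi) /\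
    forall eta, 0 < eta -> exists h M, (forall x, `|h x| <= M) /\
      forall x, `|h x - A h x - (phi x - c * xi x)| <= eta * xi x.
Proof.
move=> phi_lip phi_xi.
have [Ac hAc] := pot_equi_lip phi_lip phi_xi.
have [G [GU Gr]] := @ultraFilterLemma _ (0 : R)^'+ _.
pose v := potoo phi.
have near_e : \forall e \near G, 0 < e <= 1 / 2.
  apply: Gr; near=> e; apply/andP; split; near: e.
    exact: nbhs_right_gt.
  by apply: nbhs_right_le; rewrite divr_gt0.
have vb e x : 0 < e <= 1 / 2 -> 0 <= v e x <= C.
  by move=> he; rewrite (potoo_ge0 phi_xi he) (potoo_le phi_xi he).
have vcv : forall x : R, exists l : R, v e x @[e --> G] --> l.
  move=> x.
  have : compact `[0, C] by exact: segment_compact.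
  rewrite compact_ultra => /(_ (v^~ x @ G)) [].
  - exact: ultra_fmap.
  - by apply: (filterS _ near_e) => e he; rewrite /= in_itv; exact: vb.
  - by move=> l [_ ?]; exists l.
have [u vu] := choice vcv.
have e_cvg : e @[e --> G] --> (0 : R).
  have : (e : R) @[e --> (0 : R)^'+] --> (0 : R) by apply: cvg_at_right_filter; exact: cvg_id.
  by move=> h B /h; exact: Gr.
have u_lip : lip Ac u.
  move=> x y; have : `|v e x - v e y| @[e --> G] --> `|u x - u y|.
    by apply: cvg_norm; apply: cvgB.
  move=> cv; apply: cvg_le_cst cv _; apply: filterS near_e => e he.
  by have [_] := hAc e he; apply.
have ub x : 0 <= u x <= C.
  apply/andP; split; [apply: cvg_ge_cst (vu x) _|apply: cvg_le_cst (vu x) _];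
    by apply: filterS near_e => e he; have /andP[] := vb e x he.
have Avu x : A (v e) x @[e --> G] --> A u x by apply: avg_cvg => y; exact: vu.
(* Source and killing both carry a factor e in the recursion, so they vanish in the limit. *)
have u_harm x : A u x = u x.
  have h1 : A (v e) x + e * (phi x - xi x * A (v e) x) @[e --> G] -->
      A u x + 0 * (phi x - xi x * A u x).
    apply: cvgD => //; apply: cvgM => //; apply: cvgB; first exact: cvg_cst.
    by apply: cvgM => //; exact: cvg_cst.
  rewrite mul0r addr0 in h1.
  apply: cvg_unique (vu x); first exact: Rhausdorff.
  apply: cvg_trans h1; apply: near_eq_cvg; apply: filterS near_e => e he.
  rewrite [RHS](potooE phi_xi he); ring.
have uC x : `|u x| <= C by have := ub x; rewrite ler_norml; lra.
have u_cst := lip_harmonic_cst H minimal u_lip uC u_harm.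
pose c := u 0; exists c.
have unif eta : 0 < eta -> exists2 e, 0 < e <= 1 / 2 &
    forall x, `|A (v e) x * xi x - c * xi x| <= eta * xi x.
  move=> eta0.
  have : \forall e \near G, forall x, a <= x <= b -> `|A (v e) x - A u x| <= eta.
    apply: (lip_cvg_unif (L := Ac)) => //.
      apply: filterS near_e => e he; apply: (lip_avg H HL).
      by have [_] := hAc e he.
    exact: (lip_avg H HL).
  move=> hG; have [e [he ho]] := filter_ex (filterI near_e hG); exists e => // x.
  case: (boolP (a <= x <= b)) => xab; last by rewrite xi_out // !mulr0 subrr normr0.
  rewrite -mulrBl normrM (ger0_norm (xi0 x)) ler_wpM2r //.
  by rewrite /c (u_cst 0 x) -u_harm; exact: ho.
split.
  move=> Lam hLam.
  have tx := xi_tcont.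
  have tZ k : tcont (fun x => k * xi x) by apply: tcontM tx; exact: cst_continuous.
  have Lxi0 : 0 <= Lam xi.
    have -> : 0 = Lam (fun x => 0 * xi x) by rewrite (funZ hLam) ?mul0r.
    by apply: (fun_le hLam) => // x; rewrite mul0r.
  apply/eqP; rewrite -subr_eq0 -normr_le0; apply/ler_addgt0Pl => eta eta0; rewrite addr0.
  have eta' : 0 < eta / (Lam xi + 1) by rewrite divr_gt0 // ltr_wpDl.
  have [e he hx] := unif _ eta'.
  have tA : tcont (fun x => A (v e) x * xi x).
    by apply: avg_xi_tcont; have [_ /lip_continuous] := hAc e he.
  rewrite -(fun_potoo phi_lip phi_xi he hLam) -/(v e).
  apply: (@le_trans _ _ (eta / (Lam xi + 1) * Lam xi)); last first.
    by rewrite mulrAC ler_pdivrMr ?ltr_wpDl // ler_pM2l // lerDl.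
  set k := eta / (Lam xi + 1) in eta' hx *.
  have le1 : Lam (fun x => A (v e) x * xi x) <= Lam (fun x => c * xi x + k * xi x).
    apply: (fun_le hLam) => //; first exact: tcontD.
    by move=> x; have := hx x; rewrite ler_norml; lra.
  have le2 : Lam (fun x => c * xi x) <= Lam (fun x => A (v e) x * xi x + k * xi x).
    apply: (fun_le hLam) => //; first exact: tcontD.
    by move=> x; have := hx x; rewrite ler_norml; lra.
  rewrite (funD hLam) // !(funZ hLam) // in le1.
  rewrite (funD hLam) // !(funZ hLam) // in le2.
  by rewrite ler_norml; lra.
move=> eta eta0; have [e he hx] := unif _ eta0.
have e0 : 0 < e by case/andP: he.
(* Dividing the recursion by e gives h - P h = phi - xi P v_e exactly, and P v_e is within eta of c
   on the segment [a, b] that carries xi. *)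
exists (fun x => e^-1 * v e x), (e^-1 * C); split.
  move=> x; have /andP[v0 vC] := vb e x he.
  by rewrite ger0_norm ?mulr_ge0 ?invr_ge0 ?(ltW e0) // ler_pM2l ?invr_gt0.
move=> x; apply: le_trans (hx x); rewrite avgZ [v e x](potooE phi_xi he) -/v -distrC.
rewrite le_eqVlt; apply/orP; left; apply/eqP; congr (`|_|); field.
by rewrite gt_eqF.
Unshelve. all: by end_near. Qed.

End killed_potential.

(** * Tent functions and the reference weight *)

Section tent.
Context {R : realType}.
Variables (a b : R).
Hypothesis ab : a < b.

Definition tent (x : R) : R := Num.max 0 (Num.min (x - a) (b - x)) / (b - a).

Let w0 : 0 < b - a. Proof. by rewrite subr_gt0. Qed.

Lemma tent_ge0 x : 0 <= tent x.
Proof. by rewrite divr_ge0 ?(ltW w0) // le_max lexx. Qed.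

Lemma tent_le1 x : tent x <= 1.
Proof.
rewrite ler_pdivrMr // mul1r ge_max (ltW w0) /= ge_min.
by have := ab; case: (lerP x b) => xb ?; apply/orP; [left|right]; lra.
Qed.

Lemma tent_out x : ~~ (a <= x <= b) -> tent x = 0.
Proof.
rewrite negb_and -!ltNge => xab; rewrite /tent max_l ?mul0r // ge_min.
by case/orP: xab => h; apply/orP; [left|right]; lra.
Qed.

Lemma tent_ge x (k : R) : a + k <= x -> x <= b - k -> k / (b - a) <= tent x.
Proof.
move=> h1 h2; rewrite ler_pM2r ?invr_gt0 // le_max le_min; apply/orP; right.
by apply/andP; split; lra.
Qed.

Lemma tent_gt0 x : a < x < b -> 0 < tent x.
Proof.
move=> /andP[h1 h2]; rewrite divr_gt0 // lt_max lt_min; apply/orP; right.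
by rewrite !subr_gt0 h1.
Qed.

Lemma tent_lip : lip (b - a)^-1 tent.
Proof.
move=> x y; rewrite /tent -mulrBl normrM mulrC (@ger0_norm _ (b - a)^-1); last first.
  by rewrite invr_ge0 ltW.
rewrite ler_pM2l ?invr_gt0 // /Num.max /Num.min.
case: (ltP (x - a)) => h1; case: (ltP (y - a)) => h2;
  case: (ltP 0) => h3; case: (ltP 0) => h4;
  rewrite ler_norml; have := ler_norm (x - y); have := ler_norm (y - x);
  rewrite (distrC y x); lra.
Qed.

End tent.

(** Shows that the survival factor exp(-xi) loses at least xi / 2 at each visit. *)
Lemma expRN_le (R : realType) (y : R) : 0 <= y <= 1 -> expR (- y) <= 1 - y / 2.
Proof.
move=> /andP[y0 y1]; rewrite expRN.
have h : 1 + y <= expR y by exact: expR_ge1Dx.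
apply: (@le_trans _ _ (1 + y)^-1); first by rewrite lef_pV2 ?posrE ?expR_gt0 //; lra.
rewrite -[leLHS]mul1r ler_pdivrMr; last by lra.
have : 0 <= y * (1 - y) by rewrite mulr_ge0 //; lra.
lra.
Qed.

(* xi is the function to whose Birkhoff sums all the others are compared. *)
Record ratio_weight (R : realType) (I : finType) (p : I -> R) (F : I -> R -> R)
    (r : R) (xi : R -> R) : Prop := RatioWeight {
  weight_tcont : tcont xi ;
  weight_ge0 : forall x, 0 <= xi x ;
  weight_le1 : forall x, xi x <= 1 ;
  weight_lb : exists2 d : R, 0 < d & forall x, `|x| <= r -> d <= xi x ;
  weight_rec : forall x,
    iter n (killed p F (fun x => expR (- xi x))) (fun=> 1) x @[n --> \oo] --> 0 ;
  weight_poisson : forall phi L, lip L phi -> (forall x, 0 <= phi x) ->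
    (forall x, r < `|x| -> phi x = 0) -> exists c,
      (forall Lam, invariant_functional p F Lam -> Lam phi = c * Lam xi) /\
      forall eta, 0 < eta -> exists h M, (forall x, `|h x| <= M) /\
        forall x, `|h x - avg p F h x - (phi x - c * xi x)| <= eta * xi x }.

Section weight.
Context {R : realType} {I : finType} (p : I -> R) (F : I -> R -> R) (s : I -> I).
Hypothesis H : symmetric_ifs p F s.
Hypothesis HL : forall x y, \sum_i p i * (F i y - F i x) = y - x.
Hypothesis minimal : forall x a b, a < b -> exists w, a < act F w x < b.

Lemma ratio_weight_exists (r : R) : exists xi, ratio_weight p F r xi.
Proof.
have [B hB] := hitting_itv_eq1 H.
pose M := Num.max `|r| `|B|.
have Mr : r <= M by rewrite le_max ler_norm.
have MB : `|B| <= M by rewrite le_max lexx orbT.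
have M0 : 0 <= M by apply: le_trans MB.
(* ]a, b[ exceeds the recurrent segment [-M, M] by at least 1 on each side, and b lies beyond every
   F i a, so a map moving a to the right lands inside. *)
pose a := - M - 1; pose S := \sum_i `|F i a|; pose b := M + 1 + S + 1.
have S0 : 0 <= S by apply: sumr_ge0.
have FS i : F i a < b.
  have : `|F i a| <= S by rewrite /S (bigD1 i) //= lerDl; apply: sumr_ge0.
  have := ler_norm (F i a); rewrite /b; lra.
have ab : a < b by rewrite /a /b; lra.
pose xi := tent a b; pose K (z : R) := - M <= z <= M.
have K1 x : hitting p F K x = 1.
  by apply: hB; move: MB; rewrite ler_norml; lra.
pose d := 1 / (b - a).
have d0 : 0 < d by rewrite divr_gt0 ?subr_gt0.
have xiK x : K x -> d <= xi x.
  by move=> /andP[h1 h2]; apply: tent_ge => //; rewrite /a /b; lra.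
have xi_lip := tent_lip ab.
have xi01 x : 0 <= xi x <= 1 by rewrite tent_ge0 // tent_le1.
have xi_out x : ~~ (a <= x <= b) -> xi x = 0 by move=> h; exact: tent_out.
have xi_c : continuous (fun x => xi x + avg p F xi x).
  have c1 := lip_continuous xi_lip; have c2 := avg_continuous H HL c1.
  by move=> x; apply: cvgD; [exact: c1|exact: c2].
(* The minimum of xi + P xi on [a, b] serves as [c2]: xi is positive inside, and from each endpoint
   some map enters the interior. *)
have [x0 x0ab x0min] : exists2 c, c \in `[a, b] & forall t, t \in `[a, b] ->
    xi c + avg p F xi c <= xi t + avg p F xi t.
  by apply: EVT_min; [exact: ltW|exact: continuous_subspaceT].
have Axi0 x : 0 <= avg p F xi x.
  by apply: sumr_ge0 => i _; rewrite mulr_ge0 ?(p_ge0 H) //; case/andP: (xi01 (F i x)).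
have pos i x : a < F i x < b -> 0 < avg p F xi x.
  move=> h; have := avg_term H x i (fun y => proj1 (andP (xi01 y))); apply: lt_le_trans.
  by rewrite mulr_gt0 ?(ifs_gt0 H) // tent_gt0.
have c2 : 0 < xi x0 + avg p F xi x0.
  move: x0ab; rewrite in_itv /= => /andP[]; rewrite !le_eqVlt.
  case/orP=> [/eqP <- _|ax].
    have [i ai] := move_right H a; apply: ltr_wpDl; first by case/andP: (xi01 a).
    by apply: (pos i); rewrite ai FS.
  case/orP=> [/eqP e|xb].
    rewrite e; apply: ltr_wpDl; first by case/andP: (xi01 b).
    have [i ib] := move_left H b; apply: (pos i); rewrite ib andbT.
    by rewrite -(ifs_KV H i a) (ifs_ltE H).
  by apply: ltr_pwDl; [apply: tent_gt0 => //; rewrite ax|exact: Axi0].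
have xi_avg x : a <= x <= b -> xi x0 + avg p F xi x0 <= xi x + avg p F xi x.
  by move=> xab; apply: x0min; rewrite in_itv.
exists xi; split.
- exact: (xi_tcont xi_lip xi_out).
- by move=> x; case/andP: (xi01 x).
- by move=> x; case/andP: (xi01 x).
- exists d => // x xr; apply: xiK; rewrite /K -ler_norml; exact: le_trans Mr.
- apply: (@killed_cvg0 _ _ _ _ _ H K _ (d / 2)) => //; first by rewrite divr_gt0.
    move=> x; rewrite expR_ge0 -(@expR0 R) ler_expR lerNl oppr0.
    by case/andP: (xi01 x).
  move=> x Kx; apply: le_trans (expRN_le (xi01 x)) _.
  by rewrite lerB // ler_pM2r ?invr_gt0 // xiK.
- move=> phi L phiL phi0 phi_out.
  (* phi vanishes at M + 1, so |L| (2 M + 1) bounds it on [-M, M], where xi >= d. *)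
  have C0 : 0 <= `|L| * (2 * M + 1) / d.
    by apply: divr_ge0; [rewrite mulr_ge0 // addr_ge0 // mulr_ge0|exact: ltW].
  have phi_le x : phi x <= `|L| * (2 * M + 1) / d * xi x.
    case: (leP `|x| r) => xr; last first.
      by rewrite phi_out // mulr_ge0 //; case/andP: (xi01 x).
    have KX : K x by rewrite /K -ler_norml (le_trans xr).
    apply: (@le_trans _ _ (`|L| * (2 * M + 1) / d * d)); last first.
      by rewrite ler_wpM2l ?xiK.
    rewrite divfK ?gt_eqF //.
    have := phiL x (M + 1); rewrite (phi_out (M + 1)); last first.
      by apply: le_lt_trans Mr _; rewrite ger0_norm; lra.
    rewrite subr0 ger0_norm // => /le_trans; apply.
    apply: le_trans (ler_wpM2r _ (ler_norm L)) _ => //.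
    rewrite ler_wpM2l // ler_norml; move: KX => /andP[]; lra.
  have phi_xi x : 0 <= phi x <= `|L| * (2 * M + 1) / d * xi x by rewrite phi0 phi_le.
  exact: (poisson_equation H HL minimal xi_lip xi01 xi_out c2 xi_avg d0 K1 xiK phiL phi_xi).
Qed.

End weight.

Lemma measure_bigsetU_le d (T : measurableType d) (R : realType)
    (P : {measure set T -> \bar R}) (J : Type) (r : seq J) (f : J -> set T) :
  (forall j, measurable (f j)) ->
  (P (\big[setU/set0]_(j <- r) f j) <= \sum_(j <- r) P (f j))%E.
Proof.
move=> mf; elim: r => [|j r IHr]; first by rewrite !big_nil measure0.
rewrite !big_cons.
apply: (@le_trans _ _ (P (f j) + P (\big[setU/set0]_(j <- r) f j))%E); last exact: leeD2l.
by apply: measureU2 => //; exact: bigsetU_measurable.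
Qed.

Lemma negligible_small d (T : measurableType d) (R : realType)
    (P : {measure set T -> \bar R}) (B : set T) :
  (forall e : R, 0 < e -> exists U, [/\ measurable U, (P U <= e%:E)%E & B `<=` U]) ->
  P.-negligible B.
Proof.
move=> hB; have h k : exists U, [/\ measurable U, (P U <= (k.+1%:R^-1)%:E)%E & B `<=` U].
  by apply: hB; rewrite invr_gt0 ltr0n.
have [U hU] := choice h.
exists (\bigcap_k U k); split.
- by apply: bigcapT_measurable => k; case: (hU k).
- apply/eqP; rewrite -measure_le0; apply/lee_addgt0Pr => e e0; rewrite add0e.
  have [k ke] : exists k, k.+1%:R^-1 <= e :> R.
    exists (Num.bound e^-1); rewrite -[leRHS]invrK lef_pV2 ?posrE ?invr_gt0 ?ltr0n //.
    apply: le_trans (ltW (archi_boundP _)) _; first by rewrite invr_ge0 ltW.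
    by rewrite ler_nat.
  case: (hU k) => mU PU _.
  apply: (@le_trans _ _ (P (U k))); last by rewrite (le_trans PU) // lee_fin.
  apply: le_measure; rewrite ?inE //; last exact: bigcap_inf.
  by apply: bigcapT_measurable => j; case: (hU j).
- by move=> w Bw k _; case: (hU k) => _ _; apply.
Qed.

(** * Almost sure ratio limits *)

Section paths.
Context d (Omega : measurableType d) {R : realType} (P : probability Omega R).
Variables (mu : probability (homeo R) R) (g : nat -> {RV P >-> homeo R}).
Hypothesis g_iid : iid mu g.
Variables (I : finType) (gen : I -> homeo R) (p : I -> R).
Hypothesis mu_gen : forall i, mu [set gen i] = (p i)%:E.
Hypothesis mu_tot : mu (range gen) = 1%E.
Implicit Types (w : seq I) (b : pred (seq I)) (N k : nat) (ix : nat -> I).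

Let step_set w k : set (homeo R) := if onth w k is Some i then [set gen i] else setT.

Lemma step_set_measurable w k : measurable (step_set w k).
Proof.
rewrite /step_set; case: (onth w k) => [i|//].
exact: measurable_homeo_set1.
Qed.

Definition cyl w : set Omega :=
  \bigcap_(k in [set` [fset k | k in iota 0 (size w)]%fset]) (g k @^-1` step_set w k).

Lemma cylP w omega : cyl w omega <-> forall k, step_set w k (g k omega).
Proof.
split=> h k; last by move=> _; exact: h.
have [kw|kw] := ltnP k (size w); last first.
  by rewrite /step_set onth_default.
by apply: h; rewrite /= !inE mem_iota.
Qed.

Lemma cyl_measurable w : measurable (cyl w).
Proof.
apply: fin_bigcap_measurable => // k _.
exact: measurable_funPTI (step_set_measurable w k).
Qed.

Lemma prob_step (A : set (homeo R)) k : measurable A -> P (g k @^-1` A) = mu A.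
Proof. by move=> mA; have [_ /(_ k A mA)] := g_iid. Qed.

Lemma prob_cyl w : P (cyl w) = (wp p w)%:E.
Proof.
have [indep _] := g_iid.
rewrite /cyl indep; last exact: step_set_measurable.
rewrite (perm_big (iota 0 (size w))) /=; last first.
  apply: uniq_perm; [exact: fset_uniq|exact: iota_uniq|].
  by move=> k; rewrite !inE.
rewrite (eq_bigr (fun k => mu (step_set w k))); last first.
  by move=> k _; rewrite prob_step //; exact: step_set_measurable.
have mu_step v k : mu (step_set v k) = (if onth v k is Some i then (p i)%:E else 1%E).
  by rewrite /step_set; case: (onth v k) => [i|]; rewrite ?mu_gen ?probability_setT.
under eq_bigr do rewrite mu_step.
elim: w => [|i w IHw]; first by rewrite /wp !big_nil.
rewrite /wp /= !big_cons /= EFinM; congr (_ * _)%E.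
by rewrite -[1%N]/(1 + 0)%N iotaDl big_map -IHw.
Qed.

(* The increments start with w, and the word spelled by the next N ones satisfies
   b. *)
Fixpoint ev N w b : set Omega :=
  if N is N'.+1 then \big[setU/set0]_(i <- enum I) ev N' (rcons w i) (fun w' => b (i :: w'))
  else if b [::] then cyl w else set0.

Fixpoint prob N b : R :=
  if N is N'.+1 then \sum_i p i * prob N' (fun w' => b (i :: w')) else (b [::])%:R.

Lemma ev_measurable N w b : measurable (ev N w b).
Proof.
elim: N w b => [|N IHN] w b /=; last exact: bigsetU_measurable.
by case: ifP => // _; exact: cyl_measurable.
Qed.

Lemma prob_ev N w b : (P (ev N w b) <= (wp p w * prob N b)%:E)%E.
Proof.
elim: N w b => [|N IHN] w b /=.
  by case: (b [::]); rewrite ?measure0 ?mulr0 // mulr1 prob_cyl.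
apply: le_trans (measure_bigsetU_le _ _ _) _; first by move=> i; exact: ev_measurable.
apply: (@le_trans _ _ (\sum_(i <- enum I) (wp p (rcons w i) * prob N (fun w' => b (i :: w')))%:E)%E).
  by apply: lee_sum => i _; exact: IHN.
rewrite sumEFin lee_fin big_enum /= mulr_sumr le_eqVlt; apply/orP; left; apply/eqP.
by apply: eq_bigr => i _; rewrite /wp -cats1 big_cat big_seq1 mulrA.
Qed.

Definition pre ix N : seq I := [seq ix k | k <- iota 0 N].

Lemma ev_in ix N k b (omega : Omega) : (forall k, g k omega = gen (ix k)) ->
  b [seq ix j | j <- iota k N] -> ev N (pre ix k) b omega.
Proof.
move=> hg; elim: N k b => [|N IHN] k b /=.
  move=> ->; apply/cylP => j; rewrite /step_set.
  have [jk|jk] := ltnP j k; last by rewrite onth_default // size_map size_iota.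
  have [i0 _] : exists i0 : I, True by exists (ix 0%N).
  have -> : onth (pre ix k) j = Some (ix j); last exact: hg.
  by rewrite onthE -map_comp (nth_map 0%N) ?size_iota //= nth_iota.
move=> hb; rewrite -bigcup_seq; exists (ix k); first by rewrite /= mem_enum.
have -> : rcons (pre ix k) (ix k) = pre ix k.+1.
  by rewrite /pre -map_rcons -cats1 -addn1 iotaD.
exact: IHN.
Qed.

Lemma ev_rcons N w b b' (omega : Omega) :
  (forall i w', size w' = N -> b w' -> b' (rcons w' i)) ->
  (forall k, range gen (g k omega)) -> ev N w b omega -> ev N.+1 w b' omega.
Proof.
move=> + hg; elim: N w b b' => [|N IHN] w b b' bb'.
  move=> /=; case: ifP => // hb /cylP hw.
  rewrite -bigcup_seq; have [i _ gi] := hg (size w).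
  exists i => /=; first by rewrite /= mem_enum.
  have /= -> := bb' i [::] erefl hb; apply/cylP => k; rewrite /step_set -cats1 onth_cat.
  have := hw k; rewrite /step_set; case: ltnP => // kw _.
  move: kw; rewrite leq_eqVlt => /orP[/eqP <-|kw]; first by rewrite subnn /= gi.
  by rewrite onth_default // subn_gt0.
move=> /=; rewrite -!bigcup_seq => -[i /= iI hi]; exists i => //=.
apply: (IHN _ (fun w' => b (i :: w')) (fun w' => b' (i :: w'))) hi => j w' wN.
by apply: (bb' j (i :: w')) => /=; rewrite wN.
Qed.

Lemma off_measurable k : measurable (g k @^-1` (~` range gen)).
Proof.
apply: measurable_funPTI; apply: measurableC; rewrite [X in measurable X](_ : _ = \bigcup_(i in setT) [set gen i]).
  by apply: fin_bigcup_measurable => // i _; exact: measurable_homeo_set1.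
by apply/seteqP; split => [_ [i _ <-]|h [i _ /= ->]]; exists i.
Qed.

Lemma ae_range : \forall omega \ae P, forall k, range gen (g k omega).
Proof.
apply/ae_foralln => k; exists (g k @^-1` (~` range gen)); split => //.
  exact: off_measurable.
have mr : measurable (range gen).
  rewrite (_ : range gen = \bigcup_(i in setT) [set gen i]).
    by apply: fin_bigcup_measurable => // i _; exact: measurable_homeo_set1.
  by apply/seteqP; split => [_ [i _ <-]|h [i _ /= ->]]; exists i.
apply: etrans (prob_step k (measurableC mr)) _.
by rewrite probability_setC // mu_tot subee.
Qed.

(* The events decided by b N increase with N, so their union has probability at
   most e. *)
Lemma ae_path (Q : (nat -> I) -> Prop) :
  (forall e : R, 0 < e -> exists b : nat -> pred (seq I),
    [/\ forall N, prob N (b N) <= e,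
        forall N i w, size w = N -> b N w -> b N.+1 (rcons w i) &
        forall ix, ~ Q ix -> exists N, b N (pre ix N)]) ->
  \forall omega \ae P, forall ix, (forall k, g k omega = gen (ix k)) -> Q ix.
Proof.
(* The events increase only along paths whose increments all lie in the range of [gen]; the null set
   of other paths is added to each of them. *)
move=> hQ; pose off := \bigcup_k (g k @^-1` (~` range gen)).
have moff : measurable off by apply: bigcupT_measurable => k; exact: off_measurable.
have Poff : P off = 0%E.
  have [U [mU PU sU]] := ae_range.
  apply/eqP; rewrite -measure_le0 -PU; apply: le_measure; rewrite ?inE //.
  by move=> w [k _ hk]; apply: sU => /(_ k).
apply: (@negligible_small _ _ _ P) => e e0.
have [b [be bS bQ]] := hQ e e0.
pose E N := ev N [::] (b N) `|` off.
have mE N : measurable (E N) by apply: measurableU => //; exact: ev_measurable.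
have PE N : (P (E N) <= e%:E)%E.
  rewrite /E measureU0 //; last exact: ev_measurable.
  by apply: le_trans (prob_ev _ _ _) _; rewrite /wp big_nil mul1r lee_fin.
exists (\bigcup_N E N); split.
- exact: bigcupT_measurable.
- have cv : (P \o E) N @[N --> \oo] --> P (\bigcup_N E N).
    apply: nondecreasing_cvg_mu => //; first exact: bigcupT_measurable.
    apply/nondecreasing_seqP => N; apply/subsetPset => omega [hN|]; last by right.
    have [ho|ho] := pselect (off omega); [by right|left].
    apply: (ev_rcons _ _ hN); first by move=> i w; exact: bS.
    by move=> k; apply: contrapT => nk; apply: ho; exists k.
  suff : (P (\bigcup_N E N) <= e%:E)%E by [].
  have <- := cvg_lim (@ereal_hausdorff R) cv.
  apply: lime_le; first by apply/cvg_ex; exists (P (\bigcup_N E N)).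
  exact: nearW.
- move=> omega /= /existsNP[ix] /not_implyP[hg /bQ [N hN]].
  by exists N => //; left; exact: (@ev_in ix N 0).
Qed.

Lemma ae_path_cst (Q : (nat -> I) -> Prop) :
  (forall e : R, 0 < e -> exists N b,
    prob N b <= e /\ forall ix, ~ Q ix -> b (pre ix N)) ->
  \forall omega \ae P, forall ix, (forall k, g k omega = gen (ix k)) -> Q ix.
Proof.
move=> hQ; apply: (@negligible_small _ _ _ P) => e e0.
have [N [b [be bQ]]] := hQ e e0; exists (ev N [::] b); split.
- exact: ev_measurable.
- by apply: le_trans (prob_ev _ _ _) _; rewrite /wp big_nil mul1r lee_fin.
- move=> omega /= /existsNP[ix] /not_implyP[hg /bQ hN].
  exact: (@ev_in ix N 0).
Qed.

End paths.

(** The Birkhoff sum f(X_0) + ... + f(X_{n-1}): the final position is excluded. *)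
Fixpoint wsum (R : realType) (I : finType) (F : I -> R -> R) (f : R -> R)
    (x : R) (w : seq I) : R :=
  if w is i :: w' then f x + wsum F f (F i x) w' else 0.

Section path_sums.
Context {R : realType} {I : finType} (F : I -> R -> R).
Implicit Types (f : R -> R) (x : R) (w : seq I) (ix : nat -> I).

Lemma wsum_rcons f x w i : wsum F f x (rcons w i) = wsum F f x w + f (act F w x).
Proof.
elim: w x => [|j w IHw] x /=; first by rewrite addr0 add0r.
by rewrite IHw addrA.
Qed.

Lemma pre_rcons ix N : pre ix N.+1 = rcons (pre ix N) (ix N).
Proof. by rewrite /pre -map_rcons -cats1 -addn1 iotaD. Qed.

Lemma wsum_pre f x ix N :
  wsum F f x (pre ix N) = \sum_(n < N) f (act F (pre ix n) x).
Proof.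
elim: N => [|N IHN]; first by rewrite big_ord0.
by rewrite pre_rcons wsum_rcons big_ord_recr IHN.
Qed.

End path_sums.

Section path_ratio.
Context d (Omega : measurableType d) {R : realType} (P : probability Omega R).
Variables (mu : probability (homeo R) R) (g : nat -> {RV P >-> homeo R}).
Hypothesis g_iid : iid mu g.
Variables (I : finType) (gen : I -> homeo R) (p : I -> R).
Hypothesis mu_gen : forall i, mu [set gen i] = (p i)%:E.
Hypothesis mu_tot : mu (range gen) = 1%E.
Variables (F : I -> R -> R) (s : I -> I).
Hypothesis H : symmetric_ifs p F s.
Local Notation A := (avg p F).
Local Notation prob := (prob p).
Local Notation wsum := (wsum F).
Implicit Types (f psi u xi : R -> R) (x y z c : R) (w : seq I) (ix : nat -> I).

Lemma prob_le N (b b' : pred (seq I)) : (forall w, b w -> b' w) -> prob N b <= prob N b'.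
Proof.
elim: N b b' => [|N IHN] b b' bb' /=.
  by rewrite ler_nat; have := bb' [::]; case: (b [::]) => // ->.
by apply: ler_sum => i _; rewrite ler_wpM2l ?(p_ge0 H) // IHN // => w; apply: bb'.
Qed.

(** The maximal event of Ville's inequality; [z] carries the exponential factor accumulated so far,
    which makes induction on the word possible. *)
Fixpoint exceeds psi u c z y w : bool :=
  (c <= z * u y) ||
  (if w is i :: w' then exceeds psi u c (z * expR (psi y)) (F i y) w' else false).

Lemma exceeds_rcons psi u c z y w i :
  exceeds psi u c z y w -> exceeds psi u c z y (rcons w i).
Proof.
elim: w z y => [|j w IHw] z y /=; first by rewrite orbF => ->.
by case/orP => [->//|/IHw ->]; rewrite orbT.
Qed.

Lemma exceedsP psi u c z y w :
  c <= z * (expR (wsum psi y w) * u (act F w y)) -> exceeds psi u c z y w.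
Proof.
elim: w z y => [|i w IHw] z y /=; first by rewrite expR0 mul1r orbF.
rewrite expRD => h; apply/orP; right; apply: IHw; apply: le_trans h _.
by rewrite !mulrA.
Qed.

(* Ville's inequality for the supermartingale exp(psi(X_0)+...+psi(X_{n-1})) u(X_n). *)
Lemma ville psi u c z y N : (forall x, 0 <= u x) ->
  (forall x, expR (psi x) * A u x <= u x) -> 0 < c -> 0 <= z ->
  prob N (exceeds psi u c z y) <= z * u y / c.
Proof.
move=> u0 hu c0; elim: N z y => [|N IHN] z y z0 /=.
  rewrite orbF; case: (leP c) => h /=; last by rewrite divr_ge0 ?mulr_ge0 // ltW.
  by rewrite ler_pdivlMr // mul1r.
case: (leP c (z * u y)) => h /=.
  apply: (@le_trans _ _ 1); last by rewrite ler_pdivlMr // mul1r.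
  rewrite -(ifs_sum H); apply: ler_sum => i _; rewrite ler_piMr ?(p_ge0 H) //.
  elim: N (fun w' : seq I => _) {IHN} => [|N IHN] b /=; first by case: (b [::]).
  rewrite -(ifs_sum H); apply: ler_sum => j _; by rewrite ler_piMr ?(p_ge0 H).
apply: (@le_trans _ _ (\sum_i p i * (z * expR (psi y) * u (F i y) / c))).
  apply: ler_sum => i _; rewrite ler_wpM2l ?(p_ge0 H) //.
  by apply: IHN; rewrite mulr_ge0 ?expR_ge0.
have -> : \sum_i p i * (z * expR (psi y) * u (F i y) / c) = z * (expR (psi y) * A u y) / c.
  by rewrite /avg !mulr_sumr mulr_suml; apply: eq_bigr => i _; ring.
by rewrite ler_pM2r ?invr_gt0 // ler_wpM2l.
Qed.

(** A nonnegative supermartingale is almost surely bounded: it reaches (u x + 1) / e with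
    probability at most e. *)
Lemma ae_bounded psi u x : (forall x, 0 <= u x) ->
  (forall x, expR (psi x) * A u x <= u x) ->
  \forall omega \ae P, forall ix, (forall k, g k omega = gen (ix k)) ->
    exists B, forall N, expR (wsum psi x (pre ix N)) * u (act F (pre ix N) x) <= B.
Proof.
move=> u0 hu; apply: (ae_path g_iid mu_gen mu_tot) => e e0.
pose c := (u x + 1) / e.
have c0 : 0 < c by rewrite divr_gt0 // ltr_wpDl.
exists (fun=> exceeds psi u c 1 x); split.
- move=> N; apply: le_trans (ville x N u0 hu c0 ler01) _.
  rewrite mul1r ler_pdivrMr // /c mulrCA divff ?gt_eqF // mulr1; lra.
- by move=> _ i w _; exact: exceeds_rcons.
- move=> ix /forallNP /(_ c) /existsNP[N] /negP; rewrite -ltNge => h.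
  by exists N; apply: exceedsP; rewrite mul1r ltW.
Qed.

(** Exponential Markov inequality: the N-step survival probability with factor exp(-xi) is the mean
    of exp(-(xi(X_0) + ... + xi(X_{N-1}))). *)
Lemma prob_wsum_le xi c y N : (forall x, 0 <= xi x) ->
  prob N (fun w => wsum xi y w <= c) <=
    expR c * iter N (killed p F (fun x => expR (- xi x))) (fun=> 1) y.
Proof.
move=> xi0; elim: N c y => [|N IHN] c y /=.
  rewrite mulr1; case: (leP 0 c) => c0; last exact: expR_ge0.
  by rewrite -expR0 ler_expR.
rewrite /killed mulrA -expRD /avg mulr_sumr; apply: ler_sum => i _.
rewrite mulrCA ler_wpM2l ?(p_ge0 H) //.
apply: le_trans (IHN (c - xi y) (F i y)); apply: prob_le => w.
by rewrite lerBrDl.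
Qed.

Lemma ae_unbounded xi x : (forall x, 0 <= xi x) ->
  (forall x, iter n (killed p F (fun x => expR (- xi x))) (fun=> 1) x @[n --> \oo] --> 0) ->
  \forall omega \ae P, forall ix, (forall k, g k omega = gen (ix k)) ->
    forall B, exists N, B < wsum xi x (pre ix N).
Proof.
move=> xi0 hxi.
have hk (k : nat) : \forall omega \ae P, forall ix, (forall k, g k omega = gen (ix k)) ->
    exists N, k%:R < wsum xi x (pre ix N).
  apply: (ae_path_cst g_iid mu_gen) => e e0.
  have ek : 0 < e / expR k%:R by rewrite divr_gt0 ?expR_gt0.
  have /cvgrPdist_le /(_ _ ek) [N _ /(_ N (leqnn N))] := hxi x.
  rewrite sub0r normrN => hN; exists N, (fun w => wsum xi x w <= k%:R); split.
    apply: le_trans (prob_wsum_le _ _ _ xi0) _.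
    rewrite mulrC -ler_pdivlMr ?expR_gt0 //; exact: le_trans (ler_norm _) hN.
  by move=> ix /forallNP /(_ N) /negP; rewrite -leNgt.
have := ae_foralln hk; apply: filterS => omega hall ix hg B.
have [N hN] := hall (Num.bound `|B|) ix hg; exists N; apply: le_lt_trans hN.
by apply: le_trans (ler_norm B) _; apply: ltW; exact: archi_boundP.
Qed.

(* exp(lam psi) P u <= u for u = 1 + lam h, because h - P h - psi dominates
   eta xi while the second order error is O(lam) xi. *)
Lemma ae_sum_le (psi0 xi h : R -> R) (M C eta x : R) :
  (forall x, 0 <= xi x) -> (forall x, xi x <= 1) ->
  (forall x, `|psi0 x| <= C * xi x) -> 0 < eta -> 0 <= C ->
  (forall x, `|h x| <= M) -> (forall x, psi0 x - eta * xi x <= h x - A h x) ->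
  \forall omega \ae P, forall ix, (forall k, g k omega = gen (ix k)) ->
    exists B, forall N, wsum (fun x => psi0 x - 2 * eta * xi x) x (pre ix N) <= B.
Proof.
move=> xi0 xi1 psiC eta0 C0 hM hA.
have M0 : 0 <= M by apply: le_trans (hM 0).
pose C2 := C + 2 * eta.
have C20 : 0 <= C2 by rewrite addr_ge0 // mulr_ge0 // ltW.
pose psi y := psi0 y - 2 * eta * xi y.
have psi_le y : `|psi y| <= C2 * xi y.
  have e1 : `|2 * eta * xi y| = 2 * eta * xi y.
    by rewrite ger0_norm // !mulr_ge0 // ltW.
  apply: le_trans (ler_normB _ _) _; rewrite e1; have := psiC y; rewrite /C2; lra.
(* Small enough that lam |psi| and lam |h| are at most 1/2 and the second order term lam psi h is at
   most eta xi. *)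
pose lam := Num.min 1 eta / (2 * (C2 + 1) * (M + 1)).
have D0 : 0 < 2 * (C2 + 1) * (M + 1) by rewrite !mulr_gt0 // ltr_wpDl.
have lam0 : 0 < lam by rewrite divr_gt0 // lt_min ltr01.
have CM0 : 0 <= C2 * M by rewrite mulr_ge0.
have lamD : lam * (2 * (C2 + 1) * (M + 1)) = Num.min 1 eta by rewrite divfK ?gt_eqF.
have lCM0 : 0 <= lam * (C2 * M) by rewrite mulr_ge0 // ltW.
have lM0 : 0 <= lam * M by rewrite mulr_ge0 // ltW.
have lC0 : 0 <= lam * C2 by rewrite mulr_ge0 // ltW.
have m1 : Num.min 1 eta <= 1 by rewrite ge_min lexx.
have m2 : Num.min 1 eta <= eta by rewrite ge_min lexx orbT.
have lamM : lam * M <= 1 / 2 by lra.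
have lamC : lam * C2 <= 1 / 2 by lra.
have lamCM : C2 * (lam * M) <= eta by lra.
pose u y := 1 + lam * h y.
have lh y : `|lam * h y| <= lam * M by rewrite normrM gtr0_norm // ler_pM2l.
have uge y : 1 / 2 <= u y by have := lh y; rewrite /u ler_norml; lra.
have u0 y : 0 <= u y by have := uge y; lra.
have Au y : A u y = u y - lam * (h y - A h y).
  have -> : A u y = 1 + lam * A h y.
    rewrite -[X in X + _](avg_cst H 1 y) -avgZ /avg -big_split.
    by apply: eq_bigr => i _; rewrite mulrDr.
  by rewrite /u; ring.
have hu y : expR (lam * psi y) * A u y <= u y.
  have Au0 : 0 <= A u y by apply: sumr_ge0 => i _; rewrite mulr_ge0 ?(p_ge0 H).
  have lpsi : `|lam * psi y| <= 1 / 2.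
    rewrite normrM gtr0_norm //; apply: le_trans lamC; rewrite ler_pM2l //.
    by apply: le_trans (psi_le y) _; rewrite ler_piMr.
  have q0 : 0 < 1 - lam * psi y by move: lpsi; rewrite ler_norml; lra.
  (* This reduces the supermartingale property to P u <= (1 - lam psi) u. One of the two eta xi in
     psi absorbs the error in h - P h, the other the product of psi and h. *)
  have e1 : expR (lam * psi y) <= (1 - lam * psi y)^-1.
    rewrite -[leLHS]invrK lef_pV2 ?posrE ?invr_gt0 ?expR_gt0 // -expRN.
    exact: expR_ge1Dx.
  apply: le_trans (ler_wpM2r Au0 e1) _.
  rewrite mulrC ler_pdivrMr // Au.
  have h1 : lam * (psi y + eta * xi y) <= lam * (h y - A h y).
    rewrite ler_pM2l //; apply: le_trans (hA y); rewrite /psi; lra.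
  have h2 : psi y * (lam * h y) <= eta * xi y.
    apply: le_trans (ler_norm _) _; rewrite normrM.
    apply: (@le_trans _ _ (C2 * xi y * (lam * M))); first exact: ler_pM.
    by rewrite mulrAC ler_wpM2r.
  have h3 : lam * (psi y * (lam * h y)) <= lam * (eta * xi y) by rewrite ler_pM2l.
  rewrite /u in h1 *; lra.
have := ae_bounded x u0 hu; apply: filterS => omega hall ix hg.
have [B hB] := hall ix hg; exists (2 * B / lam) => N.
rewrite ler_pdivlMr // mulrC.
have -> : lam * wsum (fun x => psi0 x - 2 * eta * xi x) x (pre ix N) =
    wsum (fun y => lam * psi y) x (pre ix N).
  by rewrite !wsum_pre mulr_sumr.
set S := wsum _ x _.
have h1 : expR S * (1 / 2) <= B by apply: le_trans (hB N); rewrite ler_wpM2l ?expR_ge0.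
have := expR_ge1Dx S; lra.
Qed.

(** The upper bound on the sum of phi - c xi comes from h, the lower one from -h. Division by the
    diverging sum of xi leaves an error 2 eta, for countably many eta at once. *)
Lemma path_ratio (phi xi : R -> R) (C c x : R) :
  (forall x, 0 <= xi x) -> (forall x, xi x <= 1) ->
  (forall x, iter n (killed p F (fun x => expR (- xi x))) (fun=> 1) x @[n --> \oo] --> 0) ->
  0 <= C -> (forall x, `|phi x - c * xi x| <= C * xi x) ->
  (forall eta, 0 < eta -> exists h M, (forall x, `|h x| <= M) /\
        forall x, `|h x - A h x - (phi x - c * xi x)| <= eta * xi x) ->
  \forall omega \ae P, forall ix, (forall k, g k omega = gen (ix k)) ->
    wsum phi x (pre ix N) / wsum xi x (pre ix N) @[N --> \oo] --> c.
Proof.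
move=> xi0 xi1 hxi C0 phiC pois.
have up (k : nat) : \forall omega \ae P, forall ix, (forall k, g k omega = gen (ix k)) ->
    exists B, forall N, `|wsum phi x (pre ix N) - c * wsum xi x (pre ix N)| <=
      2 * k.+1%:R^-1 * wsum xi x (pre ix N) + B.
  have eta0 : 0 < k.+1%:R^-1 :> R by rewrite invr_gt0 ltr0n.
  move: (k.+1%:R^-1) eta0 => eta eta0.
  have [h [M [hM hp]]] := pois _ eta0.
  have AN y : A (fun z => - h z) y = - A h y.
    by rewrite /avg -sumrN; apply: eq_bigr => i _; rewrite mulrN.
  have q1 y : phi y - c * xi y - eta * xi y <= h y - A h y.
    by have := hp y; rewrite ler_norml; lra.
  have q2 y : - (phi y - c * xi y) - eta * xi y <= - h y - A (fun z => - h z) y.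
    by rewrite AN; have := hp y; rewrite ler_norml; lra.
  have q3 y : `|- (phi y - c * xi y)| <= C * xi y by rewrite normrN.
  have q4 y : `|- h y| <= M by rewrite normrN.
  have b1 := ae_sum_le x xi0 xi1 phiC eta0 C0 hM q1.
  have b2 := ae_sum_le x xi0 xi1 q3 eta0 C0 q4 q2.
  apply: filterS2 b1 b2 => omega h1 h2 ix hg.
  have [B1 hB1] := h1 ix hg; have [B2 hB2] := h2 ix hg.
  exists (`|B1| + `|B2|) => N; have := hB1 N; have := hB2 N.
  rewrite !wsum_pre !sumrB sumrN sumrB -!mulr_sumr.
  have := ler_norm B1; have := ler_norm B2.
  have := normr_ge0 B1; have := normr_ge0 B2.
  rewrite ler_norml; lra.
have := ae_unbounded x xi0 hxi; have := ae_foralln up.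
apply: filterS2 => omega hup hinf ix hg.
have mono N N' : (N <= N')%N -> wsum xi x (pre ix N) <= wsum xi x (pre ix N').
  move=> NN'; rewrite !wsum_pre (big_ord_widen _ (fun n => xi (act F (pre ix n) x)) NN').
  rewrite big_mkcond; apply: ler_sum => i _; by case: ifP.
apply/cvgrPdist_le => e e0.
pose k := Num.bound (4 / e).
have ke : 2 / k.+1%:R <= e / 2.
  rewrite ler_pdivrMr ?ltr0n // mulrAC ler_pdivlMr // mulrC.
  have := archi_boundP (ltW (divr_gt0 (ltr0n R 4) e0)) => h4.
  have : 4 / e < k.+1%:R by apply: lt_le_trans h4 _; rewrite ler_nat.
  rewrite ltr_pdivrMr //; lra.
have [B hB] := hup k ix hg.
have [N0 hN0] := hinf ix hg (1 + 2 * `|B| / e).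
exists N0 => // N /= N0N; set S := wsum xi x (pre ix N).
have S1 : 1 + 2 * `|B| / e < S := lt_le_trans hN0 (mono _ _ N0N).
have B0 : 0 <= 2 * `|B| / e by rewrite divr_ge0 ?mulr_ge0 // ltW.
have S0 : 0 < S by lra.
have := hB N; rewrite -/S => h.
have Sn : S != 0 by rewrite gt_eqF.
rewrite distrC -[c in _ - c](mulfK Sn) -mulrBl normrM normfV (gtr0_norm S0).
rewrite ler_pdivrMr //; apply: le_trans h _.
have h1 : 2 / k.+1%:R * S <= e / 2 * S by rewrite ler_pM2r.
move: (2 / k.+1%:R * S) h1 => q h1.
have h2 : 2 * `|B| / e < S by lra.
rewrite ltr_pdivrMr // in h2.
have := ler_norm B; lra.
Qed.

End path_ratio.

Lemma locally_finite_discrete (R : realType) (S : set R) :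
  (forall c : R, finite_set (S `&` [set x | `|x| <= c])) ->
  closed S /\ S `<=` isolated S.
Proof.
move=> fS.
have near_lt (x : R) : nbhs x [set y | `|y| <= `|x| + 1].
  near=> y => /=; have : `|x - y| <= 1.
    by near: y; apply: cvgr_dist_le => //; exact: ltr01.
  have := ler_normD (x - (x - y)) (x - y) ; have := ler_normB x (x - y).
  have -> : x - (x - y) = y by ring.
  move=> h1 _ h2; lra.
have clT : forall T : set R, finite_set T -> closed T.
  apply/accessible_finite_set_closed; apply: hausdorff_accessible; exact: Rhausdorff.
split.
  move=> x clx; suff : closed (S `&` [set y | `|y| <= `|x| + 1]).
    move=> /(_ x) [|//]; move=> B nB.
    have [y [Sy [By hy]]] := clx _ (filterI nB (near_lt x)).
    by exists y.
  exact: clT.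
move=> x Sx; split; first by rewrite inE.
pose T := S `&` [set y | `|y| <= `|x| + 1] `\ x.
have cT : closed T by apply: clT; apply: sub_finite_set (fS (`|x| + 1)); exact: subDsetl.
exists (~` T `&` [set y | `|y| <= `|x| + 1]).
  apply: filterI (near_lt x); apply: open_nbhs_nbhs; split; first exact: closed_openC.
  by move=> [_]; apply.
apply/seteqP; split => [y [[nT hy] Sy]|y ->]; last first.
  by split => //; split; [move=> [_]; apply|rewrite /= lerDl].
by apply: contrapT => yx; apply: nT.
Unshelve. all: by end_near. Qed.

(** * Invariant measures and their distribution functions *)

Section wandering.
Context {R : realType} {I : finType} (p : I -> R) (F : I -> R -> R) (s : I -> I).
Hypothesis H : symmetric_ifs p F s.
Variable nu : {measure set (measurableTypeR R) -> \bar R}.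
Hypothesis nu_radon : radon nu.
Hypothesis nu_inv : forall A : set R, measurable A ->
  nu A = (\sum_i (p i)%:E * nu (F i @^-1` A))%E.
Hypothesis nodisc : forall x, ~ (closed (range (fun w => act F w x)) /\
  range (fun w => act F w x) `<=` isolated (range (fun w => act F w x))).
Implicit Types (x y z : R) (i : I) (w : seq I) (A B : set R).

Lemma nu_bounded A (c : R) : measurable A -> (forall x, A x -> `|x| <= c) ->
  nu A \is a fin_num.
Proof.
move=> mA Ac; rewrite ge0_fin_numE //; apply: le_lt_trans (nu_radon (@segment_compact R (- c) c)).
apply: le_measure; rewrite ?inE //.
by move=> x /Ac; rewrite /= in_itv /= ler_norml.
Qed.

Lemma nu_le A B : measurable A -> measurable B -> A `<=` B -> (nu A <= nu B)%E.
Proof. by move=> mA mB AB; apply: le_measure; rewrite ?inE. Qed.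

(** An equivariant partition of the line into bounded intervals: single points in one application,
    gaps of an invariant set in the other. *)
Variable J : R -> set R.
Hypothesis J_refl : forall x, J x x.
Hypothesis J_eq : forall x y, J x y -> J y = J x.
Hypothesis J_itv : forall x, is_interval (J x).
Hypothesis J_bnd : forall x, exists c, forall y, J x y -> `|y| <= c.
Hypothesis J_equi : forall i x y, J (F i x) (F i y) <-> J x y.

Let mJ x : measurable (J x). Proof. exact: is_interval_measurable. Qed.

Let J_fin x : nu (J x) \is a fin_num.
Proof. by have [c hc] := J_bnd x; exact: nu_bounded hc. Qed.

Let m x := fine (nu (J x)).

Let m_ge0 x : 0 <= m x. Proof. by rewrite /m fine_ge0 ?measure_ge0. Qed.

(** The preimage of [J x] under [F i] is the class of [F (s i) x], so invariance of [nu] and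
    symmetry give harmonicity. *)
Let m_harm x : avg p F m x = m x.
Proof.
rewrite /avg (sum_sym H); apply: EFin_inj; rewrite fineK // nu_inv // -sumEFin.
apply: eq_bigr => i _; rewrite EFinM fineK //; congr (_ * nu _)%E.
apply/seteqP; split => y /= Jy; last first.
  have : J (F i (F (s i) x)) (F i y) by rewrite (ifs_KV H).
  by move/J_equi.
by rewrite -(ifs_KV H i x); exact/J_equi.
Qed.

Lemma class_sum_le (ys : seq R) (U : set R) : measurable U -> nu U \is a fin_num ->
  (forall y, y \in ys -> J y `<=` U) -> uniq (map J ys) ->
  \sum_(y <- ys) m y <= fine (nu U).
Proof.
elim: ys U => [|y ys IHys] U mU fU sub; first by rewrite big_nil fine_ge0 ?measure_ge0.
rewrite /= => /andP[yn un]; rewrite big_cons.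
have mD : measurable (U `\` J y) by apply: measurableD.
have fD : nu (U `\` J y) \is a fin_num.
  rewrite ge0_fin_numE //; apply: le_lt_trans (_ : nu U < +oo)%E; last by rewrite -ge0_fin_numE.
  by apply: nu_le => //; exact: subDsetl.
have -> : fine (nu U) = fine (nu (U `\` J y)) + m y.
  rewrite (measureDI nu mU (mJ y)) setIidr; last by apply: sub; rewrite inE eqxx.
  by rewrite fineD // J_fin.
rewrite addrC lerD2r; apply: IHys => // z zys t Jt; split.
  by apply: sub Jt; rewrite inE zys orbT.
move=> Jyt; move: yn; rewrite -(J_eq Jyt) (J_eq Jt) => /negP; apply.
exact: map_f.
Qed.

(** A class that meets [a, b] and sticks out contains an endpoint, hence is the class of that
    endpoint. *)
Let K_sub (a b : R) y : a <= y <= b -> J y `<=` `[a, b] `|` J a `|` J b.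
Proof.
move=> yab z Jz; case: (leP a z) => az; last first.
  left; right; have Ja : J y a.
    by apply: (J_itv Jz (J_refl y)); move: az yab; lra.
  by rewrite (J_eq Ja).
case: (leP z b) => zb; first by left; left; rewrite /= in_itv /= az.
right; have Jb : J y b by apply: (J_itv (J_refl y) Jz); move: zb yab; lra.
by rewrite (J_eq Jb).
Qed.

Let K_fin (a b : R) : nu (`[a, b] `|` J a `|` J b) \is a fin_num.
Proof.
have [c1 h1] := J_bnd a; have [c2 h2] := J_bnd b.
apply: (@nu_bounded _ (`|a| + `|b| + `|c1| + `|c2|)).
  by apply: measurableU => //; exact: measurableU.
move=> x [[|/h1]|/h2].
- rewrite /= in_itv /= => /andP[ax xb]; rewrite ler_norml.
  have := ler_norm (- a); have := ler_norm b; rewrite normrN.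
  have := normr_ge0 a; have := normr_ge0 b; have := normr_ge0 c1; have := normr_ge0 c2.
  lra.
- have := ler_norm c1; have := normr_ge0 a; have := normr_ge0 b; have := normr_ge0 c2; lra.
- have := ler_norm c2; have := normr_ge0 a; have := normr_ge0 b; have := normr_ge0 c1; lra.
Qed.

Let J_F i x y : J x = J y -> J (F i x) = J (F i y).
Proof. by move=> xy; apply/esym/J_eq/J_equi; rewrite xy. Qed.

Let class_le x w : m x <= m (act F w x).
Proof.
have [B hB] := hitting_itv_eq1 H.
have K1 : forall z, hitting p F (fun z => - `|B| <= z <= `|B|) z = 1.
  by apply: hB; rewrite ?lerN2 ?ler_norm.
apply: (@class_mass_ge R I p F s H _ J m (fun z => - `|B| <= z <= `|B|)
  (fine (nu (`[- `|B|, `|B|] `|` J (- `|B|) `|` J `|B|)))) => [i y z||y|y z yz|//|ys yK uy].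
- exact: J_F.
- exact: m_harm.
- exact: m_ge0.
- by rewrite /m yz.
- apply: class_sum_le => //; first by apply: measurableU => //; exact: measurableU.
  by move=> y yys; apply: K_sub; apply: (allP yK).
Qed.

Let a x := inf (J x).

Let J_inf x : has_inf (J x).
Proof.
split; first by exists x.
by have [c hc] := J_bnd x; exists (- c) => y /hc; rewrite ler_norml => /andP[].
Qed.

Let a_F i x : a (F i x) = F i (a x).
Proof.
apply/eqP; rewrite eq_le; apply/andP; split; last first.
  apply: lb_le_inf; first by exists (F i x).
  move=> y Jy; rewrite (ifs_le_adj H); apply: ge_inf; first by case: (J_inf x).
  by apply/(J_equi i); rewrite (ifs_KV H).
rewrite -(ifs_KV H i (a (F i x))) (ifs_leE H).
apply: lb_le_inf; first by exists x.
move=> y Jy; rewrite (ifs_le_adj H) (ifs_inv H); apply: ge_inf; first by case: (J_inf (F i x)).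
exact/J_equi.
Qed.

Let a_act w x : a (act F w x) = act F w (a x).
Proof. by elim: w x => [//|i w IHw] x /=; rewrite IHw a_F. Qed.

(** By recurrence no class in the orbit of [J x] has smaller mass. If this mass were positive, only
    finitely many of these disjoint classes could meet a bounded set, and their left ends would form
    a locally finite orbit, hence a discrete one. *)
Lemma wandering_null x : nu (J x) = 0%E.
Proof.
apply/eqP; rewrite -(fineK (J_fin x)) -/(m x) eqe eq_le m_ge0 andbT leNgt.
apply/negP => mx0; apply: (nodisc (x := a x)); apply: locally_finite_discrete => c.
apply: contrapT; set S := _ `&` _ => infS.
pose U : set R := `[- c, c + 1] `|` J (- c) `|` J (c + 1).
(* More than nu(U) / m x disjoint classes of mass at least m x do not fit into U. *)
pose n := Num.bound (fine (nu U) / m x).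
have [C CS nC] := @infinite_set_fset R S n infS.
have hC (t : R) : exists y, t \in C -> [/\ a y = t, - c <= t <= c & m x <= m y].
  have [tC|tC] := boolP (t \in C); last by exists 0.
  have [[w _ wt] tc] := CS t tC; exists (act F w x) => _; split.
  - by rewrite a_act.
  - by rewrite -ler_norml.
  - exact: class_le.
have [f hf] := choice hC.
have : \sum_(y <- map f C) m y <= fine (nu U).
  apply: class_sum_le.
  - by apply: measurableU => //; exact: measurableU.
  - exact: K_fin.
  - move=> y /mapP[t tC ->]; have [ft tc _] := hf t tC.
    have [z Jz zt] := @inf_adherent _ (J (f t)) 1 ltr01 (J_inf (f t)).
    rewrite -(J_eq Jz); apply: K_sub.
    have : a (f t) <= z by apply: ge_inf => //; case: (J_inf (f t)).
    by move: zt; rewrite -/(a (f t)) ft; move: tc; lra.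
  - rewrite -map_comp map_inj_in_uniq ?fset_uniq // => t t' tC t'C /= JJ.
    have [<- _ _] := hf t tC; have [<- _ _] := hf t' t'C.
    by rewrite /a JJ.
apply/negP; rewrite -ltNge big_map.
apply: (@lt_le_trans _ _ (\sum_(t <- C) m x)); last first.
  by rewrite big_seq [leRHS]big_seq; apply: ler_sum => t tC; have [] := hf t tC.
rewrite big_const_seq count_predT iter_addr_0 -mulr_natl -ltr_pdivrMr //.
apply: lt_le_trans (archi_boundP _) _; first by rewrite divr_ge0 // fine_ge0 ?measure_ge0.
by rewrite ler_nat.
Qed.

End wandering.

Section cumulative.
Context {R : realType} {I : finType} (p : I -> R) (F : I -> R -> R) (s : I -> I).
Hypothesis H : symmetric_ifs p F s.
Variable nu : {measure set (measurableTypeR R) -> \bar R}.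
Hypothesis nu_radon : radon nu.
Hypothesis nu_nz : nonzero_measure nu.
Hypothesis nu_inv : forall A : set R, measurable A ->
  nu A = (\sum_i (p i)%:E * nu (F i @^-1` A))%E.
Hypothesis nodisc : forall x, ~ (closed (range (fun w => act F w x)) /\
  range (fun w => act F w x) `<=` isolated (range (fun w => act F w x))).
Implicit Types (x y z : R) (i : I) (w : seq I) (A B : set R).

Lemma point_null x : nu [set x] = 0%E.
Proof.
apply: (wandering_null H nu_radon nu_inv nodisc (J := fun x => [set x])) => //.
- by move=> y z ->.
- by move=> z y t /= -> -> u; rewrite /= => /le_anti ->.
- by move=> z; exists `|z| => y ->.
- move=> i y z; split => [|-> //]; by move=> /(can_inj (ifs_K H i)).
Qed.

(** The partition consists of the points of A and the components of its complement; these are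
    bounded because orbits are unbounded in both directions. *)
Lemma gap_null A (a b : R) : A !=set0 -> (forall i x, A x -> A (F i x)) ->
  (forall x, a < x < b -> ~ A x) -> nu `]a, b[%classic = 0%E.
Proof.
move=> [a0 Aa0] AF gap.
have Aact w x : A x -> A (act F w x) by elim: w x => [//|i w IHw] x /(AF i)/IHw.
pose J x : set R := [set y | y = x \/ forall z, Num.min x y <= z <= Num.max x y -> ~ A z].
have Jsym x y : J x y -> J y x.
  by move=> [->|h]; [left|right => z; rewrite minC maxC; exact: h].
have Jtrans x y z : J x y -> J y z -> J x z.
  move=> [->//|h1] [->|h2]; first by right.
  right => t; have := h1 t; have := h2 t; rewrite !ge_min !le_max => {}h2 {}h1 /andP[k1 k2].
  have [ty|ty] := leP t y.
    case/orP: k1 => k1; [apply: h1|apply: h2]; rewrite k1 ty ?orbT //=.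
  move/ltW: ty => ty.
  by case/orP: k2 => k2; [apply: h1|apply: h2]; rewrite k2 ty ?orbT //= orbT.
have Jeq x y : J x y -> J y = J x.
  by move=> Jxy; apply/seteqP; split => z; [exact: Jtrans|apply: Jtrans; exact: Jsym].
have Jbetween x y z : J x y -> Num.min x y <= z <= Num.max x y -> J x z.
  move=> [->|h]; first by rewrite minxx maxxx => /le_anti ->; left.
  move=> zz; right => t tt; apply: h; move: zz tt; rewrite !ge_min !le_max.
  lra.
have Jitv x : is_interval (J x).
  move=> y z Jy Jz t /andP[yt tz]; case: (leP x t) => xt.
    by apply: Jbetween Jz _; rewrite ge_min le_max xt tz orbT.
  by apply: Jbetween Jy _; rewrite ge_min le_max yt (ltW xt) orbT.
have Jbnd x : exists c, forall y, J x y -> `|y| <= c.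
  have [w hw] := orbit_ubound H a0 x; have [w' hw'] := orbit_lbound H a0 x.
  exists (`|act F w a0| + `|act F w' a0|) => y Jxy.
  have y1 : y <= act F w a0.
    rewrite leNgt; apply/negP => hy; case: Jxy => [yx|h].
      by move: hy; rewrite yx ltNge (ltW hw).
    by apply: (h (act F w a0)) (Aact w a0 Aa0); rewrite ge_min le_max (ltW hw) (ltW hy) orbT.
  have y2 : act F w' a0 <= y.
    rewrite leNgt; apply/negP => hy; case: Jxy => [yx|h].
      by move: hy; rewrite yx ltNge (ltW hw').
    by apply: (h (act F w' a0)) (Aact w' a0 Aa0); rewrite ge_min le_max (ltW hw') (ltW hy) orbT.
  have := ler_norm (- act F w' a0); have := ler_norm (act F w a0); rewrite normrN ler_norml.
  have := normr_ge0 (act F w a0); have := normr_ge0 (act F w' a0); lra.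
have Jequi1 i x y : J x y -> J (F i x) (F i y).
  move=> [->|h]; [by left|right => z zz Az]; apply: (h (F (s i) z)); last exact: AF.
  have e1 t : (F i t <= z) = (t <= F (s i) z) by rewrite (ifs_le_adj H).
  have e2 t : (z <= F i t) = (F (s i) z <= t) by rewrite (ifs_le_adj H) (ifs_inv H).
  by move: zz; rewrite !ge_min !le_max !e1 !e2.
have Jequi i x y : J (F i x) (F i y) <-> J x y.
  by split=> [/(Jequi1 (s i))|]; [rewrite !(ifs_K H)|exact: Jequi1].
have : (nu `]a, b[%classic <= nu (J ((a + b) / 2)%R))%E.
  apply: nu_le => //; first exact: is_interval_measurable.
  move=> x; rewrite /= in_itv /= => /andP[ax xb]; right => z.
  rewrite ge_min le_max => zz; apply: gap; move: zz ax xb; lra.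
rewrite (wandering_null H nu_radon nu_inv nodisc (J := J)) //; last by left.
by rewrite measure_le0 => /eqP.
Qed.

Lemma itv_fin x y : nu `]x, y]%classic \is a fin_num.
Proof.
apply: (nu_bounded nu_radon (c := `|x| + `|y|)) => // z; rewrite /= in_itv /= => /andP[xz zy].
have := ler_norm (- x); have := ler_norm y; rewrite normrN ler_norml.
have := normr_ge0 x; have := normr_ge0 y; lra.
Qed.

Lemma itv_add x y z : x <= y -> y <= z ->
  fine (nu `]x, z]%classic) = fine (nu `]x, y]%classic) + fine (nu `]y, z]%classic).
Proof.
move=> xy yz; rewrite -fineD ?itv_fin // -measureU //.
  congr (fine (nu _)); apply/seteqP; split => t /=; rewrite !in_itv /=.
    by move=> /andP[xt tz]; case: (leP t y) => ty; [left; rewrite xt|right].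
  by case=> /andP[h1 h2]; rewrite ?h1 ?h2 ?(le_trans h2 yz) ?(le_lt_trans xy h1).
apply/seteqP; split => // t [] /=; rewrite !in_itv /= => /andP[_ ty] /andP[yt _].
by move: yt; rewrite ltNge ty.
Qed.

Definition cum x : R :=
  if 0 <= x then fine (nu `]0, x]%classic) else - fine (nu `]x, 0]%classic).

Lemma nu_itv x y : x <= y -> nu `]x, y]%classic = (cum y - cum x)%:E.
Proof.
move=> xy; rewrite -[LHS]fineK ?itv_fin //; congr (_%:E); rewrite /cum.
case: (leP 0 x) => x0; case: (leP 0 y) => y0.
- by rewrite (itv_add x0 xy); ring.
- by move: (le_lt_trans x0 (le_lt_trans xy y0)); rewrite ltxx.
- by rewrite (itv_add (ltW x0) y0); ring.
- by rewrite (itv_add xy (ltW y0)); ring.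
Qed.

Lemma cum_le x y : x <= y -> cum x <= cum y.
Proof. by move=> xy; rewrite -subr_ge0 -lee_fin -nu_itv // measure_ge0. Qed.

Lemma cum_lt x y : cum x < cum y -> x < y.
Proof. by rewrite !ltNge; apply: contra => /cum_le. Qed.

(** The preimage of ]x, y] under [F i] is the interval between the images of x and y under
    [F (s i)]; symmetry then turns invariance into this identity. *)
Lemma cum_harm x y : \sum_i p i * (cum (F i y) - cum (F i x)) = cum y - cum x.
Proof.
wlog xy : x y / x <= y.
  move=> h; case: (leP x y) => [|/ltW] xy; first exact: h.
  rewrite -opprB -(h y x xy) -sumrN; apply: eq_bigr => i _; ring.
rewrite (sum_sym H); apply: EFin_inj; rewrite -nu_itv // nu_inv // -sumEFin.
apply: eq_bigr => i _; rewrite EFinM -nu_itv ?(ifs_leE H) //; congr (_ * nu _)%E.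
have e1 z : (F (s i) x < z) = (x < F i z) by rewrite (ifs_lt_adj H) (ifs_inv H).
have e2 z : (z <= F (s i) y) = (F i z <= y) by rewrite (ifs_le_adj H).
by apply/seteqP; split => z /=; rewrite !in_itv /= e1 e2.
Qed.

(** Continuity of the measure along intervals shrinking to x, which is not an atom. *)
Lemma cum_close x e : 0 < e -> exists2 d : R, 0 < d & cum (x + d) - cum (x - d) < e.
Proof.
move=> e0; pose E n : set R := `]x - n.+1%:R^-1, x + n.+1%:R^-1]%classic.
have pn n : 0 < n.+1%:R^-1 :> R by rewrite invr_gt0 ltr0n.
have mE n : measurable (E n) by exact: measurable_itv.
have capE : \bigcap_n E n = [set x].
  apply/seteqP; split => [z hz|_ -> n _]; last first.
    by rewrite /E /= in_itv /=; move: (n.+1%:R^-1) (pn n) => q q0; lra.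
  apply/eqP; rewrite -subr_eq0 -normr_le0; apply/ler_addgt0Pl => k k0; rewrite addr0.
  have [n nk] : exists n, n.+1%:R^-1 <= k :> R.
    exists (Num.bound k^-1); rewrite -[leRHS]invrK lef_pV2 ?posrE ?invr_gt0 ?ltr0n //.
    apply: le_trans (ltW (archi_boundP _)) _; first by rewrite invr_ge0 ltW.
    by rewrite ler_nat.
  have := hz n Logic.I; rewrite /E /= in_itv /= ler_norml; move: (n.+1%:R^-1) nk => q nk; lra.
have cv : (nu \o E) n @[n --> \oo] --> nu (\bigcap_n E n).
  apply: nonincreasing_cvg_mu => //.
  - by rewrite -ge0_fin_numE //; exact: itv_fin.
  - by rewrite capE; exact: measurable_set1.
  - apply/nonincreasing_seqP => n; apply/subsetPset => z; rewrite /E /= !in_itv /=.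
    have : n.+2%:R^-1 <= n.+1%:R^-1 :> R by rewrite lef_pV2 ?posrE ?ltr0n // ler_nat.
    move: (n.+1%:R^-1) (n.+2%:R^-1) => q q' qq'; lra.
rewrite capE point_null in cv.
have /fine_cvg /cvgrPdist_lt /(_ e e0) [n _ /(_ n (leqnn n))] := cv.
rewrite /= sub0r normrN ger0_norm; last by rewrite fine_ge0.
move=> hn; exists n.+1%:R^-1 => //.
have h : x - n.+1%:R^-1 <= x + n.+1%:R^-1 by move: (n.+1%:R^-1) (pn n) => q q0; lra.
by rewrite -[ltLHS]/(fine (_)%:E) -nu_itv.
Qed.

Lemma cum_continuous : continuous cum.
Proof.
move=> x; apply/cvgrPdist_lt => e e0.
have [d d0 hd] := cum_close x e0.
near=> y; have : `|x - y| < d by near: y; exact: cvgr_dist_lt.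
rewrite ltr_norml => yd.
have h1 : cum (x - d) <= cum y by apply: cum_le; lra.
have h2 : cum y <= cum (x + d) by apply: cum_le; lra.
have h3 : cum (x - d) <= cum x by apply: cum_le; lra.
have h4 : cum x <= cum (x + d) by apply: cum_le; lra.
rewrite ltr_norml; lra.
Unshelve. all: by end_near. Qed.

Lemma cum_not_cst : ~ (forall x y, cum x = cum y).
Proof.
move=> hc; move: nu_nz; rewrite /nonzero_measure => /eqP; apply.
pose E n : set R := `]- n%:R, n%:R]%classic.
have En n : nu (E n) = 0%E.
  by rewrite /E nu_itv ?(hc (- n%:R) n%:R) ?subrr //; have := ler0n R n; lra.
apply/eqP; rewrite -measure_le0.
have -> : [set: R] = \bigcup_n E n.
  apply/seteqP; split => // x _; exists (Num.bound `|x|).+1 => //.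
  have := archi_boundP (normr_ge0 x) => h.
  have {h} : `|x| < (Num.bound `|x|).+1%:R by apply: lt_le_trans h _; rewrite ler_nat.
  by rewrite /E /= in_itv /= ltr_norml; lra.
apply: le_trans (measure_sigma_subadditive nu (F := E) _ _ _) _ => //.
- by move=> n; exact: measurable_itv.
- by apply: bigcupT_measurable => n; exact: measurable_itv.
- by rewrite eseries0.
Qed.

Let drift x := \sum_i p i * (cum (F i x) - cum x).

Let drift_cst x y : drift x = drift y.
Proof.
have e1 : \sum_i p i * (cum x - cum y) = cum x - cum y.
  by rewrite -mulr_suml (ifs_sum H) mul1r.
have : drift x - drift y =
    \sum_i p i * (cum (F i x) - cum (F i y)) - \sum_i p i * (cum x - cum y).
  by rewrite /drift -!sumrB; apply: eq_bigr => i _; ring.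
rewrite cum_harm e1 subrr => /eqP; by rewrite subr_eq0 => /eqP.
Qed.

Let avg_cum x : avg p F cum x = cum x + drift x.
Proof.
rewrite /drift /avg -{1}(avg_cst H (cum x) 0) /avg -big_split.
by apply: eq_bigr => i _ /=; ring.
Qed.

(** Otherwise the constant drift is nonnegative, so sup cum - cum is nonnegative, superharmonic and
    monotone, hence constant, and [nu] vanishes. *)
Lemma cum_ubound (B : R) : exists x, B < cum x.
Proof.
apply: contrapT => /forallNP hB.
have {}hB x : cum x <= B by rewrite leNgt; apply/negP/hB.
have hs : has_sup (range cum) by split; [exists (cum 0), 0|exists B => _ [x _ <-]].
pose T := sup (range cum).
have hT x : cum x <= T by apply: sup_upper_bound => //; exists x.
(* The drift is the same everywhere, so it is evaluated far enough to the right that [cum] is within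
   e of its supremum at all images. *)
have drift0 x : 0 <= drift x.
  apply/ler_addgt0Pl => e e0.
  have [_ [x0 _ <-] hx0] := sup_adherent e0 hs.
  have [x1 hx1] : exists x1, forall i, x0 <= F i x1.
    exists (\sum_i `|F (s i) x0|) => i.
    have : F (s i) x0 <= \sum_i `|F (s i) x0|; last by rewrite (ifs_le_adj H) (ifs_inv H).
    apply: le_trans (ler_norm _) _; rewrite (bigD1 i) //= lerDl.
    by apply: sumr_ge0.
  rewrite (drift_cst x x1); have := avg_cum x1; have := hT x1.
  have : cum x0 <= avg p F cum x1.
    rewrite -{1}(avg_cst H (cum x0) 0); apply: ler_sum => i _.
    by rewrite ler_pM2l ?(ifs_gt0 H) // cum_le.
  move: hx0; rewrite -/T; lra.
apply: cum_not_cst => x y.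
have := @superharmonic_nonincr_cst _ _ _ _ _ H (fun z => T - cum z) _ _ _ x y.
suff h : T - cum x = T - cum y -> cum x = cum y.
  move=> h'; apply: h; apply: h'.
  - by move=> z; rewrite avgB (avg_cst H) lerB // avg_cum lerDl.
  - by move=> z; rewrite subr_ge0.
  - by move=> z t zt; rewrite lerB // cum_le.
lra.
Qed.

Lemma cum_lbound (B : R) : exists x, cum x < B.
Proof.
apply: contrapT => /forallNP hB.
have {}hB x : B <= cum x by rewrite leNgt; apply/negP/hB.
have hs : has_inf (range cum) by split; [exists (cum 0), 0|exists B => _ [x _ <-]].
pose T := inf (range cum).
have hT x : T <= cum x by apply: ge_inf; [case: hs|exists x].
have drift0 x : drift x <= 0.
  apply/ler_addgt0Pl => e e0; rewrite addr0.
  have [_ [x0 _ <-] hx0] := inf_adherent e0 hs.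
  have [x1 hx1] : exists x1, forall i, F i x1 <= x0.
    exists (- \sum_i `|F (s i) x0|) => i; rewrite (ifs_le_adj H).
    rewrite lerNl; apply: le_trans (ler_norm _) _; rewrite normrN (bigD1 i) //= lerDl.
    by apply: sumr_ge0.
  rewrite (drift_cst x x1); have := avg_cum x1; have := hT x1.
  have : avg p F cum x1 <= cum x0.
    rewrite -{1}(avg_cst H (cum x0) 0); apply: ler_sum => i _.
    by rewrite ler_pM2l ?(ifs_gt0 H) // cum_le.
  move: hx0; rewrite -/T; lra.
apply: cum_not_cst => x y.
have := @superharmonic_nondecr_cst _ _ _ _ _ H (fun z => cum z - T) _ _ _ x y.
suff h : cum x - T = cum y - T -> cum x = cum y.
  move=> h'; apply: h; apply: h'.
  - by move=> z; rewrite avgB (avg_cst H) lerB // avg_cum gerDl.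
  - by move=> z; rewrite subr_ge0.
  - by move=> z t zt; rewrite lerB // cum_le.
lra.
Qed.

Lemma cum_surj t : exists x, cum x = t.
Proof.
have [a ha] := cum_lbound t; have [b hb] := cum_ubound t.
have ab : a <= b by apply: ltW; apply: cum_lt; exact: lt_trans hb.
have [|c _ hc] := @IVT R cum a b t ab (continuous_subspaceT cum_continuous).
  by rewrite ge_min le_max (ltW ha) (ltW hb) orbT.
by exists c.
Qed.

(** An orbit avoiding ]a, b[ would make it a gap of an invariant set, hence null. *)
Lemma cum_minimal x a b : cum a < cum b -> exists w, a < act F w x < b.
Proof.
move=> hab; apply: contrapT => /forallNP hw.
have ab := cum_lt hab.
have gap : nu `]a, b[%classic = 0%E.
  apply: (gap_null (A := range (fun w => act F w x))).
  - by exists x, [::].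
  - by move=> i _ [w _ <-]; exists (rcons w i) => //; rewrite act_rcons.
  - by move=> z zz [w _ wz]; apply: (hw w); rewrite wz.
have : nu `]a, b]%classic = 0%E.
  have -> : `]a, b]%classic = `]a, b[%classic `|` [set b].
    apply/seteqP; split => z /=; rewrite !in_itv /=.
      by rewrite le_eqVlt => /andP[az /orP[/eqP|zb]]; [right|left; rewrite az].
    by case=> [/andP[-> /ltW]|->] //; rewrite ab lexx.
  by rewrite measureU0 ?gap ?point_null.
rewrite nu_itv ?(ltW ab) // => /eqP; rewrite eqe => /eqP; lra.
Qed.

(** A zero mean of nonnegative increments has zero terms. This is what lets the action descend to
    the quotient by [cum]. *)
Lemma cum_equi x y i : cum x = cum y -> cum (F i x) = cum (F i y).
Proof.
wlog xy : x y / x <= y.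
  by move=> h e; case: (leP x y) => [|/ltW] xy; [|symmetry]; apply: h.
move=> e; have := cum_harm x y; rewrite e subrr => h0.
apply/eqP; rewrite eq_le cum_le ?(ifs_leE H) //= -subr_le0 -(pmulr_rle0 _ (ifs_gt0 H i)).
rewrite -h0 (bigD1 i) //= lerDl; apply: sumr_ge0 => j _.
by rewrite mulr_ge0 ?(p_ge0 H) // subr_ge0 cum_le // (ifs_leE H).
Qed.

End cumulative.

(** * Integration against invariant measures *)

Section integral_functional.
Context {R : realType} (nu : {measure set (measurableTypeR R) -> \bar R}).
Hypothesis nu_radon : radon nu.
Local Notation T := (measurableTypeR R).
Implicit Types (f g : R -> R).

Lemma tcont_measurable f : tcont f -> measurable_fun [set: T] (f : T -> R).
Proof. by move=> [fc _]; exact: continuous_measurable_fun. Qed.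

Lemma tcont_bounded f : tcont f -> exists M, forall x, `|f x| <= M.
Proof.
move=> [fc [r fr]].
have /compact_bounded[M [_ hM]] : compact (f @` `[- `|r|, `|r|]).
  by apply: continuous_compact; [exact: continuous_subspaceT|exact: segment_compact].
exists (`|M| + 1) => x; case: (leP `|x| `|r|) => xr.
  apply: (hM (`|M| + 1)); first by apply: le_lt_trans (ler_norm M) _; rewrite ltrDl.
  by exists x => //; rewrite /= in_itv /= -ler_norml.
by rewrite fr ?normr0 ?addr_ge0 //; apply: le_lt_trans xr; exact: ler_norm.
Qed.

Lemma tcont_integrable f : tcont f -> nu.-integrable setT (EFin \o (f : T -> R)).
Proof.
move=> tf; have [_ [r fr]] := tf; have [M hM] := tcont_bounded tf.
pose K : set T := `[- `|r|, `|r|]%classic.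
have mK : measurable K by exact: measurable_itv.
have fK : EFin \o f = (EFin \o f) \_ K.
  apply/funext => x; rewrite /patch; case: ifPn => //; rewrite notin_setE /K /= in_itv /=.
  move=> /negP; rewrite -ler_norml -ltNge => xr; rewrite fr //.
  exact: le_lt_trans (ler_norm r) xr.
rewrite fK; have [h _] := @integrable_mkcond _ T R nu K (EFin \o (f : T -> R)) mK; apply: h.
apply: measurable_bounded_integrable => //.
- exact: nu_radon (@segment_compact R _ _).
- exact: measurable_funTS (tcont_measurable tf).
- exists M; split; first exact: num_real.
  by move=> x Mx y _ /=; rewrite (le_trans (hM y)) // ltW.
Qed.

Definition nuint f : R := \int[nu]_x (f x).

Lemma nuintD f g : tcont f -> tcont g -> nuint (fun x => f x + g x) = nuint f + nuint g.
Proof. by move=> tf tg; apply: RintegralD => //; exact: tcont_integrable. Qed.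

Lemma nuintZ a f : tcont f -> nuint (fun x => a * f x) = a * nuint f.
Proof. by move=> tf; apply: RintegralZl => //; exact: tcont_integrable. Qed.

Lemma nuint_le f g : tcont f -> tcont g -> (forall x, f x <= g x) -> nuint f <= nuint g.
Proof. by move=> tf tg fg; apply: le_Rintegral => //; exact: tcont_integrable. Qed.

End integral_functional.

Section average_measure.
Context {R : realType} {I : finType} (p : I -> R) (F : I -> R -> R).
Variable nu : {measure set (measurableTypeR R) -> \bar R}.
Local Notation T := (measurableTypeR R).
Hypothesis p0 : forall i, 0 <= p i.
Hypothesis F_cont : forall i, continuous (F i).

Let mF (i : I) : measurable_fun [set: T] (F i : T -> T).
Proof. exact: continuous_measurable_fun. Qed.

Let push (i : I) : {measure set T -> \bar R}.
Proof. refine (pushforward nu (F i : T -> T) : {measure set T -> \bar R}); exact: mF. Defined.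

(** The measure sum_i p_i (F i)_* nu, built by folding so that its integrals follow from those for
    sums, scalings and images. *)
Let avg_measure (r : seq I) : {measure set T -> \bar R} :=
  foldr (fun i m => measure_add (mscale (NngNum (p0 i)) (push i)) m : {measure set T -> \bar R})
    (mzero : {measure set T -> \bar R}) r.

Let avg_measureE r A : avg_measure r A = (\sum_(i <- r) (p i)%:E * nu (F i @^-1` A))%E.
Proof.
elim: r => [|i r IHr] /=; first by rewrite big_nil.
by apply: etrans (measure_addE _ _ _) _; rewrite big_cons -IHr.
Qed.

Let avg_integral r (f : T -> \bar R) : measurable_fun setT f -> (forall x, 0 <= f x)%E ->
  (\int[avg_measure r]_x f x = \sum_(i <- r) (p i)%:E * \int[nu]_x f (F i x))%E.
Proof.
move=> mf f0; elim: r => [|i r IHr] /=; first by rewrite big_nil integral_measure_zero.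
rewrite ge0_integral_measure_add // big_cons -IHr ge0_integral_mscale //.
congr (_ * _ + _)%E; rewrite ge0_integral_pushforward //; exact: mF.
Qed.

Hypothesis nu_inv : forall A : set R, measurable A ->
  nu A = (\sum_i (p i)%:E * nu (F i @^-1` A))%E.

Lemma ge0_integral_inv (f : T -> \bar R) : measurable_fun setT f -> (forall x, 0 <= f x)%E ->
  (\int[nu]_x f x = \sum_i (p i)%:E * \int[nu]_x f (F i x))%E.
Proof.
move=> mf f0; rewrite -big_enum -avg_integral //=.
apply: eq_measure_integral => A mA _.
by rewrite nu_inv // -big_enum; apply/esym/avg_measureE.
Qed.

End average_measure.

Lemma tcont_comp (R : realType) (f h : R -> R) : tcont f -> continuous h ->
  {homo h : x y / x <= y} -> (forall B, exists x, B < h x) ->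
  (forall B, exists x, h x < B) -> tcont (f \o h).
Proof.
move=> [fc [r fr]] hc hmon hub hlb; split.
  by move=> x; apply: continuous_comp; [exact: hc|exact: fc].
have [a ha] := hub r; have [b hb] := hlb (- r).
exists (`|a| + `|b|) => x; rewrite ltr_normr => hx; apply: fr; rewrite ltr_normr.
have na := ler_norm a; have nb := ler_norm (- b); rewrite normrN in nb.
have na0 := normr_ge0 a; have nb0 := normr_ge0 b.
case/orP: hx => hx; apply/orP; [left|right].
  by apply: lt_le_trans ha _; apply: hmon; lra.
by rewrite ltrNr; apply: le_lt_trans hb; apply: hmon; lra.
Qed.

Section integral_invariance.
Context {R : realType} {I : finType} (p : I -> R) (F : I -> R -> R) (s : I -> I).
Hypothesis H : symmetric_ifs p F s.
Hypothesis F_cont : forall i, continuous (F i).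
Variable nu : {measure set (measurableTypeR R) -> \bar R}.
Hypothesis nu_radon : radon nu.
Hypothesis nu_inv : forall A : set R, measurable A ->
  nu A = (\sum_i (p i)%:E * nu (F i @^-1` A))%E.
Implicit Types (f : R -> R).

Lemma tcont_act1 f (i : I) : tcont f -> tcont (f \o F i).
Proof.
move=> tf; apply: tcont_comp => //.
- by move=> x y xy; rewrite (ifs_leE H).
- move=> B; exists (F (s i) (B + 1)); rewrite (ifs_KV H); lra.
- move=> B; exists (F (s i) (B - 1)); rewrite (ifs_KV H); lra.
Qed.

Let nuint_inv0 f : tcont f -> (forall x, 0 <= f x) ->
  nuint nu f = \sum_i p i * nuint nu (f \o F i).
Proof.
move=> tf f0; rewrite /nuint /Rintegral (ge0_integral_inv (p_ge0 H) F_cont nu_inv).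
- rewrite -sum_fine; last first.
    move=> i _; rewrite fin_numM //; apply: integrable_fin_num => //.
    exact: tcont_integrable (tcont_act1 i tf).
  apply: eq_bigr => i _; rewrite fineM //; apply: integrable_fin_num => //.
  exact: tcont_integrable (tcont_act1 i tf).
- by apply/measurable_EFinP; exact: tcont_measurable.
- by move=> x; rewrite lee_fin.
Qed.

Lemma nuint_inv f : tcont f -> nuint nu f = \sum_i p i * nuint nu (f \o F i).
Proof.
move=> tf; pose f1 x := (`|f x| + f x) / 2; pose f2 x := (`|f x| - f x) / 2.
have t1 : tcont f1.
  have [fc [r fr]] := tf; split; last by exists r => x /fr; rewrite /f1 => ->; rewrite normr0 addr0 mul0r.
  move=> x; apply: cvgM; last exact: cvg_cst.
  by apply: cvgD; [apply: cvg_norm; exact: fc|exact: fc].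
have t2 : tcont f2.
  have [fc [r fr]] := tf; split; last by exists r => x /fr; rewrite /f2 => ->; rewrite normr0 subr0 mul0r.
  move=> x; apply: cvgM; last exact: cvg_cst.
  by apply: cvgB; [apply: cvg_norm; exact: fc|exact: fc].
have f12 : f = fun x => f1 x + -1 * f2 x by apply/funext => x; rewrite /f1 /f2; lra.
have f1_ge0 x : 0 <= f1 x.
  by rewrite /f1; have := ler_norm (- f x); rewrite normrN; lra.
have f2_ge0 x : 0 <= f2 x by rewrite /f2; have := ler_norm (f x); lra.
have tZ g : tcont g -> tcont (fun x => -1 * g x) by apply: tcontM; exact: cst_continuous.
rewrite f12 (nuintD nu_radon) //; last exact: tZ.
rewrite (nuintZ nu_radon) // !nuint_inv0 //.
rewrite mulr_sumr -big_split; apply: eq_bigr => i _ /=.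
have -> : (fun x => f1 x + -1 * f2 x) \o F i =
  (fun x => (f1 \o F i) x + -1 * (f2 \o F i) x) by [].
rewrite (nuintD nu_radon) ?(nuintZ nu_radon) //; try exact: tcont_act1.
- ring.
- by apply: tZ; exact: tcont_act1.
Qed.

Lemma nuint_avg f : tcont f -> nuint nu (avg p F f) = nuint nu f.
Proof.
move=> tf; rewrite [RHS]nuint_inv //.
have : forall r : seq I, nuint nu (fun x => \sum_(i <- r) p i * f (F i x)) =
    \sum_(i <- r) p i * nuint nu (f \o F i) /\ tcont (fun x => \sum_(i <- r) p i * f (F i x)).
  elim=> [|i r [IHr tr]].
    rewrite big_nil; split.
      rewrite -[RHS](mul0r (nuint nu f)) -(nuintZ nu_radon) //.
      by congr (nuint nu _); apply/funext => x; rewrite big_nil mul0r.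
    by split; [move=> x; under eq_fun do rewrite big_nil; exact: cvg_cst|exists 0 => x _; rewrite big_nil].
  have -> : (fun x => \sum_(i <- i :: r) p i * f (F i x)) =
      (fun x => p i * (f \o F i) x + \sum_(i <- r) p i * f (F i x)).
    by apply/funext => x; rewrite big_cons.
  have tp : tcont (fun x => p i * (f \o F i) x).
    by apply: tcontM; [exact: cst_continuous|exact: tcont_act1].
  split; last exact: tcontD.
  by rewrite big_cons (nuintD nu_radon) // (nuintZ nu_radon) ?IHr //; exact: tcont_act1.
by move=> /(_ (index_enum I)) [].
Qed.

End integral_invariance.

(* D collapses the gaps of the support of an invariant measure; quo is the induced
   action on the quotient line, read through a section of D. *)
Section quotient.
Context {R : realType} {I : finType} (p : I -> R) (F : I -> R -> R) (s : I -> I).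
Hypothesis H : symmetric_ifs p F s.
Variables (D sec : R -> R).
Hypothesis D_cont : continuous D.
Hypothesis D_le : {homo D : x y / x <= y}.
Hypothesis secK : cancel sec D.
Hypothesis D_harm : forall x y, \sum_i p i * (D (F i y) - D (F i x)) = D y - D x.
Hypothesis D_equi : forall x y i, D x = D y -> D (F i x) = D (F i y).
Hypothesis D_min : forall x a b, D a < D b -> exists w, a < act F w x < b.
Implicit Types (x y t u : R) (i : I).

Definition quo i t : R := D (F i (sec t)).

Lemma quoE i x : quo i (D x) = D (F i x).
Proof. by apply: D_equi; rewrite secK. Qed.

Lemma act_quo w x : act quo w (D x) = D (act F w x).
Proof. by elim: w x => [//|i w IHw] x /=; rewrite quoE IHw. Qed.

Lemma quo_harm t u : \sum_i p i * (quo i u - quo i t) = u - t.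
Proof. by rewrite -[in RHS](secK u) -[in RHS](secK t) -D_harm. Qed.

Lemma quo_minimal t a b : a < b -> exists w, a < act quo w t < b.
Proof.
(* [D] is only weakly increasing: strict inequalities between points become weak ones between
   values, and the middle third leaves room for that. *)
move=> ab; have [|w] := @D_min (sec t) (sec ((2 * a + b) / 3)) (sec ((a + 2 * b) / 3)).
  by rewrite !secK; lra.
move=> /andP[/ltW /D_le h1 /ltW /D_le h2]; exists w.
by rewrite -{1 2}(secK t) act_quo; move: h1 h2; rewrite !secK; lra.
Qed.

Let D_lt x y : D x < D y -> x < y.
Proof. by rewrite !ltNge; apply: contra; exact: D_le. Qed.

Let D_step i x y : x <= y -> p i * (D (F i y) - D (F i x)) <= D y - D x.
Proof.
move=> xy; rewrite -[leRHS]D_harm (bigD1 i) //= lerDl; apply: sumr_ge0 => j _.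
by rewrite mulr_ge0 ?(p_ge0 H) // subr_ge0 D_le // (ifs_leE H).
Qed.

(** Strict monotonicity holds because the inverse map expands [D]-lengths by at most 1/p, so
    positive length stays positive. Distinct indices may induce the same map here, which an indexed
    family allows. *)
Lemma quo_ifs : symmetric_ifs p quo s.
Proof.
split.
- exact: ifs_gt0 H.
- exact: ifs_sum H.
- move=> i t u tu; rewrite /quo.
  have st : sec t < sec u by apply: D_lt; rewrite !secK.
  have := @D_step (s i) (F i (sec t)) (F i (sec u)).
  rewrite (ifs_leE H) (ltW st) !(ifs_K H) !secK => /(_ isT).
  have : 0 < p (s i) * (u - t) by rewrite mulr_gt0 ?(ifs_gt0 H) // subr_gt0.
  lra.
- exact: ifs_inv H.
- exact: ifs_sym H.
- by move=> i t; rewrite [quo i t]/quo quoE (ifs_K H) secK.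
- move=> t; apply: contrapT => /forallNP h.
  have {}h i : quo i t = t by apply/eqP; have /negP := h i; rewrite negbK.
  have hw w : act quo w t = t by elim: w => [//|i w IHw] /=; rewrite h.
  have [|w] := @quo_minimal t (t + 1) (t + 2); first by lra.
  rewrite hw; lra.
Qed.

Let D_ub B : exists x, B < D x.
Proof. by exists (sec (B + 1)); rewrite secK; lra. Qed.

Let D_lb B : exists x, D x < B.
Proof. by exists (sec (B - 1)); rewrite secK; lra. Qed.

Lemma tcont_compD f : tcont f -> tcont (f \o D).
Proof. by move=> tf; exact: tcont_comp. Qed.

Lemma quo_functional (nu : {measure set (measurableTypeR R) -> \bar R}) :
  (forall i, continuous (F i)) -> radon nu ->
  (forall A : set R, measurable A -> nu A = (\sum_i (p i)%:E * nu (F i @^-1` A))%E) ->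
  invariant_functional p quo (fun f => nuint nu (f \o D)).
Proof.
move=> F_cont nu_radon nu_inv; split.
- by move=> f g tf tg; apply: (nuintD nu_radon (f := f \o D) (g := g \o D)); exact: tcont_compD.
- by move=> a f tf; apply: (nuintZ nu_radon a (f := f \o D)); exact: tcont_compD.
- move=> f g tf tg fg; apply: (nuint_le nu_radon); [exact: tcont_compD..|].
  by move=> x; exact: fg.
- move=> f tf; rewrite -[RHS](nuint_avg H F_cont nu_radon nu_inv (tcont_compD tf)).
  by congr (nuint nu _); apply/funext => x; apply: eq_bigr => i _; rewrite /= quoE.
Qed.

End quotient.

(** * Interval indicators and trapezoids *)

Definition itv_ind (R : realType) (a b x : R) : R := ((a < x) && (x <= b))%:R.

Definition trap (R : realType) (u v d t : R) : R :=
  Num.max 0 (Num.min 1 (Num.min ((t - u) / d) ((v - t) / d))).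

Lemma dist_min (R : realType) (a b a' b' q : R) : `|a - a'| <= q -> `|b - b'| <= q ->
  `|Num.min a b - Num.min a' b'| <= q.
Proof.
rewrite !ler_norml /Num.min => h1 h2.
by case: (ltP a b); case: (ltP a' b'); lra.
Qed.

Lemma dist_max (R : realType) (a b a' b' q : R) : `|a - a'| <= q -> `|b - b'| <= q ->
  `|Num.max a b - Num.max a' b'| <= q.
Proof.
rewrite !ler_norml /Num.max => h1 h2.
by case: (ltP a b); case: (ltP a' b'); lra.
Qed.

Section trapezoid.
Context {R : realType}.
Variables (u v d : R).
Hypothesis d0 : 0 < d.

Lemma trap_ge0 t : 0 <= trap u v d t.
Proof. by rewrite /trap le_max lexx. Qed.

Lemma trap_le1 t : trap u v d t <= 1.
Proof. by rewrite /trap ge_max ler01 ge_min lexx. Qed.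

Lemma trap_out t : ~~ (u < t < v) -> trap u v d t = 0.
Proof.
rewrite negb_and -!leNgt => h; rewrite /trap max_l // !ge_min.
have d0' := d0.
case/orP: h => h; apply/orP; right; apply/orP; [left|right];
  by rewrite ler_pdivrMr // mul0r; lra.
Qed.

Lemma trap_in t : u + d <= t -> t <= v - d -> trap u v d t = 1.
Proof.
move=> h1 h2; have d0' := d0; rewrite /trap min_l; first by rewrite max_r.
by rewrite le_min !ler_pdivlMr // mul1r; lra.
Qed.

Lemma trap_lip : lip d^-1 (trap u v d).
Proof.
have d0' := d0; have i0 : 0 < d^-1 by rewrite invr_gt0.
have e x y : d^-1 * `|x - y| = `|x / d - y / d|.
  by rewrite -mulrBl normrM (gtr0_norm i0) mulrC.
move=> x y; rewrite e /trap !mulrBl.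
have q0 := normr_ge0 (x / d - y / d).
apply: dist_max; first by rewrite subrr normr0.
apply: dist_min; first by rewrite subrr normr0.
apply: dist_min.
  have -> // : x / d - u / d - (y / d - u / d) = x / d - y / d by ring.
by have -> : v / d - x / d - (v / d - y / d) = - (x / d - y / d) by [ring]; rewrite normrN.
Qed.

End trapezoid.

Section integrable_functions.
Context {R : realType} (nu : {measure set (measurableTypeR R) -> \bar R}).
Hypothesis nu_radon : radon nu.
Local Notation T := (measurableTypeR R).
Implicit Types (f g : R -> R).

Definition integ f := nu.-integrable setT (EFin \o (f : T -> R)).

Lemma integ_lin a f g : integ f -> integ g -> integ (fun x => a * f x + g x).
Proof.
move=> hf hg; rewrite /integ.
have -> : EFin \o (fun x => a * f x + g x) =
  ((fun x => a%:E * (EFin \o f) x) \+ (EFin \o g))%E by apply/funext => x.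
by apply: integrableD => //; apply: integrableZl.
Qed.

Lemma nuint_lin a f g : integ f -> integ g ->
  nuint nu (fun x => a * f x + g x) = a * nuint nu f + nuint nu g.
Proof.
move=> hf hg; rewrite /nuint RintegralD //; first by rewrite RintegralZl.
have := @integ_lin a f (fun=> 0) hf; rewrite /integ.
have -> : (fun x => a * f x + 0) = fun x => a * f x by apply/funext => x; rewrite addr0.
by apply; exact: integrable0.
Qed.

Lemma integ_itv (a b : R) : integ (itv_ind a b).
Proof.
pose K : set T := `]a, b]%classic.
have mK : measurable K by exact: measurable_itv.
have [h _] := @integrable_mkcond _ T R nu K (EFin \o (cst 1 : T -> R)) mK.
have -> : integ (itv_ind a b) = nu.-integrable setT ((EFin \o (cst 1 : T -> R)) \_ K).
  rewrite /integ; congr (_.-integrable _ _); apply/funext => x.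
  rewrite /patch /itv_ind /=; case: ifPn; rewrite ?notin_setE ?inE /K /= in_itv /=.
    by move=> ->.
  by move=> /negP/negPf ->.
apply: h; apply: measurable_bounded_integrable => //.
  by rewrite -ge0_fin_numE //; exact: itv_fin.
exact: bounded_cst.
Qed.

Lemma nuint_itv (a b : R) : nuint nu (itv_ind a b) = fine (nu `]a, b]%classic).
Proof.
rewrite /nuint /Rintegral; congr (fine _).
have mK : measurable (`]a, b]%classic : set T) by exact: measurable_itv.
rewrite -[X in nu X]setIT -integral_indic //.
apply: eq_integral => x _; rewrite indicE /itv_ind; congr (_%:R)%:E.
congr nat_of_bool; apply/idP/idP; first by move=> h; rewrite inE /= in_itv.
by rewrite inE /= in_itv.
Qed.

Lemma nuint_mono f g : integ f -> integ g -> (forall x, f x <= g x) ->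
  nuint nu f <= nuint nu g.
Proof. by move=> hf hg fg; apply: le_Rintegral. Qed.

End integrable_functions.

(** * Comparison with functions of the distribution function *)

Section squeeze.
Context {R : realType} (nu : {measure set (measurableTypeR R) -> \bar R}).
Hypothesis nu_radon : radon nu.
Variables (D sec : R -> R).
Hypothesis D_cont : continuous D.
Hypothesis D_le : {homo D : x y / x <= y}.
Hypothesis secK : cancel sec D.
Hypothesis nuD : forall x y, x <= y -> nu `]x, y]%classic = (D y - D x)%:E.

Let D_lt x y : D x < D y -> x < y.
Proof. by rewrite !ltNge; apply: contra; exact: D_le. Qed.

Lemma trap_tcont (u v d : R) : 0 < d -> tcont (trap u v d).
Proof.
move=> d0; split; first exact: lip_continuous (trap_lip u v d0).
exists (`|u| + `|v|) => x hx; apply: trap_out => //; apply/negP => /andP[h1 h2].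
move: hx; rewrite ltNge => /negP; apply; rewrite ler_norml.
have := ler_norm u; have := ler_norm v; have := ler_norm (- u); have := ler_norm (- v).
rewrite !normrN; lra.
Qed.

Lemma trap_integ (u v d : R) : 0 < d -> integ nu (trap u v d \o D).
Proof.
by move=> d0; apply: tcont_integrable => //; apply: (tcont_compD D_cont D_le secK); exact: trap_tcont.
Qed.

Lemma trap_le_itv (u v d t : R) : 0 < d -> trap u v d (D t) <= itv_ind (sec u) (sec v) t.
Proof.
move=> d0; case: (boolP (u < D t < v)) => [/andP[h1 h2]|h]; last first.
  by rewrite trap_out // ler0n.
have -> : itv_ind (sec u) (sec v) t = 1; last exact: trap_le1.
by rewrite /itv_ind D_lt ?secK //= (ltW (D_lt _)) ?secK.
Qed.

Lemma itv_le_trap (x y d t : R) : 0 < d ->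
  itv_ind x y t <= trap (D x - d) (D y + d) d (D t).
Proof.
move=> d0; rewrite /itv_ind; case: (boolP (_ && _)) => [/andP[/ltW /D_le h1 /D_le h2]|_].
  by rewrite trap_in //; lra.
exact: trap_ge0.
Qed.

Lemma trap_le_itvD (x y d t : R) : 0 < d ->
  trap (D x) (D y) d (D t) <= itv_ind x y t.
Proof.
move=> d0; case: (boolP (D x < D t < D y)) => [/andP[h1 h2]|h]; last first.
  by rewrite trap_out // ler0n.
by rewrite /itv_ind (D_lt h1) (ltW (D_lt h2)) trap_le1.
Qed.

Lemma nuint_itvD (x y : R) : x <= y -> nuint nu (itv_ind x y) = D y - D x.
Proof. by move=> xy; rewrite nuint_itv nuD. Qed.

(** [D] carries [nu] to Lebesgue measure, so the integral is compared with the base of the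
    trapezoid; the lower bound discards the two slopes of width d. *)
Lemma nuint_trap_le (u v d : R) : 0 < d -> u <= v -> nuint nu (trap u v d \o D) <= v - u.
Proof.
move=> d0; rewrite le_eqVlt => /orP[/eqP ->|uv].
  have -> : trap v v d \o D = itv_ind 0 0.
    apply/funext => t /=; rewrite trap_out //; last by apply/negP; lra.
    by rewrite /itv_ind; case: (ltP 0 t) => //= t0; rewrite leNgt t0.
  by rewrite nuint_itvD // !subrr.
rewrite -[in leRHS](secK u) -[in leRHS](secK v) -nuint_itvD; last first.
  by apply/ltW/D_lt; rewrite !secK.
apply: nuint_mono; [exact: trap_integ|exact: integ_itv|].
by move=> t; exact: trap_le_itv.
Qed.

Lemma nuint_trap_ge (u v d : R) : 0 < d -> v - u - 2 * d <= nuint nu (trap u v d \o D).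
Proof.
move=> d0; case: (ltP (u + d) (v - d)) => uv; last first.
  apply: (@le_trans _ _ 0); first lra.
  by apply: Rintegral_ge0 => t _; exact: trap_ge0.
have -> : v - u - 2 * d = D (sec (v - d)) - D (sec (u + d)) by rewrite !secK; ring.
rewrite -nuint_itvD; last by apply/ltW/D_lt; rewrite !secK.
apply: nuint_mono; [exact: integ_itv|exact: trap_integ|].
move=> t; rewrite /itv_ind; case: (boolP (_ && _)) => [/andP[/ltW /D_le h1 /D_le h2]|_]; last exact: trap_ge0.
by rewrite /= trap_in //; move: h1 h2; rewrite !secK; lra.
Qed.

End squeeze.

Section uniqueness.
Context {R : realType} {I : finType} (p : I -> R) (F : I -> R -> R) (s : I -> I).
Hypothesis H : symmetric_ifs p F s.
Hypothesis F_cont : forall i, continuous (F i).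
Variable nu : {measure set (measurableTypeR R) -> \bar R}.
Hypothesis nu_radon : radon nu.
Hypothesis nu_nz : nonzero_measure nu.
Hypothesis nu_inv : forall A : set R, measurable A ->
  nu A = (\sum_i (p i)%:E * nu (F i @^-1` A))%E.
Hypothesis nodisc : forall x, ~ (closed (range (fun w => act F w x)) /\
  range (fun w => act F w x) `<=` isolated (range (fun w => act F w x))).
Local Notation D := (cum nu).

Lemma cum_section : exists sec, cancel sec D.
Proof.
have [sec h] := choice (fun t => cum_surj H nu_radon nu_nz nu_inv nodisc t).
by exists sec.
Qed.

Variable sec : R -> R.
Hypothesis secK : cancel sec D.

Let D_cont : continuous D.
Proof. exact: (@cum_continuous _ _ _ _ _ H _ nu_radon nu_inv nodisc). Qed.
Let D_le : {homo D : x y / x <= y}.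
Proof. by move=> x y; exact: cum_le. Qed.
Let D_harm := cum_harm H nu_radon nu_inv.
Let D_equi x y i := @cum_equi _ _ _ _ _ H _ nu_radon nu_inv x y i.
Let D_min := cum_minimal H nu_radon nu_inv nodisc.
Let nuD x y := @nu_itv _ nu nu_radon x y.

Lemma quotient_weight r : exists xi, ratio_weight p (quo F D sec) r xi.
Proof.
apply: (ratio_weight_exists (quo_ifs H D_le secK D_harm D_equi D_min)).
  exact: quo_harm.
exact: (quo_minimal D_le secK D_equi D_min).
Qed.

Lemma quotient_functional (nu' : {measure set (measurableTypeR R) -> \bar R}) :
  radon nu' ->
  (forall A : set R, measurable A -> nu' A = (\sum_i (p i)%:E * nu' (F i @^-1` A))%E) ->
  invariant_functional p (quo F D sec) (fun f => nuint nu' (f \o D)).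
Proof. exact: (quo_functional H D_cont D_le secK D_equi F_cont). Qed.

Section comparison.
Variable nu' : {measure set (measurableTypeR R) -> \bar R}.
Hypothesis nu'_radon : radon nu'.
Hypothesis nu'_inv : forall A : set R, measurable A ->
  nu' A = (\sum_i (p i)%:E * nu' (F i @^-1` A))%E.

(** For any weight xi both measures give a trapezoid the same ratio to xi, the constant of its
    Poisson equation. Dividing by the ratio for one fixed trapezoid eliminates xi, which depends on
    u and v. *)
Lemma proportional_trap : exists2 k : R, 0 <= k & forall u v d, 0 < d ->
  nuint nu' (trap u v d \o D) = k * nuint nu (trap u v d \o D).
Proof.
pose m (u v d : R) := nuint nu (trap u v d \o D).
pose m' (u v d : R) := nuint nu' (trap u v d \o D).
have m0 : 0 < m (- 2) 2 1.
  by apply: lt_le_trans (nuint_trap_ge nu_radon D_cont D_le secK nuD _ _ ltr01); lra.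
exists (m' (- 2) 2 1 / m (- 2) 2 1).
  by rewrite divr_ge0 ?(ltW m0) //; apply: Rintegral_ge0 => t _; exact: trap_ge0.
move=> u v d d0; pose r := `|u| + `|v| + 2.
have [xi w] := quotient_weight r.
have hr u1 v1 d1 x : 0 < d1 -> `|u1| <= r -> `|v1| <= r -> r < `|x| -> trap u1 v1 d1 x = 0.
  move=> d10 ur vr xr; apply: trap_out => //; apply/negP => /andP[h1 h2].
  by move: xr ur vr; rewrite ltr_normr !ler_norml; case/orP; lra.
have nu0 := normr_ge0 u; have nv0 := normr_ge0 v.
have [|||c0 [hc0 _]] := weight_poisson w (phi := trap (- 2) 2 1) (L := 1^-1).
- exact: trap_lip.
- by move=> x; exact: trap_ge0.
- by move=> x; apply: hr; rewrite ?normrN ?ger0_norm // /r; lra.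
have [|||c [hc _]] := weight_poisson w (phi := trap u v d) (L := d^-1).
- exact: trap_lip.
- by move=> x; exact: trap_ge0.
- by move=> x; apply: hr => //; rewrite /r; lra.
have f := quotient_functional nu_radon nu_inv.
have f' := quotient_functional nu'_radon nu'_inv.
have := hc0 _ f; have := hc0 _ f'; have := hc _ f; have := hc _ f'.
rewrite -/(m u v d) -/(m' u v d) -/(m (-2) 2 1) -/(m' (-2) 2 1) => e1 e2 e3 e4.
apply: (mulIf (lt0r_neq0 m0)); rewrite mulrAC divfK ?lt0r_neq0 //.
rewrite e1 e2 e3 e4; ring.
Qed.

Lemma proportional_itv : exists2 k : R, 0 <= k & forall x y, x <= y ->
  nu' `]x, y]%classic = (k%:E * nu `]x, y]%classic)%E.
Proof.
have [k k0 hk] := proportional_trap; exists k => // x y xy.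
rewrite nuD // -EFinM -[LHS]fineK ?itv_fin // -nuint_itv; congr (_%:E).
apply/eqP; rewrite eq_le; apply/andP; split; apply/ler_addgt0Pr => e e0.
  (* The outer trapezoid exceeds the mass of ]x, y] by at most 2 d, scaled by k; k + 1 avoids a
     division by 0. *)
  pose d := e / (2 * (k + 1)).
  have d0 : 0 < d by rewrite divr_gt0 //; lra.
  have de : 2 * (k + 1) * d = e by rewrite /d mulrC divfK //; lra.
  have kd0 : 0 <= k * d by rewrite mulr_ge0 // ltW.
  apply: (@le_trans _ _ (nuint nu' (trap (D x - d) (D y + d) d \o D))).
    apply: nuint_mono; [exact: integ_itv|exact: (trap_integ _ D_cont D_le secK)|].
    by move=> t; exact: itv_le_trap.
  rewrite hk //; apply: (@le_trans _ _ (k * (D y + d - (D x - d)))).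
    rewrite ler_wpM2l // (nuint_trap_le nu_radon D_cont D_le secK nuD) //.
    have := D_le xy; lra.
  move: de; lra.
pose d := e / (2 * (k + 1)).
have d0 : 0 < d by rewrite divr_gt0 //; lra.
have de : 2 * (k + 1) * d = e by rewrite /d mulrC divfK //; lra.
apply: (@le_trans _ _ (nuint nu' (trap (D x) (D y) d \o D) + e)); last first.
  rewrite lerD2r; apply: nuint_mono; [exact: (trap_integ _ D_cont D_le secK)|exact: integ_itv|].
  by move=> t; exact: trap_le_itvD.
rewrite hk //; apply: (@le_trans _ _ (k * (D y - D x - 2 * d) + e)); first by move: de; lra.
rewrite lerD2r ler_wpM2l //; exact: (nuint_trap_ge nu_radon D_cont D_le secK nuD).
Qed.

Lemma proportional : exists2 k : R, 0 <= k & forall A : set R, measurable A ->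
  nu' A = (k%:E * nu A)%E.
Proof.
have [k k0 hk] := proportional_itv; exists k => // A mA.
pose k' := NngNum k0.
apply: (@measure_unique _ R (measurableTypeR R) (@ocitv R) (fun n => `]- n%:R, n%:R]%classic)
  erefl (@ocitvI R) _ _ nu' (mscale k' nu) _ _ A mA).
- by move=> n; exact: is_ocitv.
- apply/seteqP; split => // x _; exists (Num.truncn `|x|).+1 => //=; rewrite in_itv /=.
  have := truncnS_gt `|x|; rewrite ltr_norml => /andP[-> /ltW ->] //.
- move=> _ [[a b] _ <-] /=; rewrite /mscale /=; case: (leP a b) => ab; first exact: hk.
  by rewrite set_itv_ge ?measure0 ?mule0 // bnd_simp -leNgt ltW.
- by move=> n; rewrite -ge0_fin_numE //; exact: itv_fin.
Qed.

End comparison.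

End uniqueness.

Lemma unif_cont_segment (R : realType) (f : R -> R) (B e : R) : continuous f -> 0 < e ->
  exists n : nat, forall x y, `|x| <= B -> `|y - x| < n.+1%:R^-1 -> `|f y - f x| <= e.
Proof.
move=> fc e0.
have /compact_near_coveringP hK := @segment_compact R (- B) B.
pose Q (n : nat) (x : R) := forall y, `|y - x| < n.+1%:R^-1 -> `|f y - f x| <= e.
have [|N _ /(_ N (leqnn N)) hN] := hK nat \oo Q _; last first.
  by exists N => x y xB; apply: hN; rewrite /= in_itv /= -ler_norml.
move=> x _; have e2 : 0 < e / 2 by rewrite divr_gt0.
have /cvgrPdist_lt /(_ _ e2) /nbhs_ballP[d /= d0 hd] := fc x.
have d2 : 0 < d / 2 by rewrite divr_gt0.
exists (ball x (d / 2), [set n | n.+1%:R^-1 < d / 2]) => /=.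
  by split; [exact: nbhsx_ballx|exact: near_infty_natSinv_lt (PosNum d2)].
move=> [z n] /= [hz hn] y hy.
have h1 : `|f x - f z| < e / 2.
  by apply: hd; apply: le_ball hz; rewrite ler_pdivrMr // ler_pMr // ler1n.
have h2 : `|f x - f y| < e / 2.
  apply: hd; have hz' : `|x - z| < d / 2 by exact: hz.
  change (`|x - y| < d); have := ler_distD z x y; rewrite (distrC z y).
  have hy' := lt_trans hy hn; clear hy hn; lra.
have := ler_distD (f x) (f y) (f z); rewrite (distrC (f y) (f x)); clear hy hn; lra.
Qed.

Section good_functions.
Context d (Omega : measurableType d) {R : realType} (P : probability Omega R).
Variable g : nat -> {RV P >-> homeo R}.
Context {I : finType} (gen : I -> homeo R) (F : I -> R -> R).
Variable nu : {measure set (measurableTypeR R) -> \bar R}.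
Hypothesis nu_radon : radon nu.
Variables (x0 : R) (W : R -> R).
Hypothesis W0 : forall x, 0 <= W x.
Hypothesis W1 : 0 < nuint nu W.
Implicit Types (f : R -> R) (x y : R).

(** The index sequence is quantified inside the almost sure statement, so no measurable choice of
    indices is made. *)
Definition good f := integ nu f /\
  \forall omega \ae P, forall ix, (forall k, g k omega = gen (ix k)) ->
    wsum F f x0 (pre ix N) / wsum F W x0 (pre ix N) @[N --> \oo] --> nuint nu f / nuint nu W.

Lemma wsum_le f f' x w : (forall x, f x <= f' x) -> wsum F f x w <= wsum F f' x w.
Proof. by move=> ff'; elim: w x => [//|i w IHw] x /=; rewrite lerD. Qed.

Lemma wsum_lin a f f' x w :
  wsum F (fun x => a * f x + f' x) x w = a * wsum F f x w + wsum F f' x w.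
Proof. by elim: w x => [|i w IHw] x /=; rewrite ?IHw; ring. Qed.

Lemma good_lin a f f' : good f -> good f' -> good (fun x => a * f x + f' x).
Proof.
move=> [fi hf] [fi' hf']; split; first exact: integ_lin.
move: hf hf'; apply: filterS2 => omega hf hf' ix hix.
rewrite nuint_lin // mulrDl -mulrA.
under eq_fun do rewrite wsum_lin mulrDl -mulrA.
by apply: cvgD; [apply: cvgMr; exact: hf|exact: hf'].
Qed.

Lemma good_squeeze f : integ nu f -> (forall e, 0 < e -> exists f1 f2, [/\ good f1, good f2,
    forall x, f1 x <= f x, forall x, f x <= f2 x & nuint nu f2 - nuint nu f1 <= e]) ->
  good f.
Proof.
move=> fi hf; split => //.
(* A countable family of sandwiches, so that the exceptional null sets can be united. *)
have hk (k : nat) : exists fs : (R -> R) * (R -> R), [/\ good fs.1, good fs.2,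
    forall x, fs.1 x <= f x, forall x, f x <= fs.2 x &
    nuint nu fs.2 - nuint nu fs.1 <= k.+1%:R^-1 * nuint nu W].
  have [|f1 [f2 h]] := hf (k.+1%:R^-1 * nuint nu W); first by rewrite mulr_gt0 ?invr_gt0.
  by exists (f1, f2).
have [fs {}hk] := choice hk.
have g1 k := (let: And5 a _ _ _ _ := hk k in a).2.
have g2 k := (let: And5 _ a _ _ _ := hk k in a).2.
have := ae_foralln g1; have := ae_foralln g2; apply: filterS2 => omega h2 h1 ix hix.
apply/cvgrPdist_le => e e0.
have e2 : 0 < e / 2 by rewrite divr_gt0.
have [k2 _ /(_ k2 (leqnn k2)) /= ke2] := near_infty_natSinv_lt (PosNum e2).
have [[i1 _] [i2 _] l1 l2 l3] := hk k2.
have /cvgrPdist_lt /(_ _ e2) c1 := h1 k2 ix hix.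
have /cvgrPdist_lt /(_ _ e2) c2 := h2 k2 ix hix.
move: c1 c2; apply: filterS2 => N.
have V0 := ltW W1.
have S0 : 0 <= (wsum F W x0 (pre ix N))^-1.
  by rewrite invr_ge0; elim: (pre ix N) x0 => [|i w IHw] x //=; rewrite addr_ge0.
have s1 := ler_wpM2r S0 (wsum_le x0 (pre ix N) l1).
have s2 := ler_wpM2r S0 (wsum_le x0 (pre ix N) l2).
have V1 : 0 <= (nuint nu W)^-1 by rewrite invr_ge0.
have n1 := ler_wpM2r V1 (nuint_mono i1 fi l1).
have n2 := ler_wpM2r V1 (nuint_mono fi i2 l2).
have n3 := ler_wpM2r V1 l3.
rewrite mulfK ?lt0r_neq0 // mulrBl in n3.
rewrite !ltr_distl ler_distl => /andP[a1 a2] /andP[b1 b2].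
move: (k2.+1%:R^-1) ke2 n3 => q ke2 n3; apply/andP; split; lra.
Qed.

Variable B : R.
Hypothesis B1 : 1 <= B.
Hypothesis good_itv : forall x y, - B <= x -> x <= y -> y <= B -> good (itv_ind x y).

Lemma itv_ind_split (a b c t : R) : a <= b -> b <= c ->
  itv_ind a c t = itv_ind a b t + itv_ind b c t.
Proof.
move=> ab bc; rewrite /itv_ind; case: (ltP a t) => h1; case: (leP t b) => h2 /=.
- by rewrite (le_trans h2 bc) addr0.
- by rewrite add0r.
- by rewrite addr0.
- by have := le_lt_trans (le_trans h1 ab) h2; rewrite ltxx.
Qed.

(** The step function takes on each piece of length h the value of f at the right endpoint;
    half-open pieces add up without overlap. *)
Lemma good_step f (a h e : R) (n : nat) : 0 <= h -> - B <= a -> a + n%:R * h <= B ->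
  (forall x y, a <= x <= a + n%:R * h -> a <= y <= a + n%:R * h -> `|y - x| <= h -> `|f y - f x| <= e) ->
  exists2 f1, good f1 & forall t, `|f t * itv_ind a (a + n%:R * h) t - f1 t| <= e * itv_ind a (a + n%:R * h) t.
Proof.
have B1' := B1; move=> h0 aB; have gi0 : good (fun=> 0).
  have -> : (fun=> 0) = itv_ind (0 : R) 0; last by apply: good_itv => //; lra.
  by apply/funext => t; rewrite /itv_ind; case: (ltP 0 t) => //= t0; rewrite leNgt t0.
elim: n => [|n IHn] nB hf.
  exists (fun=> 0) => // t; have -> : itv_ind a (a + 0 * h) t = 0.
    by rewrite /itv_ind mul0r addr0; case: (ltP a t) => //= t0; rewrite leNgt t0.
  by rewrite !mulr0 subrr normr0.
have nS : n.+1%:R * h = n%:R * h + h by rewrite -natr1 mulrDl mul1r.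
have nh : 0 <= n%:R * h by rewrite mulr_ge0.
have [||f1 gf1 hf1] := IHn; [by rewrite nS in nB; lra| |]; first by move=> x y hx hy; apply: hf; rewrite nS; lra.
pose b := a + n%:R * h; pose c := a + n.+1%:R * h.
have bc : b <= c by rewrite /b /c nS; lra.
have ab : a <= b by rewrite /b; lra.
exists (fun t => f c * itv_ind b c t + f1 t); first by apply: good_lin => //; apply: good_itv => //; lra.
move=> t; rewrite -/b -/c (itv_ind_split t ab bc) in hf1 *.
have := hf1 t; rewrite -/b; set p := itv_ind a b t; move: p => p hp.
apply: (@le_trans _ _ (`|f t * p - f1 t| + `|(f t - f c) * itv_ind b c t|)).
  by apply: le_trans (ler_normD _ _); rewrite le_eqVlt; apply/orP; left; apply/eqP; congr `|_|; ring.
rewrite mulrDr lerD // /itv_ind; case: (boolP (_ && _)) => [/andP[t1 t2]|_].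
  rewrite !mulr1 distrC; rewrite distrC; apply: hf; rewrite -/b -/c; rewrite ?ab; try lra.
  by rewrite distrC ger0_norm ?subr_ge0 //; move: t1 t2; rewrite /b /c nS; lra.
by rewrite !mulr0 normr0.
Qed.

Lemma good_tcont f : continuous f -> (forall x, B <= `|x| -> f x = 0) -> good f.
Proof.
move=> fc fr; apply: good_squeeze.
  by apply: tcont_integrable => //; split => //; exists B => x /ltW; exact: fr.
move=> e e0; have B1' := B1.
pose V := nuint nu (itv_ind (- B) B).
have BB : - B <= B by lra.
have V0 : 0 <= V by apply: Rintegral_ge0 => t _; rewrite ler0n.
(* The sandwich of f between f1 - e' and f1 + e' on ]-B, B] has gap 2 e' V, at most e. *)
pose e' := e / (2 * (V + 1)).
have e'0 : 0 < e' by rewrite divr_gt0 //; lra.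
have ee : 2 * (V + 1) * e' = e by rewrite /e' mulrC divfK //; lra.
have [m hm] := @unif_cont_segment _ f B _ fc e'0.
(* Enough pieces of [-B, B] for the mesh to fall below the modulus of continuity. *)
pose k := (Num.truncn (2 * B * m.+1%:R)).+1; pose h := 2 * B / k%:R.
have k0 : 0 < k%:R :> R by rewrite ltr0n.
have h0 : 0 < h by rewrite divr_gt0 //; lra.
have hm1 : h < m.+1%:R^-1.
  by rewrite /h ltr_pdivrMr // [ltRHS]mulrC ltr_pdivlMr ?ltr0n //; exact: truncnS_gt.
have kh : k%:R * h = 2 * B by rewrite /h mulrC divfK ?lt0r_neq0.
have aB : - B + k%:R * h = B by rewrite kh; ring.
have [|||f1 gf1 hf1] := @good_step f (- B) h e' k (ltW h0); rewrite ?aB //.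
  move=> x y hx hy xy; apply: hm; first by rewrite ler_norml.
  exact: le_lt_trans hm1.
rewrite aB in hf1.
have fB t : f t * itv_ind (- B) B t = f t.
  rewrite /itv_ind; case: (boolP (_ && _)) => [_|ht]; first by rewrite mulr1.
  rewrite mulr0 fr // leNgt; apply/negP; rewrite ltr_norml => /andP[t1 t2].
  by move/negP: ht; apply; rewrite t1 ltW.
exists (fun t => - e' * itv_ind (- B) B t + f1 t), (fun t => e' * itv_ind (- B) B t + f1 t).
have gB := good_itv (lexx _) BB (lexx _); split; [exact: good_lin|exact: good_lin|..].
- by move=> t; have := hf1 t; rewrite fB ler_norml; lra.
- by move=> t; have := hf1 t; rewrite fB ler_norml; lra.
- have [i1 _] := gf1; have [i2 _] := gB.
  rewrite !nuint_lin // -/V; move: ee; lra.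
Qed.

End good_functions.

Section ratio_limit.
Context d (Omega : measurableType d) {R : realType} (P : probability Omega R).
Variables (mu : probability (homeo R) R) (g : nat -> {RV P >-> homeo R}).
Hypothesis g_iid : iid mu g.
Variables (I : finType) (gen : I -> homeo R) (p : I -> R).
Hypothesis mu_gen : forall i, mu [set gen i] = (p i)%:E.
Hypothesis mu_tot : mu (range gen) = 1%E.
Variables (F : I -> R -> R) (s : I -> I).
Hypothesis H : symmetric_ifs p F s.
Hypothesis F_cont : forall i, continuous (F i).
Variable nu : {measure set (measurableTypeR R) -> \bar R}.
Hypothesis nu_radon : radon nu.
Hypothesis nu_nz : nonzero_measure nu.
Hypothesis nu_inv : forall A : set R, measurable A ->
  nu A = (\sum_i (p i)%:E * nu (F i @^-1` A))%E.
Hypothesis nodisc : forall x, ~ (closed (range (fun w => act F w x)) /\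
  range (fun w => act F w x) `<=` isolated (range (fun w => act F w x))).
Local Notation D := (cum nu).
Variable sec : R -> R.
Hypothesis secK : cancel sec D.
Variable x0 : R.
Implicit Types (f phi psi xi : R -> R) (x y : R).

Let D_cont : continuous D.
Proof. exact: (@cum_continuous _ _ _ _ _ H _ nu_radon nu_inv nodisc). Qed.
Let D_le : {homo D : x y / x <= y}.
Proof. by move=> x y; exact: cum_le. Qed.
Let D_harm := cum_harm H nu_radon nu_inv.
Let D_equi x y i := @cum_equi _ _ _ _ _ H _ nu_radon nu_inv x y i.
Let D_min := cum_minimal H nu_radon nu_inv nodisc.
Let nuD x y := @nu_itv _ nu nu_radon x y.

Lemma wsum_quo f x w : wsum (quo F D sec) f (D x) w = wsum F (f \o D) x w.
Proof. by elim: w x => [//|i w IHw] x /=; rewrite (quoE secK D_equi) IHw. Qed.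

Section weight.
Variables (r : R) (xi : R -> R).
Hypothesis r2 : 2 <= r.
Hypothesis w : ratio_weight p (quo F D sec) r xi.

(** xi is bounded below on [-r, r], which contains the support of a trapezoid of positive
    integral. *)
Lemma weight_nuint_gt0 : 0 < nuint nu (xi \o D).
Proof.
have [a a0 ha] := weight_lb w; have r2' := r2.
have tt : tcont (trap (- 2) 2 1 \o D).
  by apply: (tcont_compD D_cont D_le secK); exact: trap_tcont.
apply: (@lt_le_trans _ _ (a * nuint nu (trap (- 2) 2 1 \o D))).
  rewrite mulr_gt0 //.
  by apply: lt_le_trans (nuint_trap_ge nu_radon D_cont D_le secK nuD _ _ ltr01); lra.
rewrite -nuintZ //; apply: nuint_le => //.
- by apply: tcontM => //; exact: cst_continuous.
- exact: (tcont_compD D_cont D_le secK (weight_tcont w)).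
move=> x /=; case: (boolP (- 2 < D x < 2)) => [/andP[h1 h2]|h].
  apply: (@le_trans _ _ a); first by rewrite ler_piMr ?trap_le1 // ltW.
  by apply: ha; rewrite ler_norml; lra.
by rewrite trap_out // mulr0 (weight_ge0 w).
Qed.

Lemma good_lip phi L : lip L phi -> (forall x, 0 <= phi x) ->
  (forall x, r < `|x| -> phi x = 0) -> good g gen F nu x0 (xi \o D) (phi \o D).
Proof.
move=> phiL phi0 phir.
have tphi : tcont phi by split; [exact: lip_continuous phiL|exists r].
have [c [hc pois]] := weight_poisson w phiL phi0 phir.
split; first by apply: tcont_integrable => //; exact: (tcont_compD D_cont D_le secK).
have [a a0 ha] := weight_lb w; have [m hm] := tcont_bounded tphi.
have m0 : 0 <= m by apply: le_trans (hm 0).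
have qifs := quo_ifs H D_le secK D_harm D_equi D_min.
have nc : nuint nu (phi \o D) / nuint nu (xi \o D) = c.
  have := hc _ (quotient_functional H F_cont nu_radon nu_inv nodisc secK nu_radon nu_inv).
  by move=> ->; rewrite mulfK // lt0r_neq0 // weight_nuint_gt0.
have C0 : 0 <= m / a + `|c| by rewrite addr_ge0 // divr_ge0 // ltW.
have dom x : `|phi x - c * xi x| <= (m / a + `|c|) * xi x.
  case: (leP `|x| r) => xr; last first.
    rewrite phir // sub0r normrN normrM (ger0_norm (weight_ge0 w x)).
    by rewrite ler_wpM2r ?(weight_ge0 w) // lerDr divr_ge0 // ltW.
  apply: le_trans (ler_normB _ _) _; rewrite normrM (ger0_norm (weight_ge0 w x)) mulrDl lerD2r.
  apply: le_trans (hm x) _; rewrite mulrAC ler_pdivlMr // ler_wpM2l //; exact: ha.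
have := path_ratio g_iid mu_gen mu_tot qifs (D x0)
  (weight_ge0 w) (weight_le1 w) (weight_rec w) C0 dom pois.
apply: filterS => omega h ix hix; rewrite nc; have := h ix hix.
by under eq_fun do rewrite !wsum_quo.
Qed.

Lemma good_interval x y : x <= y -> `|D x| + 2 <= r -> `|D y| + 2 <= r ->
  good g gen F nu x0 (xi \o D) (itv_ind x y).
Proof.
move=> xy xr yr; have Dxy := D_le xy.
apply: good_squeeze => //.
- by move=> z; exact: (weight_ge0 w).
- exact: weight_nuint_gt0.
- exact: integ_itv.
(* Inner and outer trapezoids differ in integral by at most 4 q, and q <= 1 keeps the outer one
   inside [-r, r]. *)
move=> e e0; pose q := Num.min 1 (e / 4).
have q0 : 0 < q by rewrite lt_min ltr01 divr_gt0.
have q1 : q <= 1 by rewrite /q ge_min lexx.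
have qe : 4 * q <= e by rewrite mulrC -ler_pdivlMr // /q ge_min lexx orbT.
have gt u v : - r <= u -> v <= r -> good g gen F nu x0 (xi \o D) (trap u v q \o D).
  move=> ur vr; apply: (good_lip (L := q^-1)).
  - exact: trap_lip.
  - by move=> z; exact: trap_ge0.
  - move=> z zr; apply: trap_out => //; apply/negP => /andP[h1 h2].
    by move: zr; rewrite ltr_normr; case/orP; lra.
have := normr_ge0 (D x); have := normr_ge0 (D y).
have := ler_norm (D x); have := ler_norm (- D x); have := ler_norm (D y).
have := ler_norm (- D y); rewrite !normrN => b1 b2 b3 b4 b5 b6.
exists (trap (D x) (D y) q \o D), (trap (D x - q) (D y + q) q \o D); split.
- by apply: gt; lra.
- by apply: gt; lra.
- by move=> z; exact: trap_le_itvD.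
- by move=> z; exact: itv_le_trap.
- have := nuint_trap_ge nu_radon D_cont D_le secK nuD (D x) (D y) q0.
  have := @nuint_trap_le _ _ nu_radon _ _ D_cont D_le secK nuD (D x - q) (D y + q) _ q0.
  lra.
Qed.

End weight.

Lemma cesaro_ratio phi psi : tcont phi -> tcont psi -> 0 < nuint nu phi ->
  \forall omega \ae P, forall ix, (forall k, g k omega = gen (ix k)) ->
    (\sum_(1 <= n < N.+1) psi (act F (pre ix n) x0)) /
    (\sum_(1 <= n < N.+1) phi (act F (pre ix n) x0)) @[N --> \oo]
      --> nuint nu psi / nuint nu phi.
Proof.
move=> [cphi [r1 hr1]] [cpsi [r2 hr2]] phi_gt0.
pose B := `|r1| + `|r2| + 1; have n1 := normr_ge0 r1; have n2 := normr_ge0 r2.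
have l1 := ler_norm r1; have l2 := ler_norm r2.
have B1 : 1 <= B by rewrite /B; lra.
pose r := `|D (- B)| + `|D B| + 2.
have n3 := normr_ge0 (D (- B)); have n4 := normr_ge0 (D B).
have r2' : 2 <= r by rewrite /r; lra.
have [xi w] := quotient_weight H nu_radon nu_inv nodisc secK r.
have W0 x : 0 <= (xi \o D) x by exact: (weight_ge0 w).
have W1 := weight_nuint_gt0 r2' w.
have gi x y : - B <= x -> x <= y -> y <= B ->
    good g gen F nu x0 (xi \o D) (itv_ind x y).
  move=> Bx xy yB; have h1 := D_le Bx; have h2 := D_le xy; have h3 := D_le yB.
  have := ler_norm (- D (- B)); have := ler_norm (D B); rewrite normrN => b1 b2.
  apply: (good_interval r2' w) => //.
    by rewrite /r lerD2r ler_norml; lra.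
  by rewrite /r lerD2r ler_norml; lra.
have [_ gphi] : good g gen F nu x0 (xi \o D) phi.
  apply: (good_tcont nu_radon W0 W1 B1 gi) => // x hx; apply: hr1.
  by apply: lt_le_trans hx; rewrite /B; lra.
have [_ gpsi] : good g gen F nu x0 (xi \o D) psi.
  apply: (good_tcont nu_radon W0 W1 B1 gi) => // x hx; apply: hr2.
  by apply: lt_le_trans hx; rewrite /B; lra.
have qifs := quo_ifs H D_le secK D_harm D_equi D_min.
have := ae_unbounded g_iid mu_gen qifs (D x0) (weight_ge0 w) (weight_rec w).
move: gphi gpsi; apply: filterS3 => omega gphi gpsi unb ix hix.
have {}gphi := gphi ix hix; have {}gpsi := gpsi ix hix; have {}unb := unb ix hix.
pose S N := wsum F (xi \o D) x0 (pre ix N).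
have S_le : {homo S : m n / (m <= n)%N >-> m <= n}.
  apply: homo_leq => // [x y z|n]; first exact: le_trans.
  by rewrite /S pre_rcons wsum_rcons lerDl.
have SV : (S N)^-1 @[N --> \oo] --> 0.
  apply/cvgrPdist_le => e e0; have [N0 hN0] := unb e^-1; rewrite wsum_quo -/(S N0) in hN0.
  exists N0 => // N /= NN; rewrite sub0r normrN.
  have SN : e^-1 < S N by apply: lt_le_trans (S_le _ _ NN).
  have e1 : 0 < e^-1 by rewrite invr_gt0.
  rewrite ger0_norm ?invr_ge0; last exact: ltW (lt_trans e1 SN).
  by rewrite -[leRHS]invrK lef_pV2 ?posrE ?ltW // (lt_trans e1).
(* The statement sums over X_1, ..., X_N, while [wsum] starts at X_0; the shift costs the single
   term f x0, negligible against the diverging [S]. *)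
have sumE f N : \sum_(1 <= n < N.+1) f (act F (pre ix n) x0) =
    wsum F f x0 (pre ix N.+1) - f x0.
  by rewrite wsum_pre -(big_mkord xpredT (fun n => f (act F (pre ix n) x0)))
    [in RHS]big_ltn //= addrC addKr.
have sh (u : nat -> R) (l : R) : u N @[N --> \oo] --> l -> u N.+1 @[N --> \oo] --> l.
  by move=> hu; rewrite (cvg_shiftS u).
have lim f (l : R) : wsum F f x0 (pre ix N) / S N @[N --> \oo] --> l ->
    (\sum_(1 <= n < N.+1) f (act F (pre ix n) x0)) / S N.+1 @[N --> \oo] --> l.
  move=> hf; under eq_fun do rewrite sumE mulrBl.
  have := cvgB (sh _ _ hf) (cvgMr (a := f x0) (sh _ _ SV)).
  by rewrite mulr0 subr0 => h; exact: h.
have -> : nuint nu psi / nuint nu phi =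
    (nuint nu psi / nuint nu (xi \o D)) / (nuint nu phi / nuint nu (xi \o D)).
  by rewrite invf_div mulrA divfK // lt0r_neq0.
have c0 : nuint nu phi / nuint nu (xi \o D) != 0 by rewrite lt0r_neq0 // divr_gt0.
have key := cvgM (lim _ _ gpsi) (cvgV c0 (lim _ _ gphi)).
apply: cvg_trans (key _ _); apply: near_eq_cvg.

(* [S N.+1] can be cancelled once it has become positive. *)
have [N0 hN0] := unb 0; rewrite wsum_quo -/(S N0) in hN0.
exists N0 => // N /= NN.
have SN : 0 < S N.+1 by apply: lt_le_trans (S_le _ _ (leqW NN)).
by rewrite invf_div mulrA divfK // lt0r_neq0.
Qed.

End ratio_limit.

(** * The support of an invariant measure *)

Section support.
Context {R : realType} {I : finType} (p : I -> R) (F : I -> R -> R) (s : I -> I).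
Hypothesis H : symmetric_ifs p F s.
Hypothesis F_cont : forall i, continuous (F i).
Variable nu : {measure set (measurableTypeR R) -> \bar R}.
Hypothesis nu_radon : radon nu.
Hypothesis nu_nz : nonzero_measure nu.
Hypothesis nu_inv : forall A : set R, measurable A ->
  nu A = (\sum_i (p i)%:E * nu (F i @^-1` A))%E.
Hypothesis nodisc : forall x, ~ (closed (range (fun w => act F w x)) /\
  range (fun w => act F w x) `<=` isolated (range (fun w => act F w x))).

Lemma msupport_closed : closed (msupport nu).
Proof.
rewrite -openC openE => x /= nx; apply: contrapT => hx; apply: nx => U oU Ux.
rewrite lt_neqAle measure_ge0 andbT; apply/negP => /eqP U0; apply: hx.
apply: filterS (open_nbhs_nbhs (conj oU Ux)) => y Uy.
by move=> /(_ U oU Uy); rewrite -U0 ltxx.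
Qed.

Lemma msupport_invariant i x : msupport nu x -> msupport nu (F i x).
Proof.
move=> sx U oU Ux; rewrite nu_inv; last exact: open_measurable.
rewrite (bigD1 i) //=; apply: (@lt_le_trans _ _ ((p i)%:E * nu (F i @^-1` U))%E).
  rewrite mule_gt0 ?lte_fin ?(ifs_gt0 H) //; apply: sx => //.
  by apply: open_comp => // y _; exact: F_cont.
rewrite leeDl //; apply: sume_ge0 => j _.
by rewrite mule_ge0 ?lee_fin ?(p_ge0 H).
Qed.

Lemma msupport_neq0 : msupport nu !=set0.
Proof.
(* [cum] is at most 0 before sup E and positive after it, so every neighbourhood of sup E has
   positive mass. *)
pose E := [set t | cum nu t <= 0].
have hE : has_sup E.
  split; first by have [x /ltW hx] := cum_lbound H nu_radon nu_nz nu_inv 0; exists x.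
  have [y hy] := cum_ubound H nu_radon nu_nz nu_inv 0; exists y => t Et.
  by apply: ltW; apply: (cum_lt nu_radon); exact: le_lt_trans hy.
exists (sup E) => U oU Ux.
have /nbhs_ballP[e /= e0 he] : nbhs (sup E) U by exact: open_nbhs_nbhs.
have e2 : 0 < e / 2 by rewrite divr_gt0.
have eh : e / 2 < e by rewrite ltr_pdivrMr // ltr_pMr // ltr1n.
apply: (@lt_le_trans _ _ (nu `]sup E - e / 2, sup E + e / 2]%classic)); last first.
  apply: nu_le; [exact: measurable_itv|exact: open_measurable|].
  move=> t; rewrite /= in_itv /= => /andP[t1 t2]; apply: he.
  by change (`|sup E - t| < e); rewrite ltr_norml; lra.
rewrite nu_itv //; last by lra.
rewrite lte_fin subr_gt0.
have [t Et ht] := sup_adherent e2 hE.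
apply: (@le_lt_trans _ _ 0).
  by apply: le_trans Et; apply: cum_le => //; exact: ltW.
rewrite ltNge; apply/negP => h.
have : sup E + e / 2 <= sup E by apply: sup_upper_bound.
lra.
Qed.

(** Outside M every point has a neighbourhood contained in a gap of M, hence null. *)
Lemma msupport_sub M : M !=set0 -> closed M -> (forall i x, M x -> M (F i x)) ->
  msupport nu `<=` M.
Proof.
move=> M0 cM MF x sx; apply: contrapT => nMx.
have /nbhs_ballP[e /= e0 he] : nbhs x (~` M) by apply: open_nbhs_nbhs; split => //; exact: closed_openC.
have := sx `]x - e, x + e[%classic (itv_open _ _); rewrite /= in_itv /=.
have -> : x - e < x < x + e by have e0' : 0 < e by []; lra.
move=> /(_ isT); rewrite (gap_null H nu_radon nu_inv nodisc (A := M)) ?ltxx //.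
by move=> y hy; apply: he; change (`|x - y| < e); rewrite ltr_norml; lra.
Qed.

End support.

Lemma compactly_supported_tcont (R : realType) (f : R -> R) :
  continuous f -> compactly_supported f -> tcont f.
Proof.
move=> fc /compact_bounded[M [_ hM]]; split => //; exists (M + 1) => x Mx.
apply/eqP; apply: contraT => fx; move: Mx; rewrite ltNge => /negP; case.
apply: (hM (M + 1)); first by rewrite ltrDl.
exact: subset_closure.
Qed.

(** * From finitely supported measures to indexed systems *)

Section finite_support.
Context {R : realType} (mu : probability (homeo R) R).
Hypothesis mu_sym : symmetric_measure mu.
Hypothesis mu_fin : finitely_supported mu.
Local Notation S := (fset_set (atoms mu)).
Implicit Types (i : S) (h : homeo R).

Definition incr i : homeo R := val i.
Definition atom_mass i : R := fine (mu [set incr i]).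

Lemma incr_atom i : atoms mu (incr i).
Proof. by have [fin _] := mu_fin; have := valP i; rewrite in_fset_set // inE. Qed.

Lemma inv_atom h : h \in S -> h^-1%g \in S.
Proof.
have [fin _] := mu_fin; rewrite !in_fset_set // !inE => hS.
by rewrite /atoms /= -mu_sym.
Qed.

Definition inv_incr i : S := [` inv_atom (valP i)]%fset.

Lemma range_incr : range incr = atoms mu.
Proof.
apply/seteqP; split => [_ [i _ <-]|h hS]; first exact: incr_atom.
have [fin _] := mu_fin; have hS' : h \in S by rewrite in_fset_set // inE.
by exists [` hS']%fset.
Qed.

Lemma mu_incr i : mu [set incr i] = (atom_mass i)%:E.
Proof. by rewrite /atom_mass fineK // fin_num_measure //; exact: measurable_homeo_set1. Qed.

Lemma sum_atoms (f : homeo R -> \bar R) :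
  (\sum_(h \in atoms mu) f h = \sum_i f (incr i))%E.
Proof. by have [fin _] := mu_fin; rewrite fsbig_finite //= big_seq_fsetE. Qed.

Lemma act_walk d (Omega : measurableType d) (P : probability Omega R)
  (g : nat -> {RV P >-> homeo R}) (omega : Omega) (ix : nat -> S) (n : nat) (x : R) :
  (forall k, g k omega = incr (ix k)) ->
  walk g n omega x = act (fun i => incr i : R -> R) (pre ix n) x.
Proof.
move=> hix; elim: n => [//|n IHn].
by rewrite pre_rcons act_rcons -IHn -hix.
Qed.

Local Notation F := (fun i => incr i : R -> R).

(** The group element is the product of the letters in reverse order, since the first letter acts
    first. *)
Lemma act_group w : exists2 h, generated_group (atoms mu) h & forall x, act F w x = h x.
Proof.
elim: w => [|i w [h Gh hE]].
  by exists 1%g => [A /= [[A1 _ _] _]|x].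
exists (h * incr i)%g => [A /= [[A1 AM AV] sA]|x /=]; last by rewrite hE.
by apply: (AM); [exact: (Gh A (conj (And3 A1 AM AV) sA))|apply: sA; exact: incr_atom].
Qed.

Hypothesis G_irr : irreducible (generated_group (atoms mu)).

Lemma incr_ifs : symmetric_ifs atom_mass F inv_incr.
Proof.
have K i : cancel (incr i) (incr (inv_incr i)) by move=> x; exact: homeoVK.
split.
- by move=> i; rewrite -lte_fin -mu_incr; exact: incr_atom.
- apply: EFin_inj; rewrite -sumEFin.
  under eq_bigr do rewrite -mu_incr.
  rewrite -(sum_atoms (fun h => mu [set h])); have [fin <-] := mu_fin.
  rewrite -measure_fin_bigcup //; first by rewrite bigcup_imset1 image_id.
  - by move=> h h' _ _ [z [-> ->]].
  - by move=> h _; exact: measurable_homeo_set1.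
- by move=> i x y; exact: homeo_incr.
- by move=> i; apply: val_inj; rewrite /= invgK.
- by move=> i; rewrite /atom_mass [in RHS]mu_sym.
- exact: K.
(* The stabiliser of x is a subgroup; if it contains all atoms, it contains the group they
   generate. *)
- move=> x; apply: contrapT => /forallNP hx; apply: G_irr; exists x => h Gh.
  apply: (Gh [set h | h x = x]); split; last first.
    move=> k; rewrite -range_incr => -[i _ <-] /=.
    by have /negP := hx i; rewrite negbK => /eqP.
  split => [//|k l /= kx lx|k /= kx]; first by rewrite /= lx kx.
  by rewrite -{1}kx; exact: homeoVK.
Qed.

Lemma group_act h : generated_group (atoms mu) h -> exists w, forall x, h x = act F w x.
Proof.
move=> Gh; apply: (Gh [set h : homeo R | exists w, forall x, h x = act F w x]); split.
  split => [|k l [w hw] [v hv]|k [w hw]]; first by exists [::].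
    by exists (v ++ w) => x; rewrite act_cat -hv -hw.
  have [v hv] := act_inv incr_ifs w; exists v => x.
  by rewrite -{2}(homeoKV k x) hw hv.
move=> k ak; have [i _ <-] : range incr k by rewrite range_incr.
by exists [:: i].
Qed.

Lemma orbitE x : homeo_orbit (generated_group (atoms mu)) x = range (fun w => act F w x).
Proof.
apply/seteqP; split => [_ [h /group_act[w hw] <-]|_ [w _ <-]]; first by exists w.
by have [h Gh hE] := act_group w; exists h.
Qed.

Lemma invariant_sum (nu : {measure set (measurableTypeR R) -> \bar R}) :
  P_invariant mu nu -> forall A : set R, measurable A ->
  nu A = (\sum_i (atom_mass i)%:E * nu (incr i @^-1` A))%E.
Proof.
move=> nu_inv A mA; rewrite nu_inv // sum_atoms; apply: eq_bigr => i _.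
by rewrite mu_incr.
Qed.

End finite_support.

Theorem theorem6p5 (R : realType) (mu : probability (homeo R) R)
  (mu_sym : symmetric_measure mu)
  (mu_fin : finitely_supported mu)
  (G : set (homeo R)) (GE : G = generated_group (atoms mu))
  (G_irr : irreducible G)
  (G_nodisc : ~ exists x : R, discrete_orbit G x)
  (M : set R) (M_min : minimal_closed_invariant G M) :
  (forall nu nu' : {measure set (measurableTypeR R) -> \bar R},
     radon nu -> nonzero_measure nu -> P_invariant mu nu ->
     radon nu' -> nonzero_measure nu' -> P_invariant mu nu' ->
     exists2 c : R, 0 < c &
       forall A : set (measurableTypeR R), measurable A ->
         nu' A = (c%:E * nu A)%E)
  /\
  (forall nu : {measure set (measurableTypeR R) -> \bar R},
     radon nu -> nonzero_measure nu -> P_invariant mu nu ->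
     msupport nu = M
     /\
     forall (d : measure_display) (Omega : measurableType d)
       (P : probability Omega R) (g : nat -> {RV P >-> homeo R}),
       iid mu g ->
       forall (phi psi : R -> R),
       continuous phi -> compactly_supported phi ->
       continuous psi -> compactly_supported psi ->
       (forall y, 0 <= phi y) -> 0 < \int[nu]_y phi y ->
       forall x : R,
       \forall w \ae P,
         (\sum_(1 <= n < N.+1) psi (walk g n w x)) /
         (\sum_(1 <= n < N.+1) phi (walk g n w x)) @[N --> \oo]
         --> (\int[nu]_y psi y) / (\int[nu]_y phi y)).
Proof.
subst G; have H := incr_ifs mu_sym mu_fin G_irr.
pose F i : R -> R := @incr R mu i.
have F_cont i : continuous (F i) by exact: homeo_cont.
have nodisc x : ~ (closed (range (fun w => act F w x)) /\
    range (fun w => act F w x) `<=` isolated (range (fun w => act F w x))).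
  by rewrite -(orbitE mu_sym mu_fin G_irr) => h; apply: G_nodisc; exists x.
split => [nu nu' rnu nnu inu rnu' nnu' inu'|nu rnu nnu inu].
  have sinu := invariant_sum mu_fin inu; have sinu' := invariant_sum mu_fin inu'.
  have [sec secK] := cum_section H rnu nnu sinu nodisc.
  have [k k0 hk] := proportional H F_cont rnu sinu nodisc secK rnu' sinu'.
  exists k => //; rewrite lt_neqAle k0 andbT; apply/eqP => k00.
  by move: nnu'; rewrite /nonzero_measure hk // -k00 mul0e eqxx.
have sinu := invariant_sum mu_fin inu.
have [[M0 cM Minv] Mmin] := M_min.
have incrG i : generated_group (atoms mu) (@incr R mu i).
  by move=> A [_ sA]; apply: sA; exact: (incr_atom mu_fin).
split.
  (* The support is a nonempty closed invariant set, and it lies in M because the gaps of M are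
     null; minimality gives equality. *)
  apply: Mmin; last first.
    apply: (msupport_sub H rnu sinu nodisc M0 cM) => i x Mx.
    by apply: (Minv _ (incrG i)); exists x.
  split; [exact: (msupport_neq0 H rnu nnu sinu)|exact: msupport_closed|].
  move=> h /(group_act mu_sym mu_fin G_irr)[w hw] _ [x sx <-]; rewrite hw.
  elim: w {hw} x sx => [//|i w IHw] x sx /=; apply: IHw.
  exact: (msupport_invariant H F_cont sinu).
move=> d Omega P g g_iid phi psi cphi sphi cpsi spsi phi0 phi_gt0 x.
have [sec secK] := cum_section H rnu nnu sinu nodisc.
have mu_tot : mu (range (@incr R mu)) = 1%E by have [_ tot] := mu_fin; rewrite range_incr.
have tphi := compactly_supported_tcont cphi sphi.
have tpsi := compactly_supported_tcont cpsi spsi.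
have := cesaro_ratio g_iid (mu_incr (mu := mu)) mu_tot H F_cont rnu sinu nodisc secK x
  tphi tpsi phi_gt0.
(* Almost every path has all its increments among the atoms, so it is spelled by some index sequence
   [ix]. *)
have := ae_range g_iid mu_tot; apply: filterS2 => omega hr hlim.
have [ix hix] := choice (fun k => let: ex_intro2 i _ e := hr k in ex_intro _ i e).
have := hlim ix (fun k => esym (hix k)).
by under eq_fun do rewrite
  (eq_bigr _ (fun n _ => congr1 psi (esym (act_walk n x (fun k => esym (hix k))))))
  (eq_bigr _ (fun n _ => congr1 phi (esym (act_walk n x (fun k => esym (hix k)))))).
Qed.
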